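(* Let $(\mathcal{A},\mathcal{T},\mathcal{G})$ be a regularity structure which contains the polynomial regularity structure, the latter providing its only elements of integer homogeneity, and let $(\Pi,\Gamma)$ be a model. Let $p,p',q,q'\in[1,\infty]$ and $\gamma,\gamma'>0$ with $\gamma,\gamma'\notin\mathcal{A}$. The space $\mathcal{D}^\gamma_{p,q}$ is continuously embedded into $\mathcal{D}^{\gamma'}_{p',q'}$ in any of the following settings: 1. $q'>q$, $p'=p$ and $\gamma'=\gamma$; 2. $q'\le q$, $p'=p$ and $\gamma'<\gamma$; 3. $q'=q$, $p'<p$ and $\gamma'=\gamma$, in the periodic case; 4. $q'=q$, $p'>p$ and $\gamma'<\gamma-|\mathfrak{s}|\big(\frac1p-\frac1{p'}\big)$.
   Context: Notation. $\mathbb{N}=\{0,1,2,\dots\}$. Fix a scaling $\mathfrak{s}=(\mathfrak{s}_1,\dots,\mathfrak{s}_d)$ of integers $\mathfrak{s}_i\ge1$; $|\mathfrak{s}|=\sum_i\mathfrak{s}_i$, $\|x\|_{\mathfrak{s}}=\sup_i|x_i|^{1/\mathfrak{s}_i}$, and $B(x,\varrho)$ is the closed ball of centre $x$ and radius $\varrho$ for $\|\cdot\|_{\mathfrak{s}}$. For $k\in\mathbb{N}^d$, $X^k=\prod_iX_i^{k_i}$ and $|k|_{\mathfrak{s}}=\sum_i\mathfrak{s}_ik_i$ is its scaled degree. $L^p=L^p(\mathbb{R}^d,dx)$ with integration variable $x$. $\mathscr{B}^r$ is the set of smooth functions on $\mathbb{R}^d$ supported in $B(0,1)$ whose $\mathcal{C}^r$-norm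 (derivatives of order $k$, $|k|_{\mathfrak{s}}\le r$) is at most $1$. $\eta^\lambda_x(y)=\lambda^{-|\mathfrak{s}|}\eta\big(\lambda^{-\mathfrak{s}_1}(y_1-x_1),\dots,\lambda^{-\mathfrak{s}_d}(y_d-x_d)\big)$. $\mathcal{D}'(\mathbb{R}^d)$ is the space of tempered distributions. Regularity structures. A regularity structure $(\mathcal{A},\mathcal{T},\mathcal{G})$ consists of: a locally finite set $\mathcal{A}\subset\mathbb{R}$ bounded from below; a graded vector space $\mathcal{T}=\bigoplus_{\zeta\in\mathcal{A}}\mathcal{T}_\zeta$ of finite sequences indexed by $\mathcal A$, each $\mathcal{T}_\zeta$ being a Banach space; a group $\mathcal{G}$ of continuous linear transformations of $\mathcal{T}$ with $\Gamma\tau-\tau\in\mathcal{T}_{<\zeta}:=\bigoplus_{\beta<\zeta}\mathcal{T}_\beta$ for all $\Gamma\in\mathcal{G}$, $\tau\in\mathcal{T}_\zeta$. $\mathcal{Q}_\zeta$ is the projection onto $\mathcal{T}_\zeta$ and $|\tau|_\zeta$ the norm of $\mathcal{Q}_\zeta\tau$. $\mathcal{A}_\gamma=\mathcal{A}\cap(-\infty,\gamma)$. The polynomial regularity structure has homogeneities $\mathbb{N}$, level $\zeta$ being the polynomials in $X_1,\dots,X_d$ of scaled degree $\zeta$, and structure group the translations acting on polynomials. Fix $r\in\mathbb{N}$ with $r>|\zeta|$ for all $\zeta\in\mathcal{A}_\gamma$. Models. A model $(\Pi,\Gamma)$ consists of linear maps $\Pi_x:\mathcal{T}_{<\gamma}\to\mathcal{D}'(\mathbb{R}^d)$,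 $x\in\mathbb{R}^d$, and elements $\Gamma_{x,y}\in\mathcal{G}$, $x,y\in\mathbb R^d$, with $\Pi_x\Gamma_{x,y}=\Pi_y$, $\Gamma_{x,y}\Gamma_{y,z}=\Gamma_{x,z}$, acting canonically on polynomials ($(\Pi_xX^k)(y)=(y-x)^k$, $\Gamma_{x,y}X^k=(X+x-y)^k$), and such that $$\sup_x\sup_{\eta\in\mathscr{B}^r}\sup_{\lambda\in(0,1]}\sup_{\zeta\in\mathcal{A}_\gamma}\sup_{\tau\in\mathcal{T}_\zeta}\frac{|\langle\Pi_x\tau,\eta_x^\lambda\rangle|}{|\tau|\lambda^\zeta}<\infty,\qquad\sup_x\sup_{y\in B(x,1)}\sup_{\beta\le\zeta\in\mathcal{A}_\gamma}\sup_{\tau\in\mathcal{T}_\zeta}\frac{|\Gamma_{x,y}\tau|_\beta}{|\tau|\,\|x-y\|_{\mathfrak{s}}^{\zeta-\beta}}<\infty.$$ Modelled distributions. $\mathcal{D}^\gamma_{p,q}$ is the Banach space of measurable $f:\mathbb{R}^d\to\mathcal{T}_{<\gamma}$ such that for all $\zeta\in\mathcal{A}_\gamma$ both quantities $$\big\||f(x)|_\zeta\big\|_{L^p},\qquad\bigg(\int_{h\in B(0,1)}\bigg\|\frac{|f(x+h)-\Gamma_{x+h,x}f(x)|_\zeta}{\|h\|_{\mathfrak{s}}^{\gamma-\zeta}}\bigg\|_{L^p}^q\frac{dh}{\|h\|_{\mathfrak{s}}^{|\mathfrak{s}|}}\bigg)^{1/q}$$ are finite (usual modification if $q=\infty$);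 its norm is the sum over $\zeta$ of these quantities. Embedding. When $\gamma'<\gamma$, the embedding of $\mathcal{D}^\gamma_{p,q}$ into $\mathcal{D}^{\gamma'}_{p',q'}$ is understood as the map sending $f$ to its restriction (projection) $\sum_{\zeta\in\mathcal{A}_{\gamma'}}\mathcal{Q}_\zeta f$ to $\mathcal{T}_{<\gamma'}$; the statement is that this map is well defined and continuous. Periodic case. This means that the model is periodic on some torus of $\mathbb{R}^d$: there is a full-rank lattice $L\subset\mathbb{R}^d$ of translations such that $\Pi_{x+\ell}\tau$ is the translate by $\ell$ of $\Pi_x\tau$ and $\Gamma_{x+\ell,y+\ell}=\Gamma_{x,y}$ for all $\ell\in L$. One then restricts the spaces $\mathcal{D}^\gamma_{p,q}$ to elements $f$ with $f(x+\ell)=f(x)$ for $\ell\in L$, and the integrals in $x$ in the norms are restricted to one period. *)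

(* Defs.v *)
From HB Require Import structures.
From mathcomp Require Import all_boot all_order all_algebra.
From mathcomp Require mpoly.
(* The notations of mpoly clash with those of MathComp-Analysis; importing it
   first lets the Analysis names (Measure, isMeasure) shadow its own. *)
Import -(notations) mpoly.
From mathcomp Require Import all_classical all_reals all_analysis.
From mathcomp Require Import ess_sup_inf.

Set Implicit Arguments.
Unset Strict Implicit.
Unset Printing Implicit Defensive.
Import Order.TTheory GRing.Theory Num.Theory.
Import numFieldNormedType.Exports.

Local Open Scope classical_set_scope.
Local Open Scope ring_scope.

(* Borel sets of R^n, generated by the coordinates *)
Definition rV_display : measure_display. Proof. exact. Qed.

Section rV_measurable.
Context {R : realType} {n : nat}.

Let coords (i : 'I_n) (x : 'rV[R]_n) : measurableTypeR R := x ord0 i.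

Let rV_measurable0 : g_sigma_preimage coords set0.
Proof. exact: sigma_algebra0. Qed.

Let rV_measurableC A : g_sigma_preimage coords A -> g_sigma_preimage coords (~` A).
Proof. exact: sigma_algebraC. Qed.

Let rV_measurable_bigcup (F : (set 'rV[R]_n)^nat) :
  (forall i, g_sigma_preimage coords (F i)) ->
  g_sigma_preimage coords (\bigcup_i (F i)).
Proof. exact: sigma_algebra_bigcup. Qed.

HB.instance Definition _ := @isMeasurable.Build rV_display 'rV[R]_n
  (g_sigma_preimage coords) rV_measurable0 rV_measurableC rV_measurable_bigcup.

Lemma measurable_coord (i : 'I_n) :
  measurable_fun setT (fun x : 'rV[R]_n => x ord0 i : measurableTypeR R).
Proof.
move=> _ Y mY; rewrite setTI; apply: sub_sigma_algebra => /=.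
rewrite -bigcup_seq/=; exists i => /=; first by rewrite mem_index_enum.
by exists Y => //; rewrite setTI.
Qed.

Lemma measurable_fun_rV d (T : measurableType d) (f : T -> 'rV[R]_n) :
  (forall i, measurable_fun setT (fun x => f x ord0 i : measurableTypeR R)) ->
  measurable_fun setT f.
Proof.
move=> mf.
suff prefS : g_sigma_preimage (fun i => coords i \o f) `<=` measurable.
  move: prefS; rewrite g_sigma_preimage_comp => prefS _ A mA.
  by apply: prefS; exists A.
apply: smallest_sub; first exact: sigma_algebra_measurable.
move: mf; rewrite /coords; case: n f => [|m] f mf; first by rewrite big_ord0.
rewrite -bigcup_mkord_ord; apply: bigcup_sub => i Ii.
by move=> A [B mB <-]; exact: mf.
Qed.

End rV_measurable.

Section lebesgue_rV.
Context {R : realType}.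

Definition rV_cons n (p : measurableTypeR R * 'rV[R]_n) : 'rV[R]_n.+1 :=
  row_mx (p.1)%:M p.2 : 'rV[R]_(1 + n).

Lemma rV_cons0 n p : @rV_cons n p ord0 ord0 = p.1.
Proof.
rewrite /rV_cons (_ : ord0 = @lshift 1 n ord0 :> 'I_n.+1); last exact/val_inj.
by rewrite (@row_mxEl _ _ 1 n) mxE mulr1n.
Qed.

Lemma rV_consS n p i : @rV_cons n p ord0 (lift ord0 i) = p.2 ord0 i.
Proof.
rewrite /rV_cons (_ : lift ord0 i = @rshift 1 n i); last exact/val_inj.
exact: (@row_mxEr _ _ 1 n).
Qed.

Lemma measurable_rV_cons n : measurable_fun setT (@rV_cons n).
Proof.
apply: measurable_fun_rV => i; case: (unliftP ord0 i) => [j|] ->.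
  rewrite (_ : (fun _ => _) =
      (fun x : 'rV[R]_n => x ord0 j : measurableTypeR R) \o snd).
    by apply: measurableT_comp; [exact: measurable_coord|exact: measurable_snd].
  by apply/funext => x; rewrite rV_consS.
rewrite (_ : (fun _ => _) = fst); first exact: measurable_fst.
by apply/funext => x; rewrite rV_cons0.
Qed.

Definition rV_uncons n (x : 'rV[R]_n.+1) : measurableTypeR R * 'rV[R]_n :=
  ((x : 'rV[R]_(1 + n)) ord0 (lshift n ord0), rsubmx (x : 'rV[R]_(1 + n))).

Lemma measurable_rV_uncons n : measurable_fun setT (@rV_uncons n).
Proof.
apply/measurable_fun_pairP; split.
  exact: (@measurable_coord R n.+1 (@lshift 1 n ord0)).
apply: measurable_fun_rV => i.
rewrite (_ : (fun _ => _) =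
    fun x : 'rV[R]_n.+1 => x ord0 (@rshift 1 n i) : measurableTypeR R).
  exact: measurable_coord.
by apply/funext => x /=; rewrite mxE.
Qed.

Lemma rV_consK n : cancel (@rV_cons n) (@rV_uncons n).
Proof.
move=> [a v]; rewrite /rV_cons /rV_uncons/=; congr (_, _).
  by rewrite row_mxEl mxE mulr1n.
by rewrite row_mxKr.
Qed.

Lemma rV_unconsK n : cancel (@rV_uncons n) (@rV_cons n).
Proof.
move=> x; rewrite /rV_cons /rV_uncons/=.
rewrite -[RHS](@hsubmxK _ 1 1 n); congr (@row_mx _ 1 1 n _ _).
by apply/matrixP => i j; rewrite !ord1 !mxE mulr1n.
Qed.

Section step.
Context {n : nat} (mu : {sigma_finite_measure set 'rV[R]_n -> \bar R}).
Local Open Scope ereal_scope.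

Definition lebesgue_rV_step : set 'rV[R]_n.+1 -> \bar R :=
  pushforward (lebesgue_measure \x mu) (@rV_cons n).

Let step0 : lebesgue_rV_step set0 = 0.
Proof. by rewrite /lebesgue_rV_step /pushforward preimage_set0 measure0. Qed.

Let step_ge0 A : 0 <= lebesgue_rV_step A.
Proof. exact: (measure_ge0 (lebesgue_measure \x mu)). Qed.

Let step_sigma_additive : semi_sigma_additive lebesgue_rV_step.
Proof.
have mcons (B : set 'rV[R]_n.+1) : measurable B -> measurable (@rV_cons n @^-1` B).
  by move=> mB; rewrite -[X in measurable X]setTI; exact: measurable_rV_cons.
move=> F mF tF mUF; rewrite /lebesgue_rV_step /pushforward preimage_bigcup.
apply: (measure_semi_sigma_additive (s := lebesgue_measure \x mu)).
- by move=> i; exact: mcons.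
- apply/trivIsetP => /= i j _ _ ij; rewrite -preimage_setI.
  by move/trivIsetP : tF => /(_ _ _ _ _ ij) ->//; rewrite preimage_set0.
- by rewrite -preimage_bigcup; exact: mcons.
Qed.

HB.instance Definition _ := isMeasure.Build _ _ _ lebesgue_rV_step
  step0 step_ge0 step_sigma_additive.

Let step_sigma_finite : sigma_finite setT lebesgue_rV_step.
Proof.
have /sigma_finiteP[F [TF ndF Foo]] :=
  sigma_finiteT (@lebesgue_measure R : {sigma_finite_measure set _ -> \bar R}).
have /sigma_finiteP[G [TG ndG Goo]] := sigma_finiteT mu.
exists (fun k => @rV_uncons n @^-1` (F k `*` G k)).
  rewrite -preimage_bigcup -[LHS](preimage_setT (@rV_uncons n)).
  congr (_ @^-1` _); rewrite -setXTT TF TG predeqE => -[x y]; split.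
    move=> [/= [k _ Fkx] [l _ Gly]]; exists (maxn k l) => //; split => /=.
    - by have /subsetPset := ndF k (maxn k l) (leq_maxl _ _); exact.
    - by have /subsetPset := ndG l (maxn k l) (leq_maxr _ _); exact.
  by move=> [k _ []/= ? ?]; split; exists k.
move=> k; have [? ?] := Foo k; have [? ?] := Goo k.
have mX : measurable (F k `*` G k) by exact: measurableX.
split; first by rewrite -[X in measurable X]setTI; exact: measurable_rV_uncons.
rewrite /lebesgue_rV_step /pushforward -comp_preimage.
rewrite (_ : _ \o _ = id) ?preimage_id; last first.
  by apply/funext => x /=; rewrite rV_consK.
by rewrite product_measure1E// lte_mul_pinfty// ge0_fin_numE.
Qed.

HB.instance Definition _ := Measure_isSigmaFinite.Build _ _ _ lebesgue_rV_step
  step_sigma_finite.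
End step.

Fixpoint lebesgue_rV (n : nat) : {sigma_finite_measure set 'rV[R]_n -> \bar R} :=
  if n is m.+1 then lebesgue_rV_step (lebesgue_rV m) else dirac (0 : 'rV[R]_0).

End lebesgue_rV.

Lemma lebesgue_rV_box {R : realType} n (B : 'I_n -> set (measurableTypeR R)) :
  (forall i, measurable (B i)) ->
  lebesgue_rV n [set x : 'rV[R]_n | forall i, B i (x ord0 i)] =
  (\prod_(i < n) lebesgue_measure (B i))%E.
Proof.
elim: n B => [|n IH] B mB.
  rewrite big_ord0 /= /dirac indicE mem_set//.
  by case.
rewrite big_ord_recl.
pose B' i := B (lift ord0 i).
transitivity ((lebesgue_measure \x lebesgue_rV n)%E
    (B ord0 `*` [set x : 'rV[R]_n | forall i, B' i (x ord0 i)])).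
  congr ((lebesgue_measure \x lebesgue_rV n)%E _).
  rewrite predeqE => -[a v]; split => [H|[/= Ba Bv] i].
    split => [|i] /=; first by have := H ord0; rewrite rV_cons0.
    by have := H (lift ord0 i); rewrite rV_consS.
  by case: (unliftP ord0 i) => [j|] ->; rewrite ?rV_consS ?rV_cons0//; exact: Bv.
rewrite product_measure1E//; first by rewrite IH// => i; exact: mB.
rewrite (_ : [set _ | _] = \bigcap_(i in [set: 'I_n])
    ((fun x : 'rV[R]_n => x ord0 i : measurableTypeR R) @^-1` B' i)); last first.
  by rewrite predeqE => x; split => [H i _|H i]; exact: H.
apply: fin_bigcap_measurable => // i _.
by rewrite -[X in measurable X]setTI; apply: measurable_coord => //; exact: mB.
Qed.

Section scaling.
Context {R : realType} {d : nat} (s : 'I_d -> nat).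
Local Notation Rd := 'rV[R]_d.

Definition scale_deg : nat := (\sum_(i < d) s i)%N.

Definition snorm (x : Rd) : R :=
  \big[Num.max/0]_(i < d) (`|x ord0 i| `^ (s i)%:R^-1).

Definition sball (x : Rd) (rho : R) : set Rd := [set y | snorm (y - x) <= rho].

Definition mdeg_s (k : multinom d) : nat := (\sum_(i < d) s i * k i)%N.

(* eta^lambda_x; x ^- n is the inverse of x ^+ n *)
Definition rescale (lambda : R) (x : Rd) (eta : Rd -> R) : Rd -> R := fun y =>
  lambda ^- scale_deg *
  eta (\row_(i < d) (lambda ^- s i * (y ord0 i - x ord0 i))).

End scaling.

Section test_functions.
Context {R : realType} {d : nat}.
Local Notation Rd := 'rV[R]_d.

Definition partial (i : 'I_d) (f : Rd -> R) : Rd -> R :=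
  fun x => 'D_(delta_mx ord0 i) f x.

(* l lists the directions of differentiation, the last one being applied first *)
Definition partials (l : seq 'I_d) (f : Rd -> R) : Rd -> R := foldr partial f l.

Definition smooth (f : Rd -> R) : Prop := forall l : seq 'I_d,
  continuous (partials l f) /\
  forall x i, derivable (partials l f) x (delta_mx ord0 i).

Definition mpartial (k : multinom d) (f : Rd -> R) : Rd -> R :=
  partials (flatten [seq nseq (k i) i | i <- enum 'I_d]) f.

Definition test_ball (s : 'I_d -> nat) (r : nat) : set (Rd -> R) :=
  [set eta | [/\ smooth eta,
    forall x, ~ sball s 0 1 x -> eta x = 0 &
    forall k, (mdeg_s s k <= r)%N -> forall x, `|mpartial k eta x| <= 1]].

(* the m-th seminorm of the Schwartz space is at most M *)
Definition schwartz_bound (m : nat) (M : R) (phi : Rd -> R) : Prop :=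
  forall (l : seq 'I_d) x, (size l <= m)%N ->
    (1 + `|x|) ^+ m * `|partials l phi x| <= M.

Definition schwartz : set (Rd -> R) :=
  [set phi | smooth phi /\ forall m, exists M, schwartz_bound m M phi].

(* u is a continuous linear form on the Schwartz space; its values outside of
   the Schwartz space are irrelevant *)
Definition tempered (u : (Rd -> R) -> R) : Prop :=
  (forall a phi psi, schwartz phi -> schwartz psi ->
     u (fun x => a * phi x + psi x) = a * u phi + u psi) /\
  exists m C, forall phi M, schwartz phi -> schwartz_bound m M phi ->
    `|u phi| <= C * M.

End test_functions.

(* The finite sequences indexed by A with values in the T z. T is given on all
   of R, but only the T z with z in A contribute. *)
Section direct_sum.
Context {R : realType} (A : set R) (T : R -> completeNormedModType R).

Record dsum := DSum {
  dsum_val :> forall z, T z;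
  dsum_finite : finite_set [set z | dsum_val z != 0];
  dsum_supp : forall z, dsum_val z != 0 -> A z }.

Lemma dsum_eq (u v : dsum) : (forall z, u z = v z) -> u = v.
Proof.
case: u v => [u uf us] [v vf vs] /= uv.
have {}uv : u = v by exact: functional_extensionality_dep.
by subst v; congr DSum; exact: Prop_irrelevance.
Qed.

HB.instance Definition _ := gen_eqMixin dsum.
HB.instance Definition _ := gen_choiceMixin dsum.

Program Definition dsum0 := @DSum (fun z => 0) _ _.
Next Obligation. by rewrite (_ : [set _ | _] = set0)// -subset0 => z/=; rewrite eqxx. Qed.
Next Obligation. by move=> z /=; rewrite eqxx. Qed.

Program Definition dsum_opp (u : dsum) := @DSum (fun z => - u z) _ _.
Next Obligation.
by move=> u; apply: sub_finite_set (dsum_finite u) => z /=; rewrite oppr_eq0.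
Qed.
Next Obligation. by move=> u z /=; rewrite oppr_eq0; exact: dsum_supp. Qed.

Lemma dsum_add_neq0 (u v : dsum) z : u z + v z != 0 -> u z != 0 \/ v z != 0.
Proof.
have [u0|] := eqVneq (u z) 0; last by left.
by rewrite u0 add0r; right.
Qed.

Program Definition dsum_add (u v : dsum) := @DSum (fun z => u z + v z) _ _.
Next Obligation.
move=> u v; apply: (@sub_finite_set _ _ ([set z | u z != 0] `|` [set z | v z != 0])).
  by move=> z /dsum_add_neq0.
by rewrite finite_setU; split; exact: dsum_finite.
Qed.
Next Obligation. by move=> u v z /= /dsum_add_neq0[]; exact: dsum_supp. Qed.

Program Definition dsum_scale (a : R) (u : dsum) := @DSum (fun z => a *: u z) _ _.
Next Obligation.
move=> a u; apply: sub_finite_set (dsum_finite u) => z /=.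
by rewrite scaler_eq0 negb_or => /andP[].
Qed.
Next Obligation.
by move=> a u z /=; rewrite scaler_eq0 negb_or => /andP[_]; exact: dsum_supp.
Qed.

Let dsum_addA : associative dsum_add.
Proof. by move=> u v w; apply: dsum_eq => z /=; rewrite addrA. Qed.
Let dsum_addC : commutative dsum_add.
Proof. by move=> u v; apply: dsum_eq => z /=; rewrite addrC. Qed.
Let dsum_add0 : left_id dsum0 dsum_add.
Proof. by move=> u; apply: dsum_eq => z /=; rewrite add0r. Qed.
Let dsum_addN : left_inverse dsum0 dsum_opp dsum_add.
Proof. by move=> u; apply: dsum_eq => z /=; rewrite addNr. Qed.

HB.instance Definition _ := GRing.isZmodule.Build dsum
  dsum_addA dsum_addC dsum_add0 dsum_addN.

Let dsum_scaleA a b v : dsum_scale a (dsum_scale b v) = dsum_scale (a * b) v.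
Proof. by apply: dsum_eq => z /=; rewrite scalerA. Qed.
Let dsum_scale1 : left_id 1 dsum_scale.
Proof. by move=> u; apply: dsum_eq => z /=; rewrite scale1r. Qed.
Let dsum_scaleDr : right_distributive dsum_scale +%R.
Proof. by move=> a u v; apply: dsum_eq => z /=; rewrite scalerDr. Qed.
Let dsum_scaleDl v : {morph dsum_scale^~ v : a b / a + b}.
Proof. by move=> a b; apply: dsum_eq => z /=; rewrite scalerDl. Qed.

HB.instance Definition _ := GRing.Zmodule_isLmodule.Build R dsum
  dsum_scaleA dsum_scale1 dsum_scaleDr dsum_scaleDl.

Lemma dsumE (u v : dsum) a z :
  [/\ (u + v) z = u z + v z, (- u) z = - u z, (a *: u) z = a *: u z
    & (0 : dsum) z = 0].
Proof. by []. Qed.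

(* the projection onto the sum of the levels below c *)
Program Definition dsum_below (c : R) (u : dsum) :=
  @DSum (fun z => if z < c then u z else 0) _ _.
Next Obligation.
move=> c u; apply: sub_finite_set (dsum_finite u) => z /=.
by case: ifP => // _; rewrite eqxx.
Qed.
Next Obligation.
by move=> c u z /=; case: ifP => [_|]; [exact: dsum_supp|rewrite eqxx].
Qed.

Definition in_level (z : R) : set dsum :=
  [set u | forall b, b != z -> u b = 0].

Definition in_below (c : R) : set dsum :=
  [set u | forall b, c <= b -> u b = 0].

End direct_sum.

Arguments in_level {R A T} z.
Arguments in_below {R A T} c.
Arguments dsum_below {R A T} c u.

Section regularity_structures.
Context {R : realType}.

Record regularity_structure := RegularityStructure {
  rs_hom : set R;
  rs_hom_locally_finite : forall a b, finite_set (rs_hom `&` `[a, b]);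
  rs_hom_lbound : has_lbound rs_hom;
  rs_level : R -> completeNormedModType R;
  rs_group : set (dsum rs_hom rs_level -> dsum rs_hom rs_level);
  rs_group_linear : forall g, rs_group g -> linear g;
  (* continuity for the direct sum topology: every block of g is bounded *)
  rs_group_bounded : forall g, rs_group g -> forall z b, exists C,
    forall tau, in_level z tau -> `|g tau b| <= C * `|tau z|;
  rs_group_id : rs_group id;
  rs_group_comp : forall g h, rs_group g -> rs_group h -> rs_group (g \o h);
  rs_group_inv : forall g, rs_group g ->
    exists h, [/\ rs_group h, cancel g h & cancel h g];
  rs_group_below : forall g z tau, rs_group g -> in_level z tau ->
    in_below z (g tau - tau) }.

Definition rs_space (RS : regularity_structure) : lmodType R :=
  dsum (rs_hom RS) (rs_level RS).

Definition hom_below (RS : regularity_structure) (c : R) : set R :=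
  [set z | rs_hom RS z /\ z < c].

End regularity_structures.

Arguments regularity_structure R : clear implicits.

Section polynomials.
Context {R : realType} {d : nat}.

(* p |-> p(X + h) *)
Definition mtranslate (h : 'rV[R]_d) (p : mpoly d R) : mpoly d R :=
  comp_mpoly [tuple mpolyX R (mnm1 i) + mpolyC d (h ord0 i) | i < d] p.

(* RS contains the polynomial regularity structure, which provides its only
   elements of integer homogeneity *)
Record polynomial_part (s : 'I_d -> nat) (RS : regularity_structure R) :=
  PolynomialPart {
  pp_inj : mpoly d R -> rs_space RS;
  pp_linear : linear pp_inj;
  pp_injective : injective pp_inj;
  pp_hom : forall n : nat, rs_hom RS n%:R;
  pp_level : forall (n : nat) tau, in_level n%:R tau <->
    exists2 p, (forall k, k \in msupp p -> mdeg_s s k = n) & pp_inj p = tau;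
  pp_group : forall g, rs_group g ->
    exists h, forall p, g (pp_inj p) = pp_inj (mtranslate h p);
  pp_group_onto : forall h, exists2 g, rs_group g &
    forall p, g (pp_inj p) = pp_inj (mtranslate h p);
  pp_only_int : forall z, rs_hom RS z -> z \is a Num.int ->
    exists n : nat, z = n%:R }.

End polynomials.

Section models.
Context {R : realType} {d : nat} {s : 'I_d -> nat}.
Context {RS : regularity_structure R} (P : polynomial_part s RS).
Local Notation Rd := 'rV[R]_d.

(* Distributions are compared through their values on Schwartz functions *)
Record model (gamma : R) (r : nat) := Model {
  md_Pi : Rd -> rs_space RS -> (Rd -> R) -> R;
  md_Gamma : Rd -> Rd -> rs_space RS -> rs_space RS;
  md_Pi_tempered : forall x tau, in_below gamma tau -> tempered (md_Pi x tau);
  md_Pi_linear : forall x a tau sigma phi,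
    in_below gamma tau -> in_below gamma sigma -> schwartz phi ->
    md_Pi x (a *: tau + sigma) phi = a * md_Pi x tau phi + md_Pi x sigma phi;
  md_Gamma_group : forall x y, rs_group (md_Gamma x y);
  md_Pi_Gamma : forall x y tau phi, in_below gamma tau -> schwartz phi ->
    md_Pi x (md_Gamma x y tau) phi = md_Pi y tau phi;
  md_Gamma_comp : forall x y z tau,
    md_Gamma x y (md_Gamma y z tau) = md_Gamma x z tau;
  md_Pi_poly : forall x (k : multinom d) phi,
    (mdeg_s s k)%:R < gamma -> schwartz phi ->
    md_Pi x (pp_inj P (mpolyX R k)) phi =
    \int[lebesgue_rV d]_y
      ((\prod_(i < d) (y ord0 i - x ord0 i) ^+ k i) * phi y);
  md_Gamma_poly : forall x y (k : multinom d),
    md_Gamma x y (pp_inj P (mpolyX R k)) =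
    pp_inj P (mtranslate (x - y) (mpolyX R k));
  md_Pi_bound : exists C, forall x eta lambda zeta tau,
    test_ball s r eta -> 0 < lambda <= 1 ->
    hom_below RS gamma zeta -> in_level zeta tau ->
    `|md_Pi x tau (rescale s lambda x eta)| <= C * `|tau zeta| * lambda `^ zeta;
  md_Gamma_bound : exists C, forall x y beta zeta tau,
    sball s x 1 y -> hom_below RS gamma beta -> hom_below RS gamma zeta ->
    beta <= zeta -> in_level zeta tau ->
    `|md_Gamma x y tau beta| <=
      C * `|tau zeta| * snorm s (x - y) `^ (zeta - beta) }.

(* The row vectors z B, z an integer vector: the lattice with basis the rows
   of B *)
Definition lattice (B : 'M[R]_d) : set Rd :=
  [set l | exists z : 'rV[int]_d, l = map_mx intr z *m B].

Definition period_cell (B : 'M[R]_d) : set Rd :=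
  [set x | exists2 t : Rd, forall i, 0 <= t ord0 i < 1 & x = t *m B].

Definition periodic_model gamma r (M : model gamma r) (L : set Rd) : Prop :=
  (forall x l tau phi, L l -> in_below gamma tau -> schwartz phi ->
     md_Pi M (x + l) tau phi = md_Pi M x tau (fun y => phi (y + l))) /\
  (forall x y l, L l -> md_Gamma M (x + l) (y + l) = md_Gamma M x y).

End models.

Section modelled_distributions.
Context {R : realType} {d : nat} (s : 'I_d -> nat) {RS : regularity_structure R}.
Local Notation Rd := 'rV[R]_d.
Local Notation mu := (lebesgue_rV d).
Context (Gamma : Rd -> Rd -> rs_space RS -> rs_space RS).

(* Bochner measurability: pointwise limit of measurable functions with finitely
   many values *)
Definition strongly_measurable (V : normedModType R) (f : Rd -> V) : Prop :=
  exists g : nat -> Rd -> V,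
    (forall n, finite_set (range (g n)) /\
       forall v, measurable (g n @^-1` [set v])) /\
    forall x, g n x @[n --> \oo] --> f x.

Definition Lp_norm (D : set Rd) (p : \bar R) (g : Rd -> R) : \bar R :=
  Lnorm mu p ((EFin \o g) \_ D).

(* The L^q norm over B(0,1) for the measure dh / |h|^|s| *)
Definition Lq_norm (q : \bar R) (g : Rd -> \bar R) : \bar R :=
  match q with
  | q%:E => ((\int[mu]_(h in sball s 0 1)
               (g h `^ q * (snorm s h ^- scale_deg s)%:E)) `^ q^-1)%E
  | +oo%E => ess_sup mu (g \_ (sball s 0 1))
  | -oo%E => 0%E
  end.

Definition increment (gamma zeta : R) (f : Rd -> rs_space RS) (h x : Rd) : R :=
  `|(f (x + h) - Gamma (x + h) x (f x)) zeta| / snorm s h `^ (gamma - zeta).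

(* The integrals in x run over D *)
Definition local_part (D : set Rd) (p : \bar R) (f : Rd -> rs_space RS)
    (zeta : R) : \bar R :=
  Lp_norm D p (fun x => `|f x zeta|).

Definition increment_part (D : set Rd) (p q : \bar R) (gamma : R)
    (f : Rd -> rs_space RS) (zeta : R) : \bar R :=
  Lq_norm q (fun h => Lp_norm D p (increment gamma zeta f h)).

Definition modelled_norm (D : set Rd) (p q : \bar R) (gamma : R)
    (f : Rd -> rs_space RS) : \bar R :=
  (\sum_(zeta \in hom_below RS gamma)
     (local_part D p f zeta + increment_part D p q gamma f zeta))%E.

Definition modelled_in (D : set Rd) (p q : \bar R) (gamma : R) :
    set (Rd -> rs_space RS) :=
  [set f | (forall x, in_below gamma (f x)) /\
    forall zeta, hom_below RS gamma zeta ->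
      [/\ strongly_measurable (fun x => f x zeta),
          (local_part D p f zeta < +oo)%E &
          (increment_part D p q gamma f zeta < +oo)%E]].

Definition modelled (p q : \bar R) (gamma : R) : set (Rd -> rs_space RS) :=
  modelled_in setT p q gamma.

Definition periodic_modelled (B : 'M[R]_d) (p q : \bar R) (gamma : R) :
    set (Rd -> rs_space RS) :=
  modelled_in (period_cell B) p q gamma `&`
  [set f | forall x l, lattice B l -> f (x + l) = f x].

Definition restrict_below (gamma' : R) (f : Rd -> rs_space RS) :
  Rd -> rs_space RS := fun x => dsum_below gamma' (f x).

End modelled_distributions.

(* E maps X to Y and is continuous for the distances induced by the seminorms NX
   and NY; functions that are equal almost everywhere are at distance 0 *)
Definition continuous_between {R : realType} {V W : zmodType}
    (X : set V) (NX : V -> \bar R) (Y : set W) (NY : W -> \bar R)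
    (E : V -> W) : Prop :=
  (forall f, X f -> Y (E f)) /\
  forall f, X f -> forall e : R, 0 < e -> exists2 dl : R, 0 < dl &
    forall g, X g -> (NX (g - f)%R < dl%:E)%E ->
      (NY (E g - E f)%R < e%:E)%E.

Section embedding.
Context {R : realType} {d : nat} (s : 'I_d -> nat) {RS : regularity_structure R}.
Local Notation Rd := 'rV[R]_d.
Context (Gamma : Rd -> Rd -> rs_space RS -> rs_space RS).

Definition embedded (p q : \bar R) (gamma : R) (p' q' : \bar R) (gamma' : R) :=
  continuous_between
    (modelled s Gamma p q gamma) (modelled_norm s Gamma setT p q gamma)
    (modelled s Gamma p' q' gamma') (modelled_norm s Gamma setT p' q' gamma')
    (restrict_below gamma').

Definition periodic_embedded (B : 'M[R]_d)
    (p q : \bar R) (gamma : R) (p' q' : \bar R) (gamma' : R) :=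
  continuous_between
    (periodic_modelled s Gamma B p q gamma)
    (modelled_norm s Gamma (period_cell B) p q gamma)
    (periodic_modelled s Gamma B p' q' gamma')
    (modelled_norm s Gamma (period_cell B) p' q' gamma')
    (restrict_below gamma').

End embedding.

(* Main.v *)
(* Fix the norms |u|_rho = sum_b rho^b |u_b|.  On T_{<gamma} the maps
   Gamma_{x,y} with |x - y| <= rho <= 1 are bounded uniformly in rho for them, so
   W(x,y) = |f(x) - Gamma_{x,y} f(y)|_rho satisfies
   W(x,y) <= W(x,t) + C W(t,y) and W(x,t) <= C W(t,x).

   1. (q < q')  By Chebyshev's inequality in h, some k with |k|, |h+k| <= |h| has
   all its increments, and those of h+k, of the expected size; going from x to
   x+h through x+h+k bounds the increments at every h, which is the case
   q' = oo, and the general case interpolates.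
   2. (gamma' < gamma)  As gamma' is not a homogeneity, truncating below gamma'
   costs |h|^e with e > 0 times the local norms, and |h|^e is integrable against
   dh/|h|^|s|.
   3. (p' < p)  Jensen's inequality on the period cell, which has finite measure.
   4. (p < p')  By 1 one may take q = oo, and by 2 it suffices to reach q' = oo
   for some g between gamma' and kappa = gamma - |s|(1/p - 1/p').  Consider the
   averages over |y - x| <= 2^-(n+1) of the levels b >= g of Gamma_{x,y} f(y) and
   of the levels b < g of f(x) - Gamma_{x,y} f(y).  From one dyadic scale to the
   next they change by at most 2^{nb} G_n(x)^{1/p}, where G_n is a local average
   of W^p; as G_n is both bounded and integrable, G_n^{1/p} has L^p' norm at most
   C 2^{-n kappa}.  The former averages are controlled at scale 1, the latter
   vanish at small scales, so both are at most 2^{-n(g-b)} T(x), where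
   T = T_0 + sum_n 2^{ng} G_n^{1/p} lies in L^p'.  Finally the increments of the
   restriction of f to T_{<g} are at most C |h|^{g-b} (T(x+h) + T(x)). *)
Require Import Defs.
From HB Require Import structures.
From mathcomp Require Import all_boot all_order all_algebra.
From mathcomp Require Import all_classical all_reals all_analysis.
From mathcomp Require Import measurable_realfun ess_sup_inf.
From mathcomp Require Import ring lra.

Set Implicit Arguments.
Unset Strict Implicit.
Unset Printing Implicit Defensive.
Import Order.TTheory GRing.Theory Num.Theory.
Import numFieldNormedType.Exports.
Local Open Scope classical_set_scope.
Local Open Scope ring_scope.

(** * Scaled balls and translations of Lebesgue measure *)

(** Each embedding is first proved as a bound: norm at most [K] implies norm at most [C K] after
    restriction. Homogeneity reduces this to [K = 1], and linearity of the restriction turns it into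
    continuity. [Lle] and [Hle] state such bounds for all exponents alike; lossy constants, [n ^ 2]
    for a sum of [n] terms and 2 for Jensen, replace the sharp inequalities.

    Two obstacles shape the proof. Besides its algebraic relations a model comes only with bounds,
    so the joint measurability of |f(x) - Gamma_{x,y} f(y)| must be derived: Gamma tends to the
    identity at the diagonal, hence points may be rounded to a countable grid. And f is known only
    through integral norms of its increments, so nothing can be evaluated at a prescribed pair of
    points; every comparison passes through a free auxiliary point, which is chosen outside a small
    bad set or averaged out.

    The exponent kappa is a balance: up to constants, G_n is at most 2^{n|s|} 2^{-n gamma p}
    pointwise and its integral is smaller by the volume 2^{-n|s|}. The p-th root therefore has L^p'
    norm at most 2^{-n gamma} 2^{n|s|/p} 2^{-n|s|/p'}. *)

Section scaled_norm.
Context {R : realType} {d : nat} (s : 'I_d -> nat).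
Hypothesis hs : forall i, (1 <= s i)%N.
Local Notation Rd := 'rV[R]_d.
Implicit Types (x y : Rd) (rho : R).

Lemma snorm_ge0 x : 0 <= snorm s x.
Proof. by rewrite /snorm; elim/big_ind : _ => // a b a0 b0; rewrite le_max a0. Qed.

(** Raising to the power [s i] removes the roots; most facts on [snorm] are obtained from this
    coordinatewise test. *)
Lemma snormP x rho : 0 <= rho ->
  (snorm s x <= rho) = [forall i, `|x ord0 i| <= rho ^+ s i].
Proof.
move=> rho0.
have si i : (s i)%:R != 0 :> R by rewrite pnatr_eq0 -lt0n; exact: hs.
have powV i (a : R) : 0 <= a -> (a `^ (s i)%:R^-1 <= rho) = (a <= rho ^+ s i).
  move=> a0; apply/idP/idP => [h|h].
    have := lerXn2r (s i) _ _ h; rewrite !nnegrE powR_ge0 rho0 => /(_ isT isT).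
    by rewrite -[X in X <= _]powR_mulrn ?powR_ge0// -powRrM mulVf// powRr1.
  rewrite (_ : rho = (rho ^+ s i) `^ (s i)%:R^-1); last first.
    by rewrite -powR_mulrn// -powRrM mulfV// powRr1.
  by apply: ge0_ler_powR; rewrite ?nnegrE ?exprn_ge0 ?invr_ge0.
apply/idP/forallP => [h i|h].
  rewrite -powV//; apply: le_trans h.
  by rewrite /snorm (bigD1 i)//= le_max lexx.
by rewrite /snorm; elim/big_ind : _ => [//|a b ha hb|i _]; rewrite ?powV// ge_max ha.
Qed.

Lemma snorm_coord x i : `|x ord0 i| <= snorm s x ^+ s i.
Proof. by have := lexx (snorm s x); rewrite snormP ?snorm_ge0// => /forallP. Qed.

Lemma snormN x : snorm s (- x) = snorm s x.
Proof. by apply: eq_bigr => i _; rewrite mxE normrN. Qed.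

Lemma snorm0 : snorm s (0 : Rd) = 0.
Proof.
apply/eqP; rewrite eq_le snorm_ge0 andbT snormP//.
by apply/forallP => i; rewrite mxE normr0 exprn_ge0.
Qed.

Lemma snorm_eq0 x : snorm s x = 0 -> x = 0.
Proof.
move=> x0; apply/rowP => i; rewrite mxE; apply/eqP; rewrite -normr_le0.
by have := snorm_coord x i; rewrite x0 expr0n gtn_eqF.
Qed.

Lemma snorm_gt0 x : x != 0 -> 0 < snorm s x.
Proof.
by move=> x0; rewrite lt_def snorm_ge0 andbT; apply: contra x0 => /eqP/snorm_eq0 ->.
Qed.

Lemma exprD_ge (a b : R) n : 0 <= a -> 0 <= b -> (0 < n)%N ->
  a ^+ n + b ^+ n <= (a + b) ^+ n.
Proof.
move=> a0 b0; case: n => // n _; elim: n => [|n ih]; first by rewrite !expr1.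
rewrite exprS (exprS b) (exprS (a + b)).
apply: (le_trans _ (ler_wpM2l _ ih)); last exact: addr_ge0.
rewrite mulrDl !mulrDr.
have h1 : 0 <= a * b ^+ n.+1 by rewrite mulr_ge0// exprn_ge0.
have h2 : 0 <= b * a ^+ n.+1 by rewrite mulr_ge0// exprn_ge0.
lra.
Qed.

(** In each coordinate, [|x_i| + |y_i| <= |x| ^+ s i + |y| ^+ s i <= (|x| + |y|) ^+ s i] with scaled
    norms in the last two terms. The second inequality is the superadditivity [exprD_ge], which
    relies on [s i >= 1]. *)
Lemma snormD x y : snorm s (x + y) <= snorm s x + snorm s y.
Proof.
rewrite snormP ?addr_ge0 ?snorm_ge0//; apply/forallP => i; rewrite mxE.
apply: (le_trans (ler_normD _ _)); apply: (le_trans _ (exprD_ge _ _ _));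
  rewrite ?snorm_ge0//.
by apply: lerD; exact: snorm_coord.
Qed.

Lemma snormB x y : snorm s (x - y) <= snorm s x + snorm s y.
Proof. by rewrite -(snormN y) snormD. Qed.

Lemma snorm_distC x y : snorm s (x - y) = snorm s (y - x).
Proof. by rewrite -snormN opprB. Qed.

End scaled_norm.

Section lebesgue_rV_theory.
Context {R : realType}.

Lemma measurable_rV_add d (a : 'rV[R]_d) :
  measurable_fun setT (fun x : 'rV[R]_d => x + a).
Proof.
apply: measurable_fun_rV => i.
rewrite (_ : (fun _ => _) = (fun x : 'rV[R]_d => (x ord0 i : R) + a ord0 i)).
  by apply: measurable_funD => //; exact: measurable_coord.
by apply/funext => x; rewrite mxE.
Qed.

Lemma measurable_rV_addfun d dT (T : measurableType dT) (f g : T -> 'rV[R]_d) :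
  measurable_fun setT f -> measurable_fun setT g ->
  measurable_fun setT (fun x => f x + g x).
Proof.
move=> mf mg; apply: measurable_fun_rV => i.
rewrite (_ : (fun _ => _) = (fun x => (f x ord0 i : R) + g x ord0 i)).
  by apply: measurable_funD => //;
    apply: (measurableT_comp (@measurable_coord R d i)).
by apply/funext => x; rewrite mxE.
Qed.

(** The image of Lebesgue measure under the translation has the same values on half-open intervals,
    and these determine it. *)
Lemma lebesgue_measure_translate (a : R) (A : set (measurableTypeR R)) :
  measurable A ->
  lebesgue_measure ((fun x : measurableTypeR R => x + a : measurableTypeR R) @^-1` A) =
  lebesgue_measure A.
Proof.
move=> mA.
have mt : measurable_fun setT
    (fun x : measurableTypeR R => (x + a)%R : measurableTypeR R).
  by apply: measurable_funD.
pose H := isMeasurableFun.Build _ _ _ _ _ mt.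
pose phi : {mfun _ >-> _} := HB.pack (fun x : measurableTypeR R => (x + a)%R : measurableTypeR R) H.
apply/esym; apply: (lebesgue_measure_unique (mu := pushforward lebesgue_measure phi)) => //=.
move=> _ [[u v] _] <-; rewrite /pushforward /=.
rewrite (_ : _ @^-1` _ = `]u - a, v - a]%classic).
  rewrite !lebesgue_measure_itv/= !lte_fin ltrD2r; case: ifP => // _.
  by rewrite -!EFinD; congr EFin; ring.
by apply/seteqP; split => x; rewrite /= !in_itv/= ltrBlDr lerBrDr.
Qed.

(** Induction on the dimension: the measure is the image of a product, so the induction hypothesis
    absorbs the translation of each section and the one-dimensional case absorbs that of the first
    coordinate. *)
Lemma lebesgue_rV_translate d (a : 'rV[R]_d) (A : set 'rV[R]_d) :
  measurable A ->
  lebesgue_rV d ((fun x : 'rV[R]_d => x + a) @^-1` A) = lebesgue_rV d A.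
Proof.
elim: d a A => [|d ih] a A mA.
  by congr (lebesgue_rV 0 _); apply/seteqP; split => x /=;
    rewrite (_ : x + a = x)//; apply/rowP => -[].
pose a0 : measurableTypeR R := (rV_uncons a).1; pose a' : 'rV[R]_d := (rV_uncons a).2.
have mcA : measurable (@rV_cons R d @^-1` A).
  by rewrite -[X in measurable X]setTI; exact: measurable_rV_cons.
pose F (t : measurableTypeR R) := lebesgue_rV d (xsection (@rV_cons R d @^-1` A) t).
have mF : measurable_fun setT F by exact: measurable_fun_xsection.
transitivity (\int[lebesgue_measure]_t F (t + a0)%R)%E.
  apply: eq_integral => t _; rewrite /F /= -(ih a'); last exact: measurable_xsection.
  have E v : rV_cons (t, v) + a = rV_cons (t + a0, v + a') :> 'rV[R]_d.+1.
    have aE : a = rV_cons (a0, a') by rewrite /a0 /a' -surjective_pairing rV_unconsK.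
    rewrite {1}aE; apply/rowP => i; rewrite mxE.
    by case: (unliftP ord0 i) => [j|] ->; rewrite ?rV_consS ?rV_cons0// !mxE.
  congr (lebesgue_rV d _); apply/seteqP; split => v; rewrite /xsection /= !inE /=;
    by rewrite E.
have mt : measurable_fun setT
    (fun x : measurableTypeR R => (x + a0)%R : measurableTypeR R).
  by apply: measurable_funD.
transitivity (\int[lebesgue_measure]_t F t)%E; last by [].
transitivity (\int[pushforward lebesgue_measure
    (fun x : measurableTypeR R => (x + a0)%R : measurableTypeR R)]_t F t)%E.
  by rewrite (ge0_integral_pushforward mt)// => y _; exact: measure_ge0.
by apply: eq_measure_integral => B mB _; exact: lebesgue_measure_translate.
Qed.

Lemma ge0_integral_translate d (a : 'rV[R]_d) (f : 'rV[R]_d -> \bar R) :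
  measurable_fun setT f -> (forall x, 0 <= f x)%E ->
  (\int[lebesgue_rV d]_x f (x + a)%R = \int[lebesgue_rV d]_x f x)%E.
Proof.
move=> mf f0.
have mt := measurable_rV_add a.
transitivity (\int[pushforward (lebesgue_rV d) (fun x : 'rV[R]_d => (x + a)%R)]_x f x)%E.
  by rewrite (ge0_integral_pushforward mt).
by apply: eq_measure_integral => B mB _; exact: lebesgue_rV_translate.
Qed.

End lebesgue_rV_theory.

Section scaled_balls.
Context {R : realType} {d : nat} (s : 'I_d -> nat).
Hypothesis hd : (0 < d)%N.
Hypothesis hs : forall i, (1 <= s i)%N.
Local Notation Rd := 'rV[R]_d.
Local Notation mu := (@lebesgue_rV R d).

Lemma scale_deg_gt0 : (0 < scale_deg s)%N.
Proof.
rewrite /scale_deg; case: d hd s hs => // n _ t ht.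
by rewrite big_ord_recl addn_gt0 ht.
Qed.

Definition cball (rho : R) : set Rd := [set x | snorm s x <= rho].

Lemma sball0E rho : sball s 0 rho = cball rho.
Proof. by apply/seteqP; split => x; rewrite /sball /cball /= subr0. Qed.

Lemma cballE rho : 0 <= rho ->
  cball rho = [set x : Rd | forall i, `[- rho ^+ s i, rho ^+ s i]%classic (x ord0 i)].
Proof.
move=> r0; apply/seteqP; split => x; rewrite /cball /= snormP//.
  by move=> /forallP h i; rewrite /= in_itv/= -ler_norml.
by move=> h; apply/forallP => i; have := h i; rewrite /= in_itv/= -ler_norml.
Qed.

Lemma measurable_box (B : 'I_d -> set (measurableTypeR R)) :
  (forall i, measurable (B i)) ->
  measurable [set x : Rd | forall i, B i (x ord0 i)].
Proof.
move=> mB; rewrite (_ : [set _ | _] = \bigcap_(i in [set: 'I_d])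
    ((fun x : Rd => x ord0 i : measurableTypeR R) @^-1` B i)); last first.
  by rewrite predeqE => x; split => [H i _|H i]; exact: H.
apply: fin_bigcap_measurable => // i _.
by rewrite -[X in measurable X]setTI; apply: measurable_coord => //; exact: mB.
Qed.

Lemma measurable_snorm : measurable_fun setT (snorm s : Rd -> R).
Proof.
have mb rho : measurable [set x : Rd | snorm s x <= rho].
  have [r0|r0] := leP 0 rho.
    by rewrite -[[set _ | _]]/(cball rho) cballE//; apply: (@measurable_box (fun i => `[_, _]%classic)) => i; exact: measurable_itv.
  rewrite (_ : [set _ | _] = set0)// -subset0 => x /= /le_lt_trans /(_ r0).
  by rewrite ltNge snorm_ge0.
apply: (measurability _ (@RGenCInfty.measurableE R)) => //.
move=> _ [_ [x ->] <-]; rewrite setTI.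
have -> : snorm s @^-1` `[x, +oo[ = ~` (\bigcup_n [set y : Rd | snorm s y <= x - n.+1%:R^-1]).
  apply/seteqP; split => y /=; rewrite in_itv/= andbT.
    by move=> h [n _] /=; rewrite leNgt => /negP; apply; rewrite ltrBlDr ltr_pwDr.
  move=> h; rewrite leNgt; apply/negP => yx; apply: h.
  have [n hn] := @ltr_add_invr _ _ _ yx.
  by exists n => //=; rewrite lerBrDr ltW.
by apply: measurableC; apply: bigcup_measurable => n _; exact: mb.
Qed.

Lemma measurable_cball rho : measurable (cball rho).
Proof.
have := measurable_snorm; move=> /(_ measurableT `]-oo, rho]%classic).
rewrite setTI (_ : snorm s @^-1` _ = cball rho); first by apply; exact: measurable_itv.
by apply/seteqP; split => x /=; rewrite in_itv.
Qed.

Lemma lebesgue_box (a b : 'I_d -> R) : (forall i, a i <= b i) ->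
  mu [set x : Rd | forall i, `[a i, b i]%classic (x ord0 i)] =
  (\prod_(i < d) (b i - a i))%:E.
Proof.
move=> ab; rewrite (lebesgue_rV_box (B := fun i => `[a i, b i]%classic))//.
rewrite -prodEFin; apply: eq_bigr => i _.
rewrite lebesgue_measure_itv/= lte_fin; case: ltP => h; first by rewrite EFinB.
by rewrite (_ : b i = a i) ?subrr//; apply/eqP; rewrite eq_le h ab.
Qed.

Lemma lebesgue_cball rho : 0 <= rho ->
  mu (cball rho) = (2 ^+ d * rho ^+ scale_deg s)%:E.
Proof.
move=> r0; rewrite cballE// lebesgue_box => [|i]; last first.
  by rewrite (le_trans (y := 0))// ?oppr_le0 exprn_ge0.
congr EFin; under eq_bigr do rewrite opprK -mulr2n -mulr_natl.
by rewrite big_split/= prodr_const card_ord -expr_sum.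
Qed.

End scaled_balls.

(** * Bounds in L^p *)

Section ereal_powers.
Context {R : realType}.
Local Open Scope ereal_scope.
Implicit Types (a b x y : \bar R) (r K : R).

Lemma lee_poweR r a b : (0 <= r)%R -> 0 <= a -> a <= b -> a `^ r <= b `^ r.
Proof.
move=> r0 a0 ab; apply: gt0_ler_poweR => //; rewrite in_itv/= ?a0 leey//=.
by rewrite (le_trans a0 ab).
Qed.

Lemma poweRVK r a : (0 < r)%R -> 0 <= a -> (a `^ r^-1) `^ r = a.
Proof. by move=> r0 a0; rewrite -poweRrM mulVf ?gt_eqF// poweRe1. Qed.

Lemma poweRKV r a : (0 < r)%R -> 0 <= a -> (a `^ r) `^ r^-1 = a.
Proof. by move=> r0 a0; rewrite -poweRrM mulfV ?gt_eqF// poweRe1. Qed.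

Lemma lee_poweRV r a K : (0 < r)%R -> 0 <= a -> (0 <= K)%R ->
  (a `^ r^-1 <= K%:E) <-> (a <= (K `^ r)%:E).
Proof.
move=> r0 a0 K0; rewrite -poweR_EFin; split => h.
  by rewrite -(poweRVK r0 a0); apply: lee_poweR => //; [exact: ltW|exact: poweR_ge0].
by rewrite -[leRHS](poweRKV r0)// ?lee_poweR// ?lee_fin// invr_ge0 ltW.
Qed.

Lemma poweR_le_of_root r a K : (0 < r)%R -> 0 <= a -> (0 <= K)%R ->
  (a `^ r <= K%:E) <-> (a <= (K `^ r^-1)%:E).
Proof.
by move=> r0 a0 K0; rewrite -(lee_poweRV (r := r^-1)) ?invr_gt0// invrK.
Qed.

(** Lets an extended-real inequality be proved through positive real bounds [K] only: [a = 0] is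
    reached as a limit of such [K], and [a = +oo] is trivial because [C > 0]. *)
Lemma lee_pmul_bound a b (C : R) : (0 < C)%R -> 0 <= a ->
  (forall K, (0 < K)%R -> a <= K%:E -> b <= (C * K)%:E) -> b <= C%:E * a.
Proof.
move=> C0; case: a => [a a0 h|_ _|//]; last by rewrite gt0_muley ?leey// lte_fin.
apply/lee_addgt0Pr => e e0; have eC : (0 < e / C)%R by exact: divr_gt0.
rewrite -EFinM -EFinD (_ : (C * a + e = C * (a + e / C))%R); last first.
  by rewrite mulrDr mulrC mulrCA mulfV ?gt_eqF// mulr1 mulrC.
by apply: h; [exact: ltr_wpDl|rewrite lee_fin lerDl ltW].
Qed.

Lemma dyadic_bracket (t : R) : (0 < t <= 1)%R ->
  exists n, (2^-1 ^+ n.+1 < t <= 2^-1 ^+ n)%R.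
Proof.
move=> /andP[t0 t1]; have ex : exists n, (2^-1 ^+ n < t)%R.
  exists (Num.truncn t^-1).+1; rewrite exprVn invf_plt ?posrE ?exprn_gt0//.
  have := archimedean.Num.Theory.truncnS_gt t^-1; move: (_.+1) => k /lt_trans; apply.
  by rewrite -natrX ltr_nat ltn_expl.
case: (ex_minnP ex) => -[|n] hn mn; first by move: hn; rewrite expr0 ltNge t1.
exists n; rewrite hn leNgt; apply/negP => /mn.
by rewrite ltnn.
Qed.

Lemma sume_const (I : Type) (t : seq I) a : 0 <= a ->
  \sum_(i <- t) a = (size t)%:R%:E * a.
Proof.
move=> a0; elim: t => [|i t ih]; first by rewrite big_nil mul0e.
by rewrite big_cons ih /= -natr1 EFinD ge0_muleDl ?lee_fin// mul1e addeC.
Qed.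

Lemma nneseries_le (u : nat -> \bar R) y : (forall n, 0 <= u n) ->
  (forall n, \sum_(0 <= m < n) u m <= y) -> \sum_(m <oo) u m <= y.
Proof.
move=> u0 h; apply: lime_le; first exact: is_cvg_nneseries.
by apply: nearW.
Qed.

Lemma nneseries_term_le (u : nat -> \bar R) n : (forall n, 0 <= u n) ->
  u n <= \sum_(m <oo) u m.
Proof.
move=> u0; apply: (le_trans _ (nneseries_lim_ge n.+1 _)) => //.
by rewrite big_nat_recr//= leeDr// sume_ge0.
Qed.

Lemma lee_nneseriesT (u v : nat -> \bar R) : (forall n, 0 <= u n) ->
  (forall n, u n <= v n) -> \sum_(m <oo) u m <= \sum_(m <oo) v m.
Proof. by move=> u0 uv; apply: lee_nneseries => n *; [exact: u0|exact: uv]. Qed.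

Lemma nneseries_geometric_le K (t : R) : (0 <= K)%R -> (0 <= t < 1)%R ->
  \sum_(m <oo) (K * t ^+ m)%:E <= (K / (1 - t))%:E.
Proof.
move=> K0 /andP[t0 t1]; apply: nneseries_le => n.
  by rewrite lee_fin mulr_ge0// exprn_ge0.
rewrite sumEFin lee_fin -mulr_sumr ler_wpM2l//.
have t1' : (0 < 1 - t)%R by rewrite subr_gt0.
rewrite -[leRHS]mul1r ler_pdivlMr// big_mkord.
rewrite -[leLHS]opprK -mulrN opprB mulrC -subrX1 opprB.
by rewrite gerBl exprn_ge0.
Qed.

End ereal_powers.

Section Lle.
Context dT {T : measurableType dT} {R : realType}.
Variable mu : {measure set T -> \bar R}.
Local Open Scope ereal_scope.
Implicit Types (p : \bar R) (g : T -> \bar R) (K : R).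

(* ||g||_p <= K for g >= 0 and 1 <= p; for p = -oo this is a junk value *)
Definition Lle p g K : Prop :=
  match p with
  | r%:E => \int[mu]_x (g x `^ r) <= (K `^ r)%:E
  | _ => {ae mu, forall x, g x <= K%:E}
  end.

Lemma measurable_poweRfun g r : measurable_fun setT g ->
  measurable_fun setT (fun x => g x `^ r).
Proof. by move=> mg; exact: (measurableT_comp (measurable_poweR _) mg). Qed.

Lemma LnormP p g K : 1 <= p -> (forall x, 0 <= g x) -> (0 <= K)%R ->
  Lnorm mu p g <= K%:E <-> Lle p g K.
Proof.
move=> p1 g0 K0; rewrite unlock /Lle; case: p p1 => [r||]//=.
  rewrite lee_fin => r1; have r0 : (0 < r)%R := lt_le_trans ltr01 r1.
  under eq_integral do rewrite gee0_abs//.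
  by apply: lee_poweRV => //; apply: integral_ge0 => x _; exact: poweR_ge0.
have -> : abse \o g = g by apply/funext => x /=; rewrite gee0_abs.
(* On a null space [Lnorm] at [+oo] is 0 by convention, and there every almost-everywhere bound
   holds as well. *)
move=> _; case: ifPn => [_|]; first by split => /ess_supP.
rewrite -leNgt => mu0; split => _; last by rewrite lee_fin.
by exists setT; split => //; apply/eqP; rewrite eq_le mu0 measure_ge0.
Qed.

Lemma Lle_mono_ae p g g' K : 1 <= p ->
  measurable_fun setT g -> measurable_fun setT g' ->
  (forall x, 0 <= g x) -> (forall x, 0 <= g' x) ->
  {ae mu, forall x, g x <= g' x} -> Lle p g' K -> Lle p g K.
Proof.
move=> p1 mg mg' g0 g'0 gg'; rewrite /Lle; case: p p1 => [r|_|_].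
- rewrite lee_fin => r1; have r0 : (0 < r)%R := lt_le_trans ltr01 r1.
  apply: le_trans; apply: ae_ge0_le_integral => //.
  + by move=> x _; exact: poweR_ge0.
  + exact: measurable_poweRfun.
  + by move=> x _; exact: poweR_ge0.
  + exact: measurable_poweRfun.
  + by apply: filterS gg' => x h _; apply: lee_poweR => //; exact: ltW.
- by move=> h; apply: filterS2 gg' h => x; exact: le_trans.
- by move=> h; apply: filterS2 gg' h => x; exact: le_trans.
Qed.

Lemma Lle_mono p g g' K : 1 <= p ->
  measurable_fun setT g -> measurable_fun setT g' ->
  (forall x, 0 <= g x) -> (forall x, g x <= g' x) -> Lle p g' K -> Lle p g K.
Proof.
move=> p1 mg mg' g0 gg'; apply: Lle_mono_ae => //; last exact: nearW.
by move=> x; exact: le_trans (gg' x).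
Qed.

Lemma Lle_widen p g K K' : 1 <= p -> (0 <= K)%R -> (K <= K')%R ->
  Lle p g K -> Lle p g K'.
Proof.
move=> p1 K0 KK'; rewrite /Lle; case: p p1 => [r|_|_].
- rewrite lee_fin => r1 h; apply: (le_trans h).
  rewrite lee_fin; apply: ge0_ler_powR; rewrite ?nnegrE//.
  + exact: le_trans r1.
  + exact: le_trans KK'.
- by apply: filterS => x h; apply: (le_trans h); rewrite lee_fin.
- by apply: filterS => x h; apply: (le_trans h); rewrite lee_fin.
Qed.

Lemma LleZ p g K (c : R) : 1 <= p -> (0 <= c)%R -> (0 <= K)%R ->
  measurable_fun setT g -> (forall x, 0 <= g x) ->
  Lle p g K -> Lle p (fun x => c%:E * g x) (c * K).
Proof.
move=> p1 c0 K0 mg g0; rewrite /Lle; case: p p1 => [r _|_|_].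
- move=> h; under eq_integral do rewrite poweRM ?lee_fin//.
  rewrite ge0_integralZl// ?poweR_ge0//.
  + by rewrite powRM// poweR_EFin EFinM lee_wpmul2l// lee_fin powR_ge0.
  + exact: measurable_poweRfun.
  + by move=> x _; exact: poweR_ge0.
- by apply: filterS => x h; rewrite EFinM lee_wpmul2l// lee_fin.
- by apply: filterS => x h; rewrite EFinM lee_wpmul2l// lee_fin.
Qed.

Lemma powR_le_id (x r : R) : (0 <= x <= 1)%R -> (1 <= r)%R -> (x `^ r <= x)%R.
Proof.
move=> /andP[x0 x1] r1; have [->|xn0] := eqVneq x 0%R.
  by rewrite powR0// gt_eqF// (lt_le_trans ltr01).
by apply: ge1r_powR => //; rewrite lt_def xn0 x0.
Qed.

Lemma ae_seq (I : eqType) (L : seq I) (Q : I -> T -> Prop) :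
  (forall i, i \in L -> {ae mu, forall x, Q i x}) ->
  {ae mu, forall x, forall i, i \in L -> Q i x}.
Proof.
elim: L => [_|i L ih h]; first exact: nearW.
have {}ih := ih (fun j jL => h j (@mem_behead _ (i :: L) j jL)).
apply: filterS2 (h i (mem_head _ _)) ih => x h1 h2 j.
by rewrite inE => /predU1P[->|]; [exact: h1|exact: h2].
Qed.

(** Takes the place of Minkowski. With [Y] the sum of the [g i ^ r], each term is at most
    [Y ^ (1/r)], so the sum is at most [n Y ^ (1/r)]. Integration gives [n ^ r * n * K ^ r], and
    [n <= n ^ r] explains the constant [n ^ 2]. *)
Lemma Lle_sum (I : eqType) (t : seq I) p (g : I -> T -> \bar R) K :
  1 <= p -> (0 <= K)%R ->
  (forall i, measurable_fun setT (g i)) -> (forall i x, 0 <= g i x) ->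
  (forall i, i \in t -> Lle p (g i) K) ->
  Lle p (fun x => \sum_(i <- t) g i x) ((size t)%:R ^+ 2 * K).
Proof.
move=> p1 K0 mg g0; set n := size t.
have ae_case : (forall i, i \in t -> {ae mu, forall x, g i x <= K%:E}) ->
    {ae mu, forall x, \sum_(i <- t) g i x <= (n%:R ^+ 2 * K)%:E}.
  move=> /ae_seq; apply: filterS => x hx.
  apply: (@le_trans _ _ (\sum_(i <- t) K%:E)).
    by rewrite big_seq [leRHS]big_seq; apply: lee_sum => i; exact: hx.
  rewrite sumEFin lee_fin big_const_seq count_predT iter_addr_0 -/n -(mulr_natl K).
  rewrite ler_wpM2r// expr2; case: n => [|m]; first by rewrite mul0r.
  by rewrite ler_peMl// ler1n.
case: p p1 => [r|_|_] //.
rewrite lee_fin /Lle => r1 h; have r0 : (0 < r)%R := lt_le_trans ltr01 r1.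
pose Y x := \sum_(i <- t) (g i x `^ r).
have Y0 x : 0 <= Y x by apply: sume_ge0 => i _; exact: poweR_ge0.
have mY : measurable_fun setT Y.
  by apply: emeasurable_sum => i; exact: measurable_poweRfun.
have sumY x : \sum_(i <- t) g i x <= n%:R%:E * (Y x `^ r^-1).
  apply: (@le_trans _ _ (\sum_(i <- t) (Y x `^ r^-1))).
    rewrite big_seq [leRHS]big_seq; apply: lee_sum => i it.
    rewrite -[leLHS](poweRKV r0)//; apply: lee_poweR; [by rewrite invr_ge0 ltW|exact: poweR_ge0|].
    rewrite /Y (big_rem i)//= leeDl//.
    by apply: sume_ge0 => j _; exact: poweR_ge0.
  by rewrite sume_const// poweR_ge0.
apply: (@le_trans _ _ (\int[mu]_x ((n%:R `^ r)%:E * Y x))).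
  apply: ge0_le_integral => //.
  - by move=> x _; exact: poweR_ge0.
  - by apply: measurable_poweRfun; exact: emeasurable_sum.
  - exact: measurable_funeM.
  - move=> x _; rewrite -[X in _ <= _ * X](poweRVK r0)// -poweR_EFin -poweRM//.
    + by apply: lee_poweR; [exact: ltW|exact: sume_ge0|].
    + exact: poweR_ge0.
rewrite ge0_integralZl// ?lee_fin ?powR_ge0// ge0_integral_sum//; last 2 first.
  - by move=> i; exact: measurable_poweRfun.
  - by move=> i x _; exact: poweR_ge0.
apply: (@le_trans _ _ ((n%:R `^ r)%:E * (n%:R * K `^ r)%:E)).
  rewrite lee_wpmul2l// ?lee_fin ?powR_ge0//.
  apply: (@le_trans _ _ (\sum_(i <- t) (K `^ r)%:E)).
    by rewrite big_seq [leRHS]big_seq; apply: lee_sum => i; exact: h.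
  by rewrite sumEFin lee_fin big_const_seq count_predT iter_addr_0 -/n -(mulr_natl (K `^ r)).
rewrite -EFinM lee_fin powRM// ?exprn_ge0// mulrA ler_wpM2r ?powR_ge0//.
rewrite expr2 powRM// ler_wpM2l ?powR_ge0//.
by case: (n) => [|m]; rewrite ?powR_ge0// le1r_powR// ler1n.
Qed.

Lemma LleD p g1 g2 K : 1 <= p -> (0 <= K)%R ->
  measurable_fun setT g1 -> measurable_fun setT g2 ->
  (forall x, 0 <= g1 x) -> (forall x, 0 <= g2 x) ->
  Lle p g1 K -> Lle p g2 K -> Lle p (fun x => g1 x + g2 x) (4 * K).
Proof.
move=> p1 K0 m1 m2 p10 p20 h1 h2.
have := @Lle_sum bool [:: true; false] p (fun b => if b then g1 else g2) K p1 K0.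
rewrite (_ : (fun x => \sum_(i <- _) _) = fun x => g1 x + g2 x); last first.
  by apply/funext => x; rewrite big_cons big_seq1.
rewrite (_ : (size _)%:R ^+ 2 = 4 :> R)%R; last by rewrite /= -natrX.
by apply; [case|case|case].
Qed.

(** The decay [t ^ m] appears twice because it is spent twice: one factor makes [Y], the sum of the
    [(t ^- m * g m) ^ r], integrable, with integral at most [K ^ r / (1 - t)]; the other sums the
    pointwise bounds [g m <= t ^ m * Y ^ (1/r)]. Each use costs one factor [1 / (1 - t)]. *)
Lemma Lle_series p (t : R) K (g : nat -> T -> \bar R) :
  1 <= p -> (0 < t < 1)%R -> (0 <= K)%R ->
  (forall m, measurable_fun setT (g m)) -> (forall m x, 0 <= g m x) ->
  (forall m, Lle p (g m) (K * t ^+ m * t ^+ m)) ->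
  Lle p (fun x => \sum_(m <oo) g m x) ((1 - t) ^- 2 * K).
Proof.
move=> p1 /andP[t0 t1] K0 mg g0.
have t1' : (0 < 1 - t)%R by rewrite subr_gt0.
have t1V : (1 <= (1 - t)^-1)%R by rewrite invf_ge1// gerBl ltW.
have ae_case : (forall m, {ae mu, forall x, g m x <= (K * t ^+ m * t ^+ m)%:E}) ->
    {ae mu, forall x, \sum_(m <oo) g m x <= ((1 - t) ^- 2 * K)%:E}.
  move=> /ae_foralln; apply: filterS => x h.
  apply: (@le_trans _ _ (\sum_(m <oo) (K * t ^+ m)%:E)).
    apply: lee_nneseriesT => m; first exact: g0.
    move: (h m) => /le_trans; apply; rewrite lee_fin ler_piMr//.
      by rewrite mulr_ge0// exprn_ge0// ltW.
    by rewrite exprn_ile1// ltW.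
  apply: (le_trans (nneseries_geometric_le K0 _)); first by rewrite t1 ltW.
  rewrite lee_fin mulrC ler_wpM2r// -exprVn expr2 ler_peMl//.
  by rewrite invr_ge0 ltW.
case: p p1 => [r|_|_] //.
rewrite lee_fin /Lle => r1 h; have r0 : (0 < r)%R := lt_le_trans ltr01 r1.
pose Y x := \sum_(m <oo) (((t ^- m) `^ r)%:E * (g m x `^ r)).
have Yt0 m x : 0 <= ((t ^- m) `^ r)%:E * (g m x `^ r).
  by rewrite mule_ge0// ?poweR_ge0// lee_fin powR_ge0.
have Y0 x : 0 <= Y x by apply: nneseries_ge0.
have mYt m : measurable_fun setT (fun x => ((t ^- m) `^ r)%:E * (g m x `^ r)).
  by apply: measurable_funeM; exact: measurable_poweRfun.
have mY : measurable_fun setT Y by apply: ge0_emeasurable_sum => // m x _ _.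
have tm0 m : (0 < t ^+ m)%R by rewrite exprn_gt0.
have gY m x : g m x <= (t ^+ m)%:E * (Y x `^ r^-1).
  have : (t ^- m)%:E * g m x <= Y x `^ r^-1.
    rewrite -[leLHS](poweRKV r0); last first.
      by rewrite mule_ge0// lee_fin invr_ge0 ltW.
    apply: lee_poweR; [by rewrite invr_ge0 ltW|exact: poweR_ge0|].
    rewrite poweRM//; last by rewrite lee_fin invr_ge0 ltW.
    rewrite poweR_EFin.
    exact: (nneseries_term_le m (Yt0 ^~ x)).
  by rewrite lee_pdivrMl.
have sumY x : \sum_(m <oo) g m x <= ((1 - t)^-1)%:E * (Y x `^ r^-1).
  apply: (@le_trans _ _ (\sum_(m <oo) ((t ^+ m)%:E * (Y x `^ r^-1)))).
    by apply: lee_nneseriesT => m; [exact: g0|exact: gY].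
  under eq_eseriesr do rewrite muleC.
  have [E|Yoo] := eqVneq (Y x `^ r^-1) +oo.
    by rewrite E gt0_muley ?leey// lte_fin invr_gt0.
  have Yfin : Y x `^ r^-1 \is a fin_num by rewrite ge0_fin_numE ?ltey// poweR_ge0.
  rewrite -(fineK Yfin); under eq_eseriesr do rewrite -EFinM.
  apply: (le_trans (nneseries_geometric_le _ _)).
  - by rewrite fine_ge0// poweR_ge0.
  - by rewrite t1 ltW.
  by rewrite -EFinM mulrC.
apply: (@le_trans _ _ (\int[mu]_x (((1 - t)^-1 `^ r)%:E * Y x))).
  apply: ge0_le_integral => //.
  - by move=> x _; exact: poweR_ge0.
  - by apply: measurable_poweRfun; exact: ge0_emeasurable_sum.
  - exact: measurable_funeM.
  - move=> x _; rewrite -[X in _ <= _ * X](poweRVK r0)// -poweR_EFin -poweRM//.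
    + by apply: lee_poweR; [exact: ltW|exact: nneseries_ge0|].
    + by rewrite lee_fin invr_ge0 ltW.
    + exact: poweR_ge0.
rewrite ge0_integralZl// ?lee_fin ?powR_ge0// integral_nneseries//.
apply: (@le_trans _ _ (((1 - t)^-1 `^ r)%:E * (K `^ r / (1 - t))%:E)).
  rewrite lee_wpmul2l// ?lee_fin ?powR_ge0//.
  apply: (@le_trans _ _ (\sum_(m <oo) ((K `^ r) * t ^+ m)%:E)); last first.
    by apply: nneseries_geometric_le; [exact: powR_ge0|rewrite t1 ltW].
  apply: lee_nneseriesT => m; first by apply: integral_ge0 => x _; exact: Yt0.
  rewrite ge0_integralZl// ?lee_fin ?powR_ge0//; last 2 first.
    - exact: measurable_poweRfun.
    - by move=> x _; exact: poweR_ge0.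
  apply: (le_trans (lee_wpmul2l _ (h m))); first by rewrite lee_fin powR_ge0.
  have tm0' : (0 <= t ^+ m)%R by exact: ltW.
  rewrite -EFinM lee_fin -powRM ?invr_ge0 ?mulr_ge0//.
  rewrite [X in (X `^ _)%R](_ : _ = K * t ^+ m)%R; last first.
    by rewrite mulrCA mulVf ?gt_eqF// mulr1.
  rewrite powRM// ler_wpM2l ?powR_ge0// powR_le_id// tm0'/=.
  by rewrite exprn_ile1// ltW.
have t1V0 : (0 <= (1 - t)^-1)%R by rewrite invr_ge0 ltW.
rewrite -EFinM lee_fin -exprVn expr2 !powRM ?mulr_ge0//.
rewrite -mulrA ler_wpM2l ?powR_ge0// mulrC ler_wpM2r ?powR_ge0//.
exact: le1r_powR.
Qed.

(** For a finite exponent [r'], with [a = r' / r - 1], one has [g ^ r' <= G ^ (1 + a) <= K ^ a * G],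
    whose integral is at most [K ^ (r' / r) * V]. Writing the bound on the integral as [K * V] makes
    the result uniform in [p], including [+oo], whose inverse is 0. *)
Lemma Lle_interp (r : R) p g (G : T -> \bar R) (K V : R) : (1 <= r)%R -> r%:E < p ->
  measurable_fun setT g -> measurable_fun setT G ->
  (forall x, 0 <= g x) -> (forall x, 0 <= G x) -> (0 <= K)%R -> (0 < V)%R ->
  (forall x, g x `^ r <= G x) -> (forall x, G x <= K%:E) ->
  \int[mu]_x G x <= (K * V)%:E ->
  Lle p g (K `^ r^-1 * V `^ (fine p^-1)).
Proof.
move=> r1 rp mg mG g0 G0 K0 V0 gG GK iG.
have r0 : (0 < r)%R := lt_le_trans ltr01 r1.
case: p rp => [r'|_|]//; last first.
  rewrite invey /= powRr0 mulr1; apply: nearW => x.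
  by apply/poweR_le_of_root => //; exact: le_trans (GK x).
rewrite lte_fin => rr'; have r'0 : (0 < r')%R := lt_trans r0 rr'.
rewrite inver gt_eqF//= /Lle.
pose a := (r' / r - 1)%R.
have a0 : (0 < a)%R by rewrite subr_gt0 ltr_pdivlMr// mul1r.
have aE : (r' / r = 1 + a)%R by rewrite /a addrC subrK.
apply: (@le_trans _ _ (\int[mu]_x ((K `^ a)%:E * G x))).
  apply: ge0_le_integral => //.
  - by move=> x _; exact: poweR_ge0.
  - exact: measurable_poweRfun.
  - exact: measurable_funeM.
  - move=> x _; apply: (@le_trans _ _ (G x `^ (r' / r))).
      rewrite (_ : g x `^ r' = (g x `^ r) `^ (r' / r)); last first.
        by rewrite -poweRrM mulrCA mulfV ?gt_eqF// mulr1.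
      by apply: lee_poweR; rewrite ?poweR_ge0// divr_ge0// ltW.
    rewrite aE poweRD; last by apply: add_neq0_poweRD_def; rewrite gt_eqF// addr_gt0.
    rewrite poweRe1// muleC lee_wpmul2r// -poweR_EFin.
    by apply: lee_poweR => //; exact: ltW.
rewrite ge0_integralZl// ?lee_fin ?powR_ge0//.
apply: (le_trans (lee_wpmul2l _ iG)); first by rewrite lee_fin powR_ge0.
have V0' : (0 <= V)%R by exact: ltW.
rewrite -EFinM lee_fin powRM ?powR_ge0// -!powRrM mulVf ?gt_eqF// (powRr1 V0').
rewrite mulrA ler_wpM2r// mulrC (mulrC (r^-1)%R) aE.
have [->|Kn0] := eqVneq K 0%R; first by rewrite mul0r powR_ge0.
rewrite (@powRD _ K 1 a); last by rewrite Kn0 implybT.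
by rewrite powRr1.
Qed.

Lemma Lle_interp_self (r : R) g (G : T -> \bar R) (K : R) : (1 <= r)%R ->
  measurable_fun setT g -> measurable_fun setT G ->
  (forall x, 0 <= g x) -> (0 <= K)%R -> (forall x, g x `^ r <= G x) ->
  \int[mu]_x G x <= K%:E -> Lle r%:E g (K `^ r^-1).
Proof.
move=> r1 mg mG g0 K0 gG iG.
have r0 : (0 < r)%R := lt_le_trans ltr01 r1.
rewrite /Lle -powRrM mulVf ?gt_eqF// powRr1//; apply: le_trans iG.
apply: ge0_le_integral => //.
- by move=> x _; exact: poweR_ge0.
- exact: measurable_poweRfun.
Qed.

(** For finite exponents [r' < r] and on [D], [g ^ r'] is at most [K ^ r'] where [g <= K] and at
    most [K ^ (r' - r) * g ^ r] elsewhere. The two parts integrate to at most [K ^ r' * (V + 1)],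
    and [V + 1 <= (V + 1) ^ r']. *)
Lemma Lle_finite_measure p p' g K (D : set T) (V : R) : 1 <= p' -> p' < p ->
  measurable D -> mu D <= V%:E -> (0 <= V)%R -> (0 < K)%R ->
  measurable_fun setT g -> (forall x, 0 <= g x) ->
  (forall x, ~ D x -> g x = 0) ->
  Lle p g K -> Lle p' g (K * (V + 1)).
Proof.
move=> p'1 p'p mD muD V0 K0 mg g0 gD.
case: p' p'1 p'p => [r'|_|]//; last by rewrite ltNge leey.
rewrite lee_fin => r'1 p'p; have r'0 : (0 < r')%R := lt_le_trans ltr01 r'1.
have fin W : (W <= K `^ r' * (V + 1))%R -> (W <= (K * (V + 1)) `^ r')%R.
  move=> /le_trans; apply; rewrite powRM ?addr_ge0//; last exact: ltW.
  by rewrite ler_wpM2l ?powR_ge0// le1r_powR// lerDr.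
have mI : measurable_fun setT (EFin \o \1_D : T -> \bar R).
  by apply/measurable_EFinP; exact: measurable_indic.
have intI : \int[mu]_x (\1_D x)%:E = mu D by rewrite integral_indic ?setIT.
case: p p'p => [r|_|]//.
  rewrite lte_fin => r'r h; have r0 : (0 < r)%R := lt_trans r'0 r'r.
  have h1 : \int[mu]_x (g x `^ r') <=
      \int[mu]_x ((K `^ r')%:E * ((\1_D x)%:E + (K `^ (- r))%:E * (g x `^ r))).
    apply: ge0_le_integral => //.
    - by move=> x _; exact: poweR_ge0.
    - exact: measurable_poweRfun.
    - apply: measurable_funeM; apply: emeasurable_funD => //.
      by apply: measurable_funeM; exact: measurable_poweRfun.
    - move=> x _; have [Dx|Dx] := pselect (D x); last first.
        rewrite gD// !poweR0r ?gt_eqF// mule0 adde0 mule_ge0// lee_fin ?powR_ge0//.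
      rewrite indicE mem_set//=; have [gK|gK] := leP (g x) K%:E.
        apply: (@le_trans _ _ ((K `^ r')%:E * 1)).
          by rewrite mule1 -poweR_EFin lee_poweR// ltW.
        rewrite lee_wpmul2l// ?lee_fin ?powR_ge0// leeDl//.
        by rewrite mule_ge0// ?poweR_ge0// lee_fin powR_ge0.
      apply: (@le_trans _ _ ((K `^ r')%:E * ((K `^ (- r))%:E * (g x `^ r)))); last first.
        by rewrite lee_wpmul2l// ?lee_fin ?powR_ge0// leeDr.
      rewrite muleA -EFinM -powRD ?(gt_eqF K0) ?implybT//.
      move: gK (g0 x); case: (g x) => [a| |]//; rewrite ?lte_fin ?lee_fin => Ka a0.
        have a00 : (0 < a)%R := lt_trans K0 Ka.
        have -> : (a `^ r' = a `^ (r' - r) * a `^ r)%R.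
          by rewrite -powRD ?subrK// (gt_eqF a00) implybT.
        rewrite ler_wpM2r ?powR_ge0// -[(r' - r)%R]opprB !powRN.
        rewrite lef_pV2 ?posrE ?powR_gt0//.
        by apply: ge0_ler_powR; rewrite ?nnegrE ?subr_ge0; exact: ltW.
      by rewrite !poweRyr ?gt_eqF// gt0_muley// lte_fin powR_gt0.
  apply: (le_trans h1); rewrite ge0_integralZl//; last 3 first.
    - apply: emeasurable_funD => //.
      by apply: measurable_funeM; exact: measurable_poweRfun.
    - move=> x _; rewrite adde_ge0// ?lee_fin//.
      by rewrite mule_ge0// ?poweR_ge0// lee_fin powR_ge0.
    - by rewrite lee_fin powR_ge0.
  rewrite ge0_integralD//; last 2 first.
    - by move=> x _; rewrite mule_ge0// ?poweR_ge0// lee_fin powR_ge0.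
    - by apply: measurable_funeM; exact: measurable_poweRfun.
  rewrite intI ge0_integralZl//; last 3 first.
    - exact: measurable_poweRfun.
    - by move=> x _; exact: poweR_ge0.
    - by rewrite lee_fin powR_ge0.
  apply: (@le_trans _ _ ((K `^ r')%:E * (V + 1)%:E)).
    rewrite lee_wpmul2l// ?lee_fin ?powR_ge0// EFinD leeD//.
    apply: (le_trans (lee_wpmul2l _ h)); first by rewrite lee_fin powR_ge0.
    by rewrite -EFinM powRN mulVf// gt_eqF// powR_gt0.
  by rewrite -EFinM lee_fin; exact: fin.
move=> h; rewrite /Lle.
apply: (@le_trans _ _ (\int[mu]_x ((K `^ r')%:E * (\1_D x)%:E))).
  apply: ae_ge0_le_integral => //.
  - by move=> x _; exact: poweR_ge0.
  - exact: measurable_poweRfun.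
  - by move=> x _; rewrite mule_ge0// lee_fin ?powR_ge0.
  - exact: measurable_funeM.
  - apply: filterS h => x h _; have [Dx|Dx] := pselect (D x); last first.
      by rewrite gD// poweR0r ?gt_eqF// mule_ge0// lee_fin ?powR_ge0.
    by rewrite indicE mem_set//= mule1 -poweR_EFin lee_poweR// ltW.
rewrite ge0_integralZl//; last by rewrite lee_fin powR_ge0.
rewrite intI; apply: (le_trans (lee_wpmul2l _ muD)); first by rewrite lee_fin powR_ge0.
rewrite -EFinM lee_fin; apply: fin; rewrite ler_wpM2l ?powR_ge0//.
by rewrite lerDl.
Qed.

End Lle.

(** * Levels of a regularity structure and bounds on the model *)

Section levels.
Context {R : realType} (RS : regularity_structure R).
Implicit Types (c b z : R) (u v : rs_space RS).

Lemma finite_hom_below c : finite_set (hom_below RS c).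
Proof.
have [a ha] := rs_hom_lbound RS.
apply: sub_finite_set (rs_hom_locally_finite RS a c) => z [hz zc]; split => //=.
by rewrite in_itv/= (ha _ hz) ltW.
Qed.

Definition levels c : seq R := finmap.enum_fset (fset_set (hom_below RS c)).

Lemma levels_uniq c : uniq (levels c).
Proof. exact: finmap.fset_uniq. Qed.

Lemma mem_levels c z : z \in levels c <-> hom_below RS c z.
Proof.
have E := in_fset_set (finite_hom_below c) z.
by split => [h|/mem_set h]; [apply: set_mem; rewrite -E|rewrite -E in h].
Qed.

Lemma levels_lt c z : z \in levels c -> z < c.
Proof. by move=> /mem_levels[]. Qed.

Lemma levels_le c c' z : c <= c' -> z \in levels c -> z \in levels c'.
Proof. by move=> cc' /mem_levels[hz zc]; apply/mem_levels; split => //; exact: lt_le_trans cc'. Qed.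

Lemma dsum_valD u v z : (u + v) z = u z + v z. Proof. by []. Qed.
Lemma dsum_valN u z : (- u) z = - u z. Proof. by []. Qed.
Lemma dsum_valB u v z : (u - v) z = u z - v z. Proof. by []. Qed.
Lemma dsum_valZ (a : R) u z : (a *: u) z = a *: u z. Proof. by []. Qed.
Lemma dsum_val0 z : (0 : rs_space RS) z = 0. Proof. by []. Qed.

Lemma dsum_val_sum (I : Type) (t : seq I) (F : I -> rs_space RS) z :
  (\sum_(i <- t) F i) z = \sum_(i <- t) F i z.
Proof. by elim/big_rec2 : _ => [//|i y x _ <-]. Qed.

Lemma in_belowB c u v : in_below c u -> in_below c v -> in_below c (u - v).
Proof. by move=> hu hv b cb; rewrite dsum_valB hu// hv// subrr. Qed.

Lemma in_below_le c c' u : c <= c' -> in_below c u -> in_below c' u.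
Proof. by move=> cc' h b c'b; apply: h; exact: le_trans c'b. Qed.

Lemma dsum_notin c u z : in_below c u -> z \notin levels c -> u z = 0.
Proof.
move=> hu hz; have [cz|zc] := leP c z; first exact: hu.
apply/eqP; apply: contraNT hz => uz; apply/mem_levels; split => //.
exact: dsum_supp uz.
Qed.

Program Definition dsum_at b (u : rs_space RS) : rs_space RS :=
  @DSum _ _ _ (fun z => if z == b then u z else 0) _ _.
Next Obligation.
move=> b u; apply: (@sub_finite_set _ _ [set b]) => // z /=.
by case: (z =P b) => // _; rewrite eqxx.
Qed.
Next Obligation.
by move=> b u z /=; case: ifP => [_|]; [exact: dsum_supp|rewrite eqxx].
Qed.

Lemma dsum_atE b u z : dsum_at b u z = if z == b then u z else 0.
Proof. by []. Qed.

Lemma in_level_at b u : in_level b (dsum_at b u).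
Proof. by move=> z zb; rewrite dsum_atE (negbTE zb). Qed.

(** The bounds on the group and on the model concern elements of a single level; this carries them
    over to sums of levels below [c]. *)
Lemma dsum_decomp c u : in_below c u -> u = \sum_(b <- levels c) dsum_at b u.
Proof.
move=> hu; apply: dsum_eq => z; rewrite dsum_val_sum.
have [zl|zl] := boolP (z \in levels c).
  rewrite (bigD1_seq z)//= ?levels_uniq// eqxx big1_seq ?addr0// => b /andP[bz _].
  by rewrite eq_sym (negbTE bz).
rewrite (dsum_notin hu zl) big1_seq// => b /andP[_ bl]; rewrite dsum_atE.
by case: (z =P b) => // zb; move: zl; rewrite zb bl.
Qed.

Lemma dsum_belowE c u z : dsum_below c u z = if z < c then u z else 0.
Proof. by []. Qed.

Lemma in_below_dsum_below c u : in_below c (dsum_below c u : rs_space RS).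
Proof. by move=> z cz; rewrite dsum_belowE ltNge cz. Qed.

Lemma dsum_below_id c u : in_below c u -> dsum_below c u = u.
Proof.
move=> hu; apply: dsum_eq => z; rewrite dsum_belowE; case: ltP => // cz.
by rewrite hu.
Qed.

Lemma dsum_belowB c u v :
  dsum_below c (u - v) = dsum_below c u - dsum_below c v :> rs_space RS.
Proof.
apply: dsum_eq => z; rewrite dsum_valB !dsum_belowE dsum_valB.
by case: ifP => // _; rewrite subrr.
Qed.

Lemma dsum_belowZ c (a : R) u :
  dsum_below c (a *: u) = a *: dsum_below c u :> rs_space RS.
Proof.
apply: dsum_eq => z; rewrite dsum_valZ !dsum_belowE dsum_valZ.
by case: ifP => // _; rewrite scaler0.
Qed.

Lemma dsum_below_below c c' u : c <= c' ->
  dsum_below c (dsum_below c' u) = dsum_below c u :> rs_space RS.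
Proof.
move=> cc'; apply: dsum_eq => z; rewrite !dsum_belowE; case: ifP => // zc.
by rewrite (lt_le_trans zc cc').
Qed.

(* weighting the level b by rho^b makes the bounds on Gamma_{x,y} uniform over
   |x - y| <= rho <= 1 *)
Definition dnorm c (rho : R) u : R := \sum_(b <- levels c) rho `^ b * `|u b|.

Lemma dnorm_ge0 c rho u : 0 <= dnorm c rho u.
Proof. by apply: sumr_ge0 => b _; rewrite mulr_ge0// powR_ge0. Qed.

Lemma dnormD c rho u v : dnorm c rho (u + v) <= dnorm c rho u + dnorm c rho v.
Proof.
rewrite -big_split/=; apply: ler_sum => b _.
by rewrite -mulrDr ler_wpM2l ?powR_ge0// dsum_valD ler_normD.
Qed.

Lemma dnormN c rho u : dnorm c rho (- u) = dnorm c rho u.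
Proof. by apply: eq_bigr => b _; rewrite dsum_valN normrN. Qed.

Lemma dnorm_level c rho u z : z \in levels c -> 0 < rho ->
  `|u z| <= rho `^ (- z) * dnorm c rho u.
Proof.
move=> zl r0; rewrite powRN mulrC ler_pdivlMr ?powR_gt0// mulrC.
rewrite /dnorm (bigD1_seq z)//= ?levels_uniq// lerDl.
by apply: sumr_ge0 => b _; rewrite mulr_ge0// powR_ge0.
Qed.

Lemma group0 g : rs_group g -> g (0 : rs_space RS) = 0.
Proof.
move=> hg; have := rs_group_linear hg 1 0 0.
by rewrite !scale1r addr0 -{1}[g 0]addr0 => /addrI.
Qed.

Lemma groupD g u v : rs_group g -> g (u + v) = g u + g v.
Proof. by move=> hg; have := rs_group_linear hg 1 u v; rewrite !scale1r. Qed.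

Lemma groupZ g (a : R) u : rs_group g -> g (a *: u) = a *: g u.
Proof.
move=> hg; have E : g (a *: u + 0) = a *: g u + g 0 := rs_group_linear hg a u 0.
by move: E; rewrite (group0 hg) !addr0.
Qed.

Lemma groupN g u : rs_group g -> g (- u) = - g u.
Proof. by move=> hg; rewrite -scaleN1r groupZ// scaleN1r. Qed.

Lemma groupB g u v : rs_group g -> g (u - v) = g u - g v.
Proof. by move=> hg; rewrite groupD// groupN. Qed.

Lemma group_sum g (I : Type) (t : seq I) (F : I -> rs_space RS) :
  rs_group g -> g (\sum_(i <- t) F i) = \sum_(i <- t) g (F i).
Proof.
move=> hg; elim: t => [|i t ih]; first by rewrite !big_nil group0.
by rewrite !big_cons groupD// ih.
Qed.

Lemma group_decomp g c u z : rs_group g -> in_below c u ->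
  g u z = \sum_(b <- levels c) g (dsum_at b u) z.
Proof. by move=> hg hu; rewrite {1}(dsum_decomp hu) group_sum// dsum_val_sum. Qed.

(** Triangularity of the structure group: [g tau - tau] has components only strictly below the level
    of [tau]. *)
Lemma group_at_ge g b u z : rs_group g -> b <= z ->
  g (dsum_at b u) z = dsum_at b u z.
Proof.
move=> hg bz; apply/eqP; rewrite -subr_eq0 -dsum_valB; apply/eqP.
by have := rs_group_below hg (@in_level_at b u); apply.
Qed.

Lemma group_in_below g c u : rs_group g -> in_below c u -> in_below c (g u).
Proof.
move=> hg hu z cz; rewrite (group_decomp z hg hu) big1_seq// => b /andP[_ bl].
have bz : b < z := lt_le_trans (levels_lt bl) cz.
by rewrite group_at_ge ?ltW// dsum_atE gt_eqF.
Qed.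

(** The constant depends on [g], unlike the bounds on [Gamma]; it serves to pass to the limit under
    a fixed element of the group. *)
Lemma group_bounded g c z : rs_group g -> exists C, 0 <= C /\
  forall u, in_below c u -> `|g u z| <= C * \sum_(b <- levels c) `|u b|.
Proof.
move=> hg.
have [C hC] := choice (fun b => rs_group_bounded hg b z).
exists (\sum_(b <- levels c) `|C b|); split; first exact: sumr_ge0.
move=> u hu; rewrite (group_decomp z hg hu) mulr_sumr.
apply: (le_trans (ler_norm_sum _ _ _)).
rewrite big_seq [leRHS]big_seq; apply: ler_sum => b bl.
apply: (le_trans (hC b _ (@in_level_at b u))); rewrite dsum_atE eqxx.
rewrite ler_wpM2r//; apply: (le_trans (ler_norm _)).
by rewrite (bigD1_seq b)//= ?levels_uniq// lerDl sumr_ge0.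
Qed.

End levels.

Section model_bounds.
Context {R : realType} {d : nat} {s : 'I_d -> nat}.
Context {RS : regularity_structure R} {P : polynomial_part s RS}.
Context {gamma : R} {r : nat} (M : model P gamma r).
Hypothesis hs : forall i, (1 <= s i)%N.
Local Notation Rd := 'rV[R]_d.
Local Notation Gam := (md_Gamma M).
Implicit Types (x y h : Rd) (c rho z : R) (u : rs_space RS).

(** [Gam x x] is idempotent by [md_Gamma_comp] and invertible as an element of the group. *)
Lemma Gamma_id x u : Gam x x u = u.
Proof.
have [g [_ gK _]] := rs_group_inv (md_Gamma_group M x x).
by rewrite -[LHS]gK md_Gamma_comp gK.
Qed.

(** Since [b - z > 0] in the blocks that matter, the distance may be replaced by any larger [rho];
    the other blocks vanish by triangularity. *)
Lemma Gamma_level_bound : exists C, 0 < C /\ forall x y rho c z b u,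
  snorm s (x - y) <= rho -> rho <= 1 -> c <= gamma ->
  z \in levels RS c -> b \in levels RS c -> b != z ->
  `|Gam x y (dsum_at b u) z| <=
    if z < b then C * `|u b| * rho `^ (b - z) else 0.
Proof.
have [C hC] := md_Gamma_bound M; exists (`|C| + 1); split.
  by rewrite ltr_wpDl.
move=> x y rho c z b u xy rho1 cg zl bl bz; case: ltP => zb; last first.
  rewrite group_at_ge//; last exact: md_Gamma_group.
  by rewrite dsum_atE eq_sym (negbTE bz) normr0.
have hz := (mem_levels _ _ _).1 (levels_le cg zl).
have hb := (mem_levels _ _ _).1 (levels_le cg bl).
have := hC x y z b (dsum_at b u) _ hz hb (ltW zb) (@in_level_at _ _ b u).
rewrite dsum_atE eqxx => /(_ _)/le_trans; apply.
  by rewrite /sball /= snorm_distC (le_trans xy).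
have rho0 : 0 <= rho := le_trans (snorm_ge0 _ _) xy.
apply: (@le_trans _ _ (`|C| * `|u b| * snorm s (x - y) `^ (b - z))).
  by rewrite ler_wpM2r ?powR_ge0// ler_wpM2r// ler_norm.
apply: ler_pM; rewrite ?powR_ge0 ?mulr_ge0//.
  by rewrite ler_wpM2r// lerDl.
by apply: ge0_ler_powR; rewrite ?nnegrE ?snorm_ge0// subr_ge0 ltW.
Qed.

Lemma Gamma_dnorm c : c <= gamma -> exists C, 0 < C /\ forall x y rho u,
  snorm s (x - y) <= rho -> 0 < rho <= 1 -> in_below c u ->
  dnorm c rho (Gam x y u) <= C * dnorm c rho u.
Proof.
move=> cg; have [C [C0 hC]] := Gamma_level_bound.
(* The diagonal blocks have norm 1 and the lower ones at most [C], so [C + 1] serves for both; the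
   last 1 keeps the constant positive when there is no level below [c]. *)
exists ((size (levels RS c))%:R * (C + 1) + 1); split.
  by rewrite ltr_wpDl// mulr_ge0// addr_ge0// ltW.
move=> x y rho u xy /andP[rho0 rho1] hu.
apply: (@le_trans _ _ ((size (levels RS c))%:R * ((C + 1) * dnorm c rho u))); last first.
  by rewrite mulrA ler_wpM2r ?dnorm_ge0// lerDl.
have H z : z \in levels RS c ->
    rho `^ z * `|Gam x y u z| <= (C + 1) * dnorm c rho u.
  move=> zl; rewrite (group_decomp z (md_Gamma_group M x y) hu).
  apply: (@le_trans _ _ (rho `^ z * \sum_(b <- levels RS c) `|Gam x y (dsum_at b u) z|)).
    by rewrite ler_wpM2l ?powR_ge0// ler_norm_sum.
  rewrite !mulr_sumr big_seq [leRHS]big_seq; apply: ler_sum => b bl.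
  have [->|bz] := eqVneq b z.
    rewrite group_at_ge//; last exact: md_Gamma_group.
    rewrite dsum_atE eqxx ler_peMl// ?mulr_ge0 ?powR_ge0//.
    by rewrite lerDr ltW.
  apply: (le_trans (ler_wpM2l _ (hC _ _ _ _ _ _ u xy rho1 cg zl bl bz))).
    exact: powR_ge0.
  case: ifP => zb; last by rewrite mulr0 !mulr_ge0 ?powR_ge0 ?addr_ge0// ltW.
  rewrite mulrCA -powRD; last by rewrite (gt_eqF rho0) implybT.
  rewrite addrC subrK -mulrA (mulrC `|u b|) ler_wpM2r ?mulr_ge0 ?powR_ge0//.
  by rewrite lerDl.
rewrite /dnorm -/(dnorm c rho u) big_seq.
apply: (le_trans (ler_sum _ H)); rewrite -big_seq.
by rewrite big_const_seq count_predT iter_addr_0 -(mulr_natl (_ * _)).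
Qed.

Lemma cvg_sum0 (I : eqType) (t : seq I) (F : I -> nat -> R) :
  (forall i, i \in t -> F i n @[n --> \oo] --> 0) ->
  \sum_(i <- t) F i n @[n --> \oo] --> 0.
Proof.
elim: t => [|i t ih] h.
  by under eq_fun do rewrite big_nil; exact: cvg_cst.
under eq_fun do rewrite big_cons.
suff : F i n + \sum_(j <- t) F j n @[n --> \oo] --> (0 + 0 : R) by rewrite addr0.
apply: cvgD.
  by apply: h; exact: mem_head.
by apply: ih => j jt; apply: h; rewrite inE jt orbT.
Qed.

(** Continuity of [Gamma] at the diagonal: a block from level [b] to a lower level [z] is of order
    [|x - y| ^ (b - z)] with a positive exponent. *)
Lemma Gamma_cvg c (t : R) (x y : nat -> Rd) u z : c <= gamma -> 0 < t < 1 ->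
  in_below c u -> (forall n, snorm s (x n - y n) <= t ^+ n) ->
  Gam (x n) (y n) u z @[n --> \oo] --> u z.
Proof.
move=> cg /andP[t0 t1] hu hxy.
have [C [C0 hC]] := Gamma_level_bound.
have [zl|zl] := boolP (z \in levels RS c); last first.
  rewrite (dsum_notin hu zl).
  under eq_fun do rewrite (dsum_notin (group_in_below (md_Gamma_group M _ _) hu) zl).
  exact: cvg_cst.
apply/subr_cvg0/norm_cvg0P.
pose F b n := if z < b then C * `|u b| * (t ^+ n) `^ (b - z) else 0.
apply: (@squeeze_cvgr _ _ _ _ (fun=> 0) (fun n => \sum_(b <- levels RS c) F b n)).
- apply: nearW => n; rewrite normr_ge0/=.
  rewrite (group_decomp z (md_Gamma_group M _ _) hu).
  rewrite {2}(dsum_decomp hu) dsum_val_sum -sumrB.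
  apply: (le_trans (ler_norm_sum _ _ _)).
  rewrite big_seq [leRHS]big_seq; apply: ler_sum => b bl; rewrite /F.
  have [zb|bz] := ltP z b; last first.
    by rewrite group_at_ge ?subrr ?normr0//; exact: md_Gamma_group.
  rewrite (dsum_atE b u z) (lt_eqF zb) subr0.
  have := hC _ _ _ _ _ _ u (hxy n) _ cg zl bl _.
  by rewrite zb; apply; rewrite ?gt_eqF// exprn_ile1// ltW.
- exact: cvg_cst.
- apply: cvg_sum0 => b bl; rewrite /F; case: (ltP z b) => zb; last exact: cvg_cst.
  suff : C * `|u b| * (t ^+ n) `^ (b - z) @[n --> \oo] --> (C * `|u b| * 0 : R).
    by rewrite mulr0.
  apply: cvgMl_tmp.
  have -> : (fun n => (t ^+ n) `^ (b - z)) = (fun n => (t `^ (b - z)) ^+ n).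
    apply/funext => n; rewrite -powR_mulrn ?ltW// -powRrM mulrC powRrM powR_mulrn//.
    exact: powR_ge0.
  apply: cvg_expr; rewrite ger0_norm ?powR_ge0//.
  suff : t `^ (b - z) < 1 `^ (b - z) by rewrite powR1.
  by apply: gt0_ltr_powR; rewrite ?nnegrE ?subr_gt0// ltW.
Qed.

Definition level_cvg (v : nat -> rs_space RS) (u : rs_space RS) :=
  forall z, v n z @[n --> \oo] --> u z.

Lemma group_level_cvg g c v u : rs_group g ->
  (forall n, in_below c (v n)) -> in_below c u -> level_cvg v u ->
  level_cvg (fun n => g (v n)) (g u).
Proof.
move=> hg hv hu vu z.
have [C [C0 hC]] := group_bounded c z hg.
apply/subr_cvg0/norm_cvg0P.
apply: (@squeeze_cvgr _ _ _ _ (fun=> 0)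
    (fun n => C * \sum_(b <- levels RS c) `|v n b - u b|)).
- apply: nearW => n; rewrite normr_ge0/= -dsum_valB -groupB//.
  by apply: hC; exact: in_belowB.
- exact: cvg_cst.
- suff : C * \sum_(b <- levels RS c) `|v n b - u b| @[n --> \oo] --> (C * 0 : R).
    by rewrite mulr0.
  apply: cvgMl_tmp; apply: cvg_sum0 => b _.
  by apply/norm_cvg0P/subr_cvg0; exact: vu.
Qed.

End model_bounds.

(** * Measurability *)

Section countable_factor.
Context dX {X : measurableType dX}.

(* [c] factors through a measurable map with values in the discrete space nat:
   such maps can be composed and paired freely *)
Definition nat_factor (E : Type) (c : X -> E) : Prop :=
  exists (e : X -> nat) (F : nat -> E),
    (forall k, measurable (e @^-1` [set k])) /\ forall x, c x = F (e x).

Lemma nat_factor_comp (E E' : Type) (phi : E -> E') (c : X -> E) :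
  nat_factor c -> nat_factor (fun x => phi (c x)).
Proof.
by move=> [e [F [me cE]]]; exists e, (phi \o F); split => // x; rewrite cE.
Qed.

Lemma nat_factor_cst (E : Type) (a : E) : nat_factor (fun=> a).
Proof.
exists (fun=> 0%N), (fun=> a); split => // k.
by rewrite preimage_cst; case: ifP.
Qed.

(** Both values are coded into one natural number, so that any function of the pair, however
    irregular, falls under [nat_factor_comp]. *)
Lemma nat_factor_pair (E1 E2 : Type) (c1 : X -> E1) (c2 : X -> E2) :
  nat_factor c1 -> nat_factor c2 -> nat_factor (fun x => (c1 x, c2 x)).
Proof.
move=> [e1 [F1 [m1 E1E]]] [e2 [F2 [m2 E2E]]].
exists (fun x => pickle (e1 x, e2 x)),
  (fun k => if @unpickle (nat * nat)%type k is Some (a, b) then (F1 a, F2 b)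
            else (F1 0%N, F2 0%N)); split; last first.
  by move=> x; rewrite pickleK E1E E2E.
move=> k; rewrite (_ : _ @^-1` _ = \bigcup_a \bigcup_b
    (if pickle (a, b) == k then e1 @^-1` [set a] `&` e2 @^-1` [set b] else set0)).
  apply: bigcup_measurable => a _; apply: bigcup_measurable => b _.
  by case: ifP => // _; exact: measurableI.
apply/seteqP; split => [x /= xk|x [a _ [b _]]].
  by exists (e1 x) => //; exists (e2 x) => //; rewrite xk eqxx.
by case: ifP => // /eqP <- [/= <- <-].
Qed.

Lemma nat_factor_measurable (R : realType) (c : X -> R) :
  nat_factor c -> measurable_fun setT c.
Proof.
move=> [e [F [me cE]]] _ Y mY; rewrite setTI.
rewrite (_ : _ @^-1` _ = \bigcup_(k in [set k | Y (F k)]) (e @^-1` [set k])).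
  by apply: bigcup_measurable => k _.
apply/seteqP; split => [x /=|x [k /= Yk ek]]; rewrite cE; first by exists (e x).
by rewrite ek.
Qed.

End countable_factor.

Lemma nat_factor_precomp dX dX' (X : measurableType dX) (X' : measurableType dX')
    (E : Type) (c : X -> E) (psi : X' -> X) :
  measurable_fun setT psi -> nat_factor c -> nat_factor (fun x => c (psi x)).
Proof.
move=> mpsi [e [F [me cE]]]; exists (fun x => e (psi x)), F; split => // k.
by have := mpsi measurableT _ (me k); rewrite setTI.
Qed.

Section dyadic_rounding.
Context {R : realType} {d : nat}.
Local Notation Rd := 'rV[R]_d.

Definition rounding (n : nat) (x : Rd) : Rd :=
  \row_i ((Num.floor (2 ^+ n * x ord0 i))%:~R / 2 ^+ n).

Lemma measurable_floor_fiber (a : R) (k : int) (i : 'I_d) :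
  measurable [set x : Rd | Num.floor (a * x ord0 i) = k].
Proof.
have m : measurable_fun setT (fun x : Rd => a * (x ord0 i : R)).
  by apply: measurable_funM => //; exact: measurable_coord.
have := m measurableT `[k%:~R, (k + 1)%:~R[%classic (measurable_itv _).
rewrite setTI; congr measurable.
apply/seteqP; split => x /=; rewrite in_itv/=.
  by move=> /floor_def ->.
by move=> <-; rewrite floor_le floorD1_gt.
Qed.

Lemma nat_factor_rounding n : nat_factor (rounding n).
Proof.
pose fl (x : Rd) : 'rV[int]_d := \row_i Num.floor (2 ^+ n * x ord0 i).
exists (fun x => pickle (fl x)),
  (fun k => if @unpickle 'rV[int]_d k is Some v
            then \row_i ((v ord0 i)%:~R / 2 ^+ n) else 0); split; last first.
  by move=> x; rewrite pickleK; apply/rowP => i; rewrite !mxE.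
move=> k; case E : (@unpickle 'rV[int]_d k) => [v|]; last first.
  rewrite (_ : _ @^-1` _ = set0)// -subset0 => x /= xk.
  by move: E; rewrite -xk pickleK.
have [kv|kv] := eqVneq (pickle v) k; last first.
  rewrite (_ : _ @^-1` _ = set0)// -subset0 => x /= xk.
  by move: E; rewrite -xk pickleK => -[vE]; move: kv; rewrite -vE xk eqxx.
rewrite (_ : _ @^-1` _ = \bigcap_(i in [set: 'I_d])
    [set x : Rd | Num.floor (2 ^+ n * x ord0 i) = v ord0 i]).
  by apply: fin_bigcap_measurable => // i _; exact: measurable_floor_fiber.
apply/seteqP; split => [x /= xk i _ /=|x /= h].
  by move: E; rewrite -xk pickleK => -[<-]; rewrite mxE.
by rewrite -kv; congr pickle; apply/rowP => i; rewrite mxE; exact: h.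
Qed.

Lemma rounding_cvg (s : 'I_d -> nat) : (0 < d)%N -> (forall i, (1 <= s i)%N) ->
  exists2 t : R, 0 < t < 1 & forall n x, snorm s (x - rounding n x) <= t ^+ n.
Proof.
move=> hd hs; pose S := scale_deg s.
have S0 : (0 < S)%N by exact: scale_deg_gt0.
(* With this [t], [t ^+ s i >= t ^+ S = 1/2] because [s i <= S]; a rounding error of [2 ^ -n] in a
   coordinate therefore has scaled size at most [t ^ n]. *)
pose t : R := 2^-1 `^ S%:R^-1.
have t0 : 0 < t by exact: powR_gt0.
have tS : t ^+ S = 2^-1.
  by rewrite -powR_mulrn ?ltW// -powRrM mulVf ?pnatr_eq0 -?lt0n// powRr1.
have t1 : t < 1.
  rewrite -(@ltr_pXn2r _ S)// ?nnegrE ?ltW// tS expr1n.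
  by rewrite invf_lt1// ltr1n.
exists t; first by rewrite t0.
move=> n x; have tn0 : 0 <= t ^+ n by rewrite exprn_ge0// ltW.
rewrite snormP//; apply/forallP => i.
apply: (@le_trans _ _ (2^-1 ^+ n)); last first.
  rewrite -tS -!exprM mulnC; apply: ler_wiXn2l; rewrite ?ltW//.
  by rewrite leq_mul2l /S /scale_deg (bigD1 i)//= leq_addr orbT.
rewrite !mxE; have e0 : (0 : R) < 2 ^+ n by rewrite exprn_gt0.
rewrite -{1}[x ord0 i](mulfK (lt0r_neq0 e0)) -mulrBl normrM normfV (gtr0_norm e0).
rewrite exprVn ler_piMl ?invr_ge0 ?(ltW e0)// (mulrC (x ord0 i)).
have := floor_le (2 ^+ n * x ord0 i); have := floorD1_gt (2 ^+ n * x ord0 i).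
rewrite intrD mulr1z => h1 h2; rewrite ger0_norm ?subr_ge0//.
by rewrite lerBlDl ltW.
Qed.

End dyadic_rounding.

Section approximation.
Context {R : realType} {d : nat}.
Local Notation Rd := 'rV[R]_d.

Lemma strongly_measurable_cst (V : normedModType R) (v : V) :
  strongly_measurable (fun _ : Rd => v).
Proof.
exists (fun _ _ => v); split => [n|x]; last exact: cvg_cst.
split; last by move=> w; rewrite preimage_cst; case: ifP.
apply: (@sub_finite_set _ _ [set v]) => //.
by move=> _ [x _ <-].
Qed.

Lemma strongly_measurable_factor (V : normedModType R) (f : Rd -> V) :
  strongly_measurable f -> exists g : nat -> Rd -> V,
    (forall n, nat_factor (g n)) /\ forall x, g n x @[n --> \oo] --> f x.
Proof.
move=> [g [hg gf]]; exists g; split => // n; have [/finite_seqP[t tE] mg] := hg n.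
have gt x : g n x \in t.
  have : range (g n) (g n x) by exists x.
  by rewrite tE.
exists (fun x => index (g n x) t), (fun k => nth 0 t k); split; last first.
  by move=> x; rewrite nth_index.
move=> k; rewrite (_ : _ @^-1` _ = if (k < size t)%N && (index (nth 0 t k) t == k)
  then g n @^-1` [set nth 0 t k] else set0).
  by case: ifP => _ //; exact: mg.
apply/seteqP; split => x /=.
  by move=> <-; rewrite index_mem gt nth_index// eqxx.
by case: ifP => // /andP[kt /eqP ki] /= ->.
Qed.

End approximation.

Section modelled_measurability.
Context {R : realType} {d : nat} {s : 'I_d -> nat}.
Context {RS : regularity_structure R}.
Local Notation Rd := 'rV[R]_d.
Implicit Types (c z : R).

(** Different levels have different types, so [v] is transported along [b = z]. It is replaced by 0
    when [b] is not a homogeneity, as [dsum_supp] demands. *)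
Definition dsum_single_val b (v : rs_level RS b) z : rs_level RS z :=
  match pselect (b = z) with
  | left e => if `[< rs_hom RS b >] then eq_rect b (fun a => rs_level RS a) v z e else 0
  | right _ => 0
  end.

Lemma dsum_single_val_neq b (v : rs_level RS b) z :
  b <> z -> dsum_single_val v z = 0.
Proof. by rewrite /dsum_single_val; case: pselect. Qed.

Lemma dsum_single_val_eq b (v : rs_level RS b) :
  rs_hom RS b -> dsum_single_val v b = v.
Proof.
move=> hb; rewrite /dsum_single_val; case: pselect => // e.
by rewrite asboolT// (_ : e = erefl)//; exact: Prop_irrelevance.
Qed.

Program Definition dsum_single b (v : rs_level RS b) : rs_space RS :=
  @DSum _ _ _ (dsum_single_val v) _ _.
Next Obligation.
move=> b v; apply: (@sub_finite_set _ _ [set b]) => // z /= zv.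
by apply: contrapT => bz; move: zv; rewrite dsum_single_val_neq ?eqxx//; exact/nesym.
Qed.
Next Obligation.
move=> b v z; rewrite /dsum_single_val; case: pselect => [e|_]; last by rewrite eqxx.
by subst z; case: asboolP => // _; rewrite eqxx.
Qed.

Definition premodelled c (f : Rd -> rs_space RS) : Prop :=
  (forall x, in_below c (f x)) /\
  forall z, hom_below RS c z -> strongly_measurable (fun x => f x z).

Lemma premodelled0 c : premodelled c (fun=> 0).
Proof. by split => // z _; exact: strongly_measurable_cst. Qed.

(** The finitely many levels below [c] are approximated separately and summed; finitely many
    discrete maps can be paired into one. *)
Lemma premodelled_approx c (f : Rd -> rs_space RS) : premodelled c f ->
  exists g : nat -> Rd -> rs_space RS, [/\ forall n, nat_factor (g n),
    forall n x, in_below c (g n x) & forall x, level_cvg (g ^~ x) (f x)].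
Proof.
move=> [fc mf].
have H b : exists g : nat -> Rd -> rs_level RS b, (forall n, nat_factor (g n)) /\
    (hom_below RS c b -> forall x, g n x @[n --> \oo] --> f x b).
  have [hb|hb] := pselect (hom_below RS c b).
    by have [g [g1 g2]] := strongly_measurable_factor (mf b hb); exists g.
  by exists (fun _ _ => 0); split => // n; exact: nat_factor_cst.
pose G b := projT1 (cid (H b)).
have G1 b n : nat_factor (G b n) by apply: (projT2 (cid (H b))).1.
have G2 b x : hom_below RS c b -> G b n x @[n --> \oo] --> f x b.
  by move=> hb; apply: (projT2 (cid (H b))).2.
exists (fun n x => \sum_(b <- levels RS c) dsum_single (G b n x)).
have val_in n x z : z \in levels RS c ->
    (\sum_(b <- levels RS c) dsum_single (G b n x)) z = G z n x.
  move=> zl; rewrite dsum_val_sum (bigD1_seq z)//= ?levels_uniq//.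
  rewrite dsum_single_val_eq; last by have [] := (mem_levels _ _ _).1 zl.
  rewrite big1_seq ?addr0// => b /andP[/eqP bz _].
  by rewrite dsum_single_val_neq.
have val_out n x z : z \notin levels RS c ->
    (\sum_(b <- levels RS c) dsum_single (G b n x)) z = 0.
  move=> zl; rewrite dsum_val_sum big1_seq// => b /andP[_ bl] /=.
  by rewrite dsum_single_val_neq// => bz; move: zl; rewrite -bz bl.
split.
- move=> n; elim: (levels RS c) => [|b t ih].
    under eq_fun do rewrite big_nil; exact: nat_factor_cst.
  under eq_fun do rewrite big_cons.
  apply: (@nat_factor_comp _ _ _ _ (fun p => p.1 + p.2)
    (fun x => (dsum_single (G b n x), \sum_(b <- t) dsum_single (G b n x)))).
  by apply: nat_factor_pair => //; exact: nat_factor_comp.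
- move=> n x z cz; apply: val_out; apply/negP => /levels_lt.
  by rewrite ltNge cz.
- move=> x z; have [zl|zl] := boolP (z \in levels RS c).
    by under eq_fun do rewrite val_in//; apply: G2; apply/mem_levels.
  rewrite (dsum_notin (fc x) zl); under eq_fun do rewrite val_out//.
  exact: cvg_cst.
Qed.

Lemma measurable_level c f z : premodelled c f ->
  measurable_fun setT (fun x : Rd => `|f x z|).
Proof.
move=> /premodelled_approx[g [g1 g2 g3]].
apply: (@measurable_fun_cvg _ _ _ _ (fun n x => `|g n x z|)).
  by move=> n; apply: nat_factor_measurable; exact: (nat_factor_comp (fun u : rs_space RS => `|u z|)).
by move=> x _; apply: cvg_norm; exact: g3.
Qed.

Context {P : polynomial_part s RS}.
Context {gamma : R} {r : nat} (M : model P gamma r).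
Hypothesis hd : (0 < d)%N.
Hypothesis hs : forall i, (1 <= s i)%N.
Local Notation Gam := (md_Gamma M).

(** Nothing is known on the measurability of [Gamma] in [(x, y)], so the function is written as
    three nested pointwise limits. First [f1] and [f2] are replaced by discrete approximations. Then
    [y] is rounded to [y_k], where [Gamma_{x,y_k} = Gamma_{x,y} Gamma_{y,y_k}] and [Gamma_{y,y_k}]
    tends to the identity. Finally [x] is rounded in the same way. What remains depends on countably
    many discrete data and is measurable whatever [Gamma] is. *)
Lemma measurable_pair_level c f1 f2 z : c <= gamma ->
  premodelled c f1 -> premodelled c f2 ->
  measurable_fun setT (fun xy : Rd * Rd =>
    `|(f1 xy.1 - Gam xy.1 xy.2 (f2 xy.2)) z|).
Proof.
move=> cg /premodelled_approx[a [a1 a2 a3]] pf2.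
have [b [b1 b2 b3]] := premodelled_approx pf2.
have [t t01 ht] := @rounding_cvg R d s hd hs.
have mfst : measurable_fun setT (fst : Rd * Rd -> Rd) by exact: measurable_fst.
have msnd : measurable_fun setT (snd : Rd * Rd -> Rd) by exact: measurable_snd.
have grp x y := md_Gamma_group M x y.
apply: (@measurable_fun_cvg _ _ _ _ (fun n (xy : Rd * Rd) =>
  `|(a n xy.1 - Gam xy.1 xy.2 (b n xy.2)) z|)); last first.
  move=> [x y] _ /=; apply: cvg_norm; apply: cvgB; first exact: a3.
  exact: (group_level_cvg (grp x y) (b2 ^~ y) (pf2.1 y) (b3 y)).
move=> n.
apply: (@measurable_fun_cvg _ _ _ _ (fun k (xy : Rd * Rd) =>
  `|(a n xy.1 - Gam xy.1 (rounding k xy.2) (b n xy.2)) z|)); last first.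
  move=> [x y] _ /=; apply: cvg_norm; apply: cvgB; first exact: cvg_cst.
  under eq_fun do rewrite -(md_Gamma_comp M x y).
  apply: (group_level_cvg (grp x y) _ (b2 n y)).
    by move=> m; apply: group_in_below; [exact: grp|exact: b2].
  move=> w; apply: (Gamma_cvg M (x := fun=> y) (y := fun i => rounding i y) cg t01 (b2 n y) _).

  by move=> i; exact: ht.
move=> k.
apply: (@measurable_fun_cvg _ _ _ _ (fun m (xy : Rd * Rd) =>
  `|(a n xy.1 - Gam (rounding m xy.1) (rounding k xy.2) (b n xy.2)) z|)); last first.
  move=> [x y] _ /=; apply: cvg_norm; apply: cvgB; first exact: cvg_cst.
  under eq_fun do rewrite -(md_Gamma_comp M _ x).
  apply: (Gamma_cvg M (x := fun i => rounding i x) (y := fun=> x) cg t01); first by apply: group_in_below; [exact: grp|exact: b2].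
  by move=> m; rewrite snorm_distC.
move=> m; apply: nat_factor_measurable.
apply: (@nat_factor_comp _ _ _ _ (fun q : (rs_space RS * Rd) * (Rd * rs_space RS) =>
   `|(q.1.1 - Gam q.1.2 q.2.1 q.2.2) z|)
  (fun xy : Rd * Rd => ((a n xy.1, rounding m xy.1), (rounding k xy.2, b n xy.2)))).
apply: nat_factor_pair; apply: nat_factor_pair.
- exact: (nat_factor_precomp mfst).
- exact: (nat_factor_precomp mfst (nat_factor_rounding _)).
- exact: (nat_factor_precomp msnd (nat_factor_rounding _)).
- exact: (nat_factor_precomp msnd).
Qed.

End modelled_measurability.

Section ess_sup_measurable.
Context d1 d2 {T1 : measurableType d1} {T2 : measurableType d2} {R : realType}.
Variable m2 : {sigma_finite_measure set T2 -> \bar R}.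
Local Open Scope ereal_scope.

(** The essential supremum of a section exceeds [c] exactly when the corresponding section of
    [{G > c}] has positive measure, and the measure of a section is a measurable function. *)
Lemma measurable_ess_sup (G : T1 * T2 -> \bar R) : measurable_fun setT G ->
  measurable_fun setT (fun x => ess_sup m2 (fun y => G (x, y))).
Proof.
move=> mG; apply: (measurability _ (@ErealGenOInfty.measurableE R)) => //.
move=> _ [_ [c ->] <-]; rewrite setTI.
pose A := G @^-1` `]c%:E, +oo[.
have mA : measurable A.
  by rewrite -[X in measurable X]setTI; apply: mG => //; exact: emeasurable_itv.
have := @measurable_fun_xsection _ _ _ _ _ m2 A mA measurableT `]0, +oo[%classic.
rewrite setTI => /(_ (emeasurable_itv _)); congr measurable.
apply/seteqP; split => x /=; rewrite !in_itv/= !andbT => h.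
  rewrite ltNge; apply/negP => /ess_supP.
  move=> /(ae_le_measureP m2 c%:E (measurableT_comp mG (measurable_pair1 x))) E.
  move: h; rewrite (_ : xsection A x = (fun y => G (x, y)) @^-1` `]c%:E, +oo[); last first.
    by apply/seteqP; split => y; rewrite /xsection /A /= inE.
  by rewrite [X in 0 < X]E ltxx.
rewrite lt0e measure_ge0 andbT; apply/negP => /eqP E; move: h.
rewrite ltNge => /negP; apply; apply/ess_supP.
apply/(ae_le_measureP m2 c%:E (measurableT_comp mG (measurable_pair1 x))).
rewrite -[RHS]E; congr (m2 _).
by apply/seteqP; split => y; rewrite /xsection /A /= inE.
Qed.

Lemma measurable_Lnorm p (G : T1 * T2 -> \bar R) : 1 <= p ->
  measurable_fun setT G -> (forall z, 0 <= G z) ->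
  measurable_fun setT (fun x => Lnorm m2 p (fun y => G (x, y))).
Proof.
move=> p1 mG G0; rewrite unlock.
case: p p1 => [r||]//= _; last first.
  case: (0 < m2 setT); last exact: measurable_cst.
  apply: (@measurable_ess_sup (abse \o G)).
  exact: measurableT_comp.
apply: (measurableT_comp (measurable_poweR _)).
pose H (z : T1 * T2) := `|G z| `^ r.
apply: (@measurable_fun_fubini_tonelli_F _ _ _ _ _ m2 H) => [|z].
  by apply: measurable_poweRfun; exact: measurableT_comp.
exact: poweR_ge0.
Qed.

End ess_sup_measurable.

Section increments.
Context {R : realType} {d : nat} {s : 'I_d -> nat}.
Context {RS : regularity_structure R} {P : polynomial_part s RS}.
Context {gamma : R} {r : nat} (M : model P gamma r).
Hypothesis hd : (0 < d)%N.
Hypothesis hs : forall i, (1 <= s i)%N.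
Local Notation Rd := 'rV[R]_d.
Local Notation Gam := (md_Gamma M).
Local Notation mu := (@lebesgue_rV R d).
Implicit Types (c z K rho : R) (f : Rd -> rs_space RS) (p q : \bar R) (D : set Rd).

Lemma increment_ge0 c z f h x : 0 <= increment s Gam c z f h x.
Proof. by rewrite /increment divr_ge0// powR_ge0. Qed.

Lemma measurable_increment c c' z f : c <= gamma -> premodelled c f ->
  measurable_fun setT (fun hx : Rd * Rd => increment s Gam c' z f hx.1 hx.2).
Proof.
move=> cg pf.
have m1 : measurable_fun setT (fun hx : Rd * Rd =>
    `|(f (hx.2 + hx.1) - Gam (hx.2 + hx.1) hx.2 (f hx.2)) z|).
  apply: (@measurableT_comp _ _ _ _ _ _ (fun xy : Rd * Rd =>
    `|(f xy.1 - Gam xy.1 xy.2 (f xy.2)) z|) _ (fun hx : Rd * Rd => (hx.2 + hx.1, hx.2))).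
    exact: (measurable_pair_level M hd hs z cg pf pf).
  apply: measurable_fun_pair; last exact: measurable_snd.
  by apply: measurable_rV_addfun; [exact: measurable_snd|exact: measurable_fst].
rewrite /increment; apply: measurable_funM => //.
have -> : (fun hx : Rd * Rd => (snorm s hx.1 `^ (c' - z))^-1) =
    (fun hx : Rd * Rd => snorm s hx.1 `^ (- (c' - z))).
  by apply/funext => hx; rewrite powRN.
apply: (measurableT_comp (measurable_powR _)).
exact: (measurableT_comp (measurable_snorm hs) measurable_fst).
Qed.

Lemma measurable_increment1 c c' z f h : c <= gamma -> premodelled c f ->
  measurable_fun setT (fun x => increment s Gam c' z f h x).
Proof.
move=> cg pf.
exact: (measurableT_comp (measurable_increment c' z cg pf) (measurable_pair1 h)).
Qed.

Lemma measurable_restrict_setT D (g : Rd -> R) : measurable D ->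
  measurable_fun setT g -> measurable_fun setT ((EFin \o g) \_ D).
Proof.
move=> mD mg; apply/(measurable_restrictT _ mD).
by apply: measurable_funTS; exact/measurable_EFinP.
Qed.

Lemma restrict_EFin_ge0 D (g : Rd -> R) : (forall x, 0 <= g x) ->
  forall x, (0 <= ((EFin \o g) \_ D) x)%E.
Proof. by move=> g0 x; rewrite patchE; case: ifP => // _; rewrite lee_fin. Qed.

Definition incr_norm D p c z f (h : Rd) : \bar R :=
  Lp_norm D p (increment s Gam c z f h).

Lemma measurable_incr_norm D p c z f : (1 <= p)%E -> measurable D ->
  c <= gamma -> premodelled c f -> measurable_fun setT (incr_norm D p c z f).
Proof.
move=> p1 mD cg pf.
pose G (hx : Rd * Rd) := ((EFin \o increment s Gam c z f hx.1) \_ D) hx.2.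
have GE : G = ((fun hx : Rd * Rd => (increment s Gam c z f hx.1 hx.2)%:E)
    \_ (setT `*` D)).
  apply/funext => -[h x]; rewrite /G !patchE /=.
  by rewrite in_setX/= in_setT.
apply: (@measurable_Lnorm _ _ _ _ _ mu p G p1).
  rewrite GE; apply/(measurable_restrictT _ (measurableX measurableT mD)).
  apply: measurable_funTS; apply/measurable_EFinP.
  exact: measurable_increment cg pf.
by move=> [h x]; apply: restrict_EFin_ge0 => y; exact: increment_ge0.
Qed.

Lemma incr_norm_ge0 D p c z f h : (0 <= incr_norm D p c z f h)%E.
Proof. exact: Lnorm_ge0. Qed.

Lemma Lp_normP D p (g : Rd -> R) K : (1 <= p)%E -> (forall x, 0 <= g x) ->
  0 <= K -> (Lp_norm D p g <= K%:E)%E <-> Lle mu p ((EFin \o g) \_ D) K.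
Proof. by move=> p1 g0 K0; apply: LnormP => // x; exact: restrict_EFin_ge0. Qed.

Lemma Lp_normTP p (g : Rd -> R) K : (1 <= p)%E -> (forall x, 0 <= g x) ->
  0 <= K -> (Lp_norm setT p g <= K%:E)%E <-> Lle mu p (EFin \o g) K.
Proof.
move=> p1 g0 K0; rewrite Lp_normP// (_ : _ \_ setT = EFin \o g)//.
by apply/funext => x; rewrite patchE mem_set.
Qed.

(** The denominator is [0] to a positive power, and the inverse of 0 is 0. This convention later
    excludes [k = 0] from the bad sets of [good_point]. *)
Lemma increment0 c z f x : z < c -> increment s Gam c z f 0 x = 0.
Proof.
move=> zc; rewrite /increment snorm0// powR0 ?invr0 ?mulr0//.
by rewrite subr_eq0 gt_eqF.
Qed.

Lemma incr_norm0 D p c z f : (1 <= p)%E -> z < c -> incr_norm D p c z f 0 = 0%E.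
Proof.
move=> p1 zc; rewrite /incr_norm /Lp_norm.
rewrite (_ : _ \_ D = cst 0%E); first by rewrite Lnorm0// gt_eqF// (lt_le_trans lte01).
apply/funext => x; rewrite patchE; case: ifP => // _ /=.
by rewrite increment0.
Qed.

End increments.

(** * Weighted L^q bounds in the increment h *)

Section Hle.
Context {R : realType} {d : nat} (s : 'I_d -> nat).
Hypothesis hd : (0 < d)%N.
Hypothesis hs : forall i, (1 <= s i)%N.
Local Notation Rd := 'rV[R]_d.
Local Notation mu := (@lebesgue_rV R d).
Local Notation w h := ((snorm s h ^- scale_deg s)%:E).
Implicit Types (F : Rd -> \bar R) (q : \bar R) (K : R).
Local Open Scope ereal_scope.

(* the analogue of [Lle] for the measure dh / |h|^|s| on the unit ball *)
Definition Hle q F K : Prop :=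
  match q with
  | r%:E => \int[mu]_(h in cball s 1) (F h `^ r * w h) <= (K `^ r)%:E
  | _ => {ae mu, forall h, cball s 1 h -> F h <= K%:E}
  end.

Lemma weight_ge0 (h : Rd) : 0 <= w h.
Proof. by rewrite lee_fin invr_ge0 exprn_ge0// snorm_ge0. Qed.

Lemma measurable_weight : measurable_fun setT (fun h : Rd => w h).
Proof.
apply/measurable_EFinP.
have -> : (fun h : Rd => (snorm s h ^- scale_deg s)%R) =
    (fun h : Rd => snorm s h `^ (- (scale_deg s)%:R))%R.
  by apply/funext => h; rewrite powR_invn// snorm_ge0.
apply: (measurableT_comp (measurable_powR _)).
exact: measurable_snorm.
Qed.

Lemma measurable_Hle_integrand F (r : R) : measurable_fun setT F ->
  measurable_fun setT (fun h => F h `^ r * w h).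
Proof.
move=> mF; apply: emeasurable_funM; last exact: measurable_weight.
exact: measurable_poweRfun.
Qed.

Lemma Lq_normP q F K : 1 <= q -> (forall h, 0 <= F h) -> (0 <= K)%R ->
  Lq_norm s q F <= K%:E <-> Hle q F K.
Proof.
move=> q1 F0 K0; case: q q1 => [r||]//=; rewrite sball0E.
  rewrite lee_fin => r1; apply: lee_poweRV => //; first exact: lt_le_trans r1.
  by apply: integral_ge0 => h _; rewrite mule_ge0 ?poweR_ge0 ?weight_ge0.
move=> _; split => [/ess_supP|] h; last apply/ess_supP.
  by apply: filterS h => x; rewrite patchE => + xB; rewrite mem_set.
apply: filterS h => x h; rewrite patchE; case: ifPn => [/set_mem//|_].
by rewrite lee_fin.
Qed.

Lemma Hle_mono q F F' K : 1 <= q ->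
  measurable_fun setT F -> measurable_fun setT F' ->
  (forall h, 0 <= F h) -> (forall h, F h <= F' h) -> Hle q F' K -> Hle q F K.
Proof.
move=> q1 mF mF' F0 FF'; rewrite /Hle; case: q q1 => [r|_|_].
- rewrite lee_fin => r1; have r0 : (0 <= r)%R := le_trans ler01 r1.
  apply: le_trans; apply: ge0_le_integral => //.
  + exact: measurable_cball.
  + by move=> h _; rewrite mule_ge0 ?poweR_ge0 ?weight_ge0.
  + by apply: measurable_funTS; exact: measurable_Hle_integrand.
  + by apply: measurable_funTS; exact: measurable_Hle_integrand.
  + by move=> h _; rewrite lee_wpmul2r ?weight_ge0// lee_poweR.
- by apply: filterS => h H hB; apply: le_trans (H hB).
- by apply: filterS => h H hB; apply: le_trans (H hB).
Qed.

Lemma HleZ q F K (c : R) : 1 <= q -> (0 <= c)%R -> (0 <= K)%R ->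
  measurable_fun setT F -> (forall h, 0 <= F h) ->
  Hle q F K -> Hle q (fun h => c%:E * F h) (c * K).
Proof.
move=> q1 c0 K0 mF F0; rewrite /Hle; case: q q1 => [r _|_|_].
- move=> H; under eq_integral do rewrite poweRM ?lee_fin// -muleA.
  rewrite ge0_integralZl// ?poweR_ge0//.
  + by rewrite powRM// poweR_EFin EFinM lee_wpmul2l// lee_fin powR_ge0.
  + exact: measurable_cball.
  + by apply: measurable_funTS; exact: measurable_Hle_integrand.
  + by move=> h _; rewrite mule_ge0 ?poweR_ge0 ?weight_ge0.
- by apply: filterS => x h hB; rewrite EFinM lee_wpmul2l ?lee_fin// h.
- by apply: filterS => x h hB; rewrite EFinM lee_wpmul2l ?lee_fin// h.
Qed.

Lemma ae_neq0 : {ae mu, forall h : Rd, h != 0%R}.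
Proof.
exists (cball s 0%R); split; first exact: measurable_cball.
  by rewrite lebesgue_cball// expr0n gtn_eqF ?mulr0// scale_deg_gt0.
by move=> x /= /negP; rewrite negbK => /eqP ->; rewrite /cball /= snorm0.
Qed.

(** On the shell [2 ^ -(n+1) < |h| <= 2 ^ -n] the integrand is at most [t ^ n * 2 ^ ((n+1) S)] with
    [t = 2 ^ -a]. The ball containing the shell has measure [2 ^ d * 2 ^ (-n S)], so the shell
    contributes at most [2 ^ S * 2 ^ d * t ^ n], a geometric series. *)
Lemma weight_int (a : R) : (0 < a)%R -> exists I : R, (0 <= I)%R /\
  \int[mu]_(h in cball s 1) ((snorm s h `^ a)%:E * w h) <= I%:E.
Proof.
move=> a0; pose t : R := (2^-1 `^ a)%R.
have t0 : (0 < t)%R by exact: powR_gt0.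
have t1 : (t < 1)%R.
  suff : (t < 1 `^ a)%R by rewrite powR1.
  by apply: gt0_ltr_powR; rewrite ?nnegrE// invf_lt1// ltr1n.
pose S := scale_deg s.
pose K : R := (2 ^+ S * 2 ^+ d)%R.
exists (K / (1 - t))%R; split.
  by rewrite divr_ge0 ?mulr_ge0 ?exprn_ge0// subr_ge0 ltW.
pose u n (h : Rd) : \bar R := (t ^+ n * 2 ^+ (n.+1 * S))%:E *
  (\1_(cball s (2^-1 ^+ n)%R) h)%:E.
have u0 n h : 0 <= u n h.
  by rewrite mule_ge0// lee_fin mulr_ge0 ?exprn_ge0// ltW.
have mu_ n : measurable_fun setT (u n).
  apply: measurable_funeM; apply/measurable_EFinP; apply: measurable_indic.
  exact: measurable_cball.
apply: (@le_trans _ _ (\int[mu]_h (\sum_(n <oo) u n h))).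
  rewrite integral_mkcond; apply: ge0_le_integral => //.
  - move=> h _; rewrite patchE; case: ifP => // _.
    by rewrite mule_ge0 ?weight_ge0// lee_fin powR_ge0.
  - apply/(measurable_restrictT _ (measurable_cball hs 1)); apply: measurable_funTS.
    apply: emeasurable_funM; last exact: measurable_weight.
    apply/measurable_EFinP; apply: (measurableT_comp (measurable_powR _)).
    exact: measurable_snorm.
  - exact: ge0_emeasurable_sum.
  - move=> h _; rewrite patchE; case: ifPn => [/set_mem h1|_]; last first.
      by apply: nneseries_ge0.
    have [->|h0] := eqVneq h 0%R.
      rewrite snorm0// powR0 ?gt_eqF// mul0e; exact: nneseries_ge0.
    have sh0 : (0 < snorm s h)%R by exact: snorm_gt0.
    have [n /andP[hn2 hn1]] := dyadic_bracket (introT andP (conj sh0 h1)).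
    apply: (le_trans _ (nneseries_term_le n (u0 ^~ h))).
    rewrite /u indicE mem_set//= mule1 -EFinM lee_fin.
    apply: ler_pM; rewrite ?powR_ge0 ?invr_ge0 ?exprn_ge0 ?snorm_ge0//.
      have -> : (t ^+ n = (2^-1 ^+ n) `^ a)%R.
        rewrite /t -powR_mulrn ?powR_ge0// -powRrM mulrC powRrM.
        by rewrite [X in (X `^ a)%R]powR_mulrn// invr_ge0.
      by apply: ge0_ler_powR; rewrite ?nnegrE ?snorm_ge0 ?exprn_ge0 ?(ltW a0).
    rewrite -[leRHS]invrK lef_pV2 ?posrE ?invr_gt0 ?exprn_gt0//.
    rewrite exprM -exprVn -exprVn; apply: lerXn2r; rewrite ?nnegrE ?snorm_ge0 ?exprn_ge0//.
    exact: ltW.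
rewrite integral_nneseries//.
apply: (@le_trans _ _ (\sum_(n <oo) (K * t ^+ n)%:E)); last first.
  apply: nneseries_geometric_le; first by rewrite mulr_ge0 ?exprn_ge0.
  by rewrite t1 ltW.
apply: lee_nneseriesT => n; first by apply: integral_ge0.
have mI : measurable_fun setT (fun h : Rd => (\1_(cball s (2^-1 ^+ n)%R) h)%:E : \bar R).
  by apply/measurable_EFinP; apply: measurable_indic; exact: measurable_cball.
rewrite ge0_integralZl//; last by rewrite lee_fin mulr_ge0 ?exprn_ge0// ltW.
rewrite integral_indic//; last exact: measurable_cball.
rewrite setIT; have n0 : (0 <= 2^-1 ^+ n :> R)%R by rewrite exprn_ge0.
rewrite [X in _ * X <= _](lebesgue_cball hs n0) -EFinM lee_fin.
rewrite le_eqVlt; apply/orP; left; apply/eqP; rewrite /K -/S.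
have e2 : (2 ^+ (n.+1 * S) * (2^-1 ^+ n) ^+ S = 2 ^+ S :> R)%R.
  rewrite mulSn exprD -mulrA -exprM exprVn mulfV ?mulr1//.
rewrite -e2 mulrACA mulrC -[RHS]mulrA; congr (_ * _)%R.
by rewrite mulrC.
Qed.

End Hle.

(** * Increments and their Chebyshev bound *)

Section increment_distance.
Context {R : realType} {d : nat} {s : 'I_d -> nat}.
Context {RS : regularity_structure R} {P : polynomial_part s RS}.
Context {gamma : R} {r : nat} (M : model P gamma r).
Hypothesis hd : (0 < d)%N.
Hypothesis hs : forall i, (1 <= s i)%N.
Local Notation Rd := 'rV[R]_d.
Local Notation Gam := (md_Gamma M).
Local Notation mu := (@lebesgue_rV R d).
Implicit Types (c z K rho : R) (f : Rd -> rs_space RS) (p q : \bar R) (D : set Rd).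

Definition increment_dist c rho f (x y : Rd) : R :=
  dnorm c rho (f x - Gam x y (f y)).

Lemma increment_dist_ge0 c rho f x y : 0 <= increment_dist c rho f x y.
Proof. exact: dnorm_ge0. Qed.

Lemma Gamma_sub c f x t y : in_below c (f y) ->
  f x - Gam x y (f y) = (f x - Gam x t (f t)) + Gam x t (f t - Gam t y (f y)).
Proof.
move=> hf; rewrite (groupB _ _ (md_Gamma_group M x t)) md_Gamma_comp.
by rewrite addrA subrK.
Qed.

Lemma Gamma_flip f x t : f x - Gam x t (f t) = - Gam x t (f t - Gam t x (f x)).
Proof.
rewrite (groupB _ _ (md_Gamma_group M x t)) md_Gamma_comp Gamma_id.
by rewrite opprB.
Qed.

Lemma increment_dist_chain c : c <= gamma -> exists C, 0 < C /\
  forall f, (forall x, in_below c (f x)) -> forall rho x t y,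
    0 < rho <= 1 -> snorm s (x - t) <= rho ->
    increment_dist c rho f x y <=
      increment_dist c rho f x t + C * increment_dist c rho f t y /\
    increment_dist c rho f x t <= C * increment_dist c rho f t x.
Proof.
move=> cg; have [C [C0 hC]] := Gamma_dnorm M cg; exists C; split => //.
move=> f hf rho x t y rho01 xt.
have hb u v : in_below c (f u - Gam u v (f v)).
  by apply: in_belowB => //; apply: group_in_below => //; exact: md_Gamma_group.
split.
  rewrite /increment_dist (Gamma_sub (c := c) x t (hf y)).
  by apply: (le_trans (dnormD _ _ _ _)); rewrite lerD2l; exact: hC.
by rewrite /increment_dist Gamma_flip dnormN; exact: hC.
Qed.

Lemma measurable_increment_dist c rho f : c <= gamma -> premodelled c f ->
  measurable_fun setT (fun xy : Rd * Rd => increment_dist c rho f xy.1 xy.2).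
Proof.
move=> cg pf; rewrite /increment_dist /dnorm.
apply: measurable_sum => b.
by apply: measurable_funM => //; exact: (measurable_pair_level M hd hs b cg pf pf).
Qed.

Lemma level_le_increment c b rho f h x : b < c -> 0 < rho -> snorm s h <= rho ->
  rho `^ b * `|(f (x + h) - Gam (x + h) x (f x)) b| <=
  rho `^ c * increment s Gam c b f h x.
Proof.
(* At [h = 0] the quotient on the right is 0 by convention, but the left side vanishes too because
   [Gamma_{x,x}] is the identity. *)
move=> bc rho0 hrho; have [->|h0] := eqVneq h 0.
  rewrite addr0 Gamma_id subrr normr0 mulr0 mulr_ge0 ?powR_ge0//.
  exact: increment_ge0.
have sh0 := snorm_gt0 hs h0.
rewrite /increment mulrA ler_pdivlMr ?powR_gt0// mulrAC ler_wpM2r//.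
apply: (@le_trans _ _ (rho `^ b * rho `^ (c - b))).
  rewrite ler_wpM2l ?powR_ge0//; apply: ge0_ler_powR;
    by rewrite ?nnegrE ?snorm_ge0 ?subr_ge0 ?(ltW bc) ?(ltW rho0).
by rewrite -powRD ?(gt_eqF rho0) ?implybT// addrC subrK.
Qed.

Lemma increment_le_dist c b f h x : b \in levels RS c -> h != 0 ->
  increment s Gam c b f h x <=
  snorm s h `^ (- c) * increment_dist c (snorm s h) f (x + h) x.
Proof.
move=> bl h0; have sh0 := snorm_gt0 hs h0.
rewrite /increment ler_pdivrMr ?powR_gt0//.
apply: (le_trans (dnorm_level _ bl sh0)).
rewrite mulrAC -powRD ?(gt_eqF sh0) ?implybT// addrA addNr sub0r.
exact: lexx.
Qed.

(** Turns bounds on the quotients at [h] into a bound on the weighted distance at any coarser scale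
    [rho >= |h|], all levels being combined with the common weight [rho ^ c]. *)
Lemma Lle_increment_dist p c rho f h K : (1 <= p)%E -> c <= gamma ->
  premodelled c f -> 0 < rho -> snorm s h <= rho -> 0 <= K ->
  (forall z, z \in levels RS c -> Lle mu p (EFin \o increment s Gam c z f h) K) ->
  Lle mu p (fun x => (increment_dist c rho f (x + h) x)%:E)
    ((size (levels RS c))%:R ^+ 2 * (rho `^ c * K)).
Proof.
move=> p1 cg pf rho0 hrho K0 H.
pose g b x : \bar R := (rho `^ b * `|(f (x + h) - Gam (x + h) x (f x)) b|)%:E.
rewrite (_ : (fun x => _) = (fun x => \sum_(b <- levels RS c) g b x)%E); last first.
  by apply/funext => x; rewrite sumEFin.
have mshift : measurable_fun setT (fun x : Rd => (x + h, x)).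
  by apply: measurable_fun_pair => //; exact: measurable_rV_add.
have mg b : measurable_fun setT (g b).
  apply/measurable_EFinP; apply: measurable_funM => //.
  exact: (measurableT_comp (measurable_pair_level M hd hs b cg pf pf) mshift).
apply: Lle_sum => //.
- by rewrite mulr_ge0 ?powR_ge0.
- by move=> b x; rewrite lee_fin mulr_ge0 ?powR_ge0.
move=> b bl.
apply: (@Lle_mono _ _ _ _ _ _ (fun x => (rho `^ c)%:E * (EFin \o increment s Gam c b f h) x)%E) => //.
- apply: measurable_funeM; apply/measurable_EFinP.
  exact: measurable_increment1 cg pf.
- by move=> x; rewrite lee_fin mulr_ge0 ?powR_ge0.
- move=> x; rewrite lee_fin; apply: level_le_increment => //.
  exact: levels_lt bl.
apply: LleZ => //.
- exact: powR_ge0.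
- by apply/measurable_EFinP; exact: measurable_increment1 cg pf.
- by move=> x; rewrite lee_fin increment_ge0.
- exact: H.
Qed.

Lemma ae_translate (Q : set Rd) (l : Rd) : {ae mu, forall x, Q x} ->
  {ae mu, forall x, Q (x + l)}.
Proof.
move=> [A [mA A0 hA]]; exists ((fun x : Rd => x + l) @^-1` A); split.
- by rewrite -[X in measurable X]setTI; exact: measurable_rV_add.
- by rewrite lebesgue_rV_translate.
- by move=> x /= hx; apply: hA.
Qed.

Lemma Lle_translate p (g : Rd -> \bar R) K (a : Rd) : (1 <= p)%E ->
  measurable_fun setT g -> (forall x, 0 <= g x)%E ->
  Lle mu p g K -> Lle mu p (fun x => g (x + a)) K.
Proof.
move=> p1 mg g0; rewrite /Lle.
have ae_case := @ae_translate (fun x => (g x <= K%:E)%E) a.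
case: p p1 => [r0|_|_] //; rewrite lee_fin => r1.
rewrite (ge0_integral_translate a (f := fun x => g x `^ r0)%E)//.
  exact: measurable_poweRfun.
by move=> x; exact: poweR_ge0.
Qed.

End increment_distance.

Section good_points.
Context {R : realType} {d : nat} (s : 'I_d -> nat).
Hypothesis hd : (0 < d)%N.
Hypothesis hs : forall i, (1 <= s i)%N.
Local Notation Rd := 'rV[R]_d.
Local Notation mu := (@lebesgue_rV R d).

Lemma measure_bigsetU_le (I : Type) (t : seq I) (E : I -> set Rd) (v : \bar R) :
  (0 <= v)%E -> (forall i, measurable (E i)) -> (forall i, mu (E i) <= v)%E ->
  (mu (\big[setU/set0]_(i <- t) E i) <= (size t)%:R%:E * v)%E.
Proof.
move=> v0 mE hE; elim: t => [|i t ih]; first by rewrite big_nil measure0 mul0e.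
rewrite big_cons /= -natr1 EFinD ge0_muleDl ?lee_fin// mul1e addeC.
apply: (le_trans (measureU2 mu _ _)) => //; first exact: bigsetU_measurable.
by apply: leeD => //; exact: hE.
Qed.

(* Chebyshev: the bad set fills less than half of a box of points k for which
   both k and h + k lie in the ball of radius |h| *)
Lemma good_point (I : choiceType) (t : seq I) (r : R) (F : I -> Rd -> \bar R) (h : Rd) :
  1 <= r -> (forall i, measurable_fun setT (F i)) ->
  (forall i k, 0 <= F i k)%E -> (forall i, F i 0 = 0%E) ->
  (forall i, Hle s r%:E (F i) 1) -> h != 0 -> snorm s h <= 1 ->
  exists k, [/\ snorm s k <= snorm s h, snorm s (h + k) <= snorm s h &
    forall i, i \in t -> (F i k <= (2 * (size t)%:R + 1)%R%:E)%E /\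
      (F i (h + k)%R <= (2 * (size t)%:R + 1)%R%:E)%E].
Proof.
move=> r1 mF F0 Fz hF h0 h1.
(* Each bad set has measure at most [rho ^ S / K], and the box [Q] below has measure [rho ^ S].
   There are [2 n] bad sets, [n] for [k] and [n] for [h + k], and [2 n < K] leaves a point of [Q]
   outside all of them. *)
set n := size t; pose K : R := 2 * n%:R + 1.
have K1 : 1 <= K by rewrite lerDr mulr_ge0.
have K0 : 0 < K := lt_le_trans ltr01 K1.
have r0 : 0 < r := lt_le_trans ltr01 r1.
pose rho := snorm s h; have rho0 : 0 < rho := snorm_gt0 hs h0.
pose S := scale_deg s.
have rhoS : 0 < rho ^+ S by exact: exprn_gt0.
pose E i := cball s rho `&` [set k | (K%:E < F i k)%E].
have mE i : measurable (E i).
  apply: measurableI; first exact: measurable_cball.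
  by rewrite -[X in measurable X]setTI; exact: emeasurable_fun_o_infty.
have muE i : (mu (E i) <= (K^-1 * rho ^+ S)%:E)%E.
  have : (\int[mu]_(k in E i) (K `^ r * rho ^- S)%:E <= 1)%E.
    have := hF i; rewrite /Hle powR1; apply: le_trans.
    apply: (@le_trans _ _ (\int[mu]_(k in E i) (F i k `^ r * (snorm s k ^- S)%:E))%E).
      apply: ge0_le_integral => //.
      + by move=> k _; rewrite lee_fin mulr_ge0 ?powR_ge0// invr_ge0 exprn_ge0 ?snorm_ge0.
      + by apply: measurable_funTS; exact: measurable_Hle_integrand.
      + move=> k [kB /= kF]; rewrite EFinM; apply: lee_pmul.
        * by rewrite lee_fin powR_ge0.
        * by rewrite lee_fin invr_ge0 exprn_ge0 ?snorm_ge0.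
        * by rewrite -poweR_EFin lee_poweR ?lee_fin// ltW.
        (* The weight is 0 at the origin by convention, so its lower bound [rho ^- S] requires
           [k != 0]; this holds in a bad set because [F i] vanishes at 0. *)
        * have k0 : k != 0.
            apply/eqP => k0; move: kF; rewrite k0 Fz lte_fin.
            by rewrite ltNge (ltW K0).
          have sk := snorm_gt0 hs k0.
          rewrite lee_fin lef_pV2 ?posrE ?exprn_gt0//.
          by apply: lerXn2r; rewrite ?nnegrE ?snorm_ge0.
    apply: ge0_subset_integral => //.
    - exact: measurable_cball.
    - by apply: measurable_funTS; exact: measurable_Hle_integrand.
    - by move=> k _; rewrite mule_ge0 ?poweR_ge0 ?weight_ge0.
    - by move=> k [kB _]; exact: le_trans h1.
  rewrite integral_cst// => H.
  have KrS : 0 < K `^ r * rho ^- S by rewrite mulr_gt0 ?powR_gt0// invr_gt0.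
  have {}H : (mu (E i) <= ((K `^ r * rho ^- S)^-1)%:E)%E.
    by rewrite -[leRHS]mule1 lee_pdivlMl// muleC muleC.
  apply: (le_trans H); rewrite lee_fin invfM invrK ler_wpM2r ?(ltW rhoS)//.
  by rewrite lef_pV2 ?posrE ?powR_gt0// le1r_powR.
pose B := \big[setU/set0]_(i <- t) E i.
have mB : measurable B by exact: bigsetU_measurable.
have muB : (mu B <= (n%:R * (K^-1 * rho ^+ S))%:E)%E.
  rewrite EFinM; apply: measure_bigsetU_le => //.
  by rewrite lee_fin mulr_ge0 ?invr_ge0 ?ltW.
(* Along each axis [k] points against [h], with [|k_i| <= rho ^ s_i]. As [|h_i| <= rho ^ s_i] as
   well, the sum [h_i + k_i] obeys the same bound. *)
pose a i := if 0 <= h ord0 i then - rho ^+ s i else 0.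
pose b i := if 0 <= h ord0 i then 0 else rho ^+ s i.
have rs i : 0 <= rho ^+ s i by rewrite exprn_ge0// ltW.
have ab i : a i <= b i by rewrite /a /b; case: ifP; rewrite ?oppr_le0.
pose Q := [set x : Rd | forall i, `[a i, b i]%classic (x ord0 i)].
have muQ : mu Q = (rho ^+ S)%:E.
  rewrite lebesgue_box//; congr EFin; rewrite /S /scale_deg expr_sum.
  apply: eq_bigr => i _.
  by rewrite /a /b; case: ifP; rewrite ?sub0r ?opprK ?subr0.
have mQ : measurable Q.
  by apply: (@measurable_box _ _ (fun i => `[_, _]%classic)) => i; exact: measurable_itv.
have mBh : measurable ((fun k : Rd => k + h) @^-1` B).
  by rewrite -[X in measurable X]setTI; exact: measurable_rV_add.
have nsub : ~ (Q `<=` B `|` (fun k : Rd => k + h) @^-1` B).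
  move=> QB; have : (mu Q <= mu B + mu B)%E.
    apply: (@le_trans _ _ (mu (B `|` (fun k : Rd => k + h) @^-1` B))).
      by apply: le_measure; rewrite ?inE//; exact: measurableU.
    apply: (le_trans (measureU2 mu _ _)) => //.
    by apply: leeD => //; rewrite [leLHS](lebesgue_rV_translate h mB).
  rewrite muQ leNgt => /negP; apply.
  apply: (le_lt_trans (leeD muB muB)); rewrite -EFinD lte_fin.
  rewrite mulrA -mulrDl -ltr_pdivlMr// divff ?gt_eqF//.
  by rewrite -mulrDl ltr_pdivrMr// mul1r /K; lra.
have [k Qk /not_orP[kB khB]] : exists2 k, Q k &
    ~ (B k \/ ((fun k : Rd => k + h) @^-1` B) k).
  apply: contrapT => hk; apply: nsub => k Qk.
  by apply: contrapT => hB; apply: hk; exists k.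
have kh : snorm s k <= rho.
  rewrite (snormP hs _ (ltW rho0)); apply/forallP => i.
  have := Qk i; rewrite /a /b /= in_itv/=; have := rs i.
  by case: ifP => _ r0' /andP[k1 k2]; rewrite ler_norml; apply/andP; split; lra.
have hk : snorm s (h + k) <= rho.
  rewrite (snormP hs _ (ltW rho0)); apply/forallP => i; rewrite mxE.
  have := snorm_coord hs h i; rewrite -/rho ler_norml => /andP[hi1 hi2].
  have := Qk i; rewrite /a /b /= in_itv/=.
  case: ifPn => [hi|]; last rewrite -ltNge => hi; move=> /andP[k1 k2].
    by rewrite ler_norml; apply/andP; split; lra.
  by rewrite ler_norml; apply/andP; split; lra.
exists k; split => // i it.
have EB k' : E i k' -> B k'.
  move=> Ek'; rewrite /B -bigcup_seq; by exists i.
split; rewrite leNgt; apply/negP => H.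
  by apply: kB; apply: EB.
by apply: khB; apply: EB; rewrite addrC.
Qed.

End good_points.

(** * Families of modelled distributions bounded in norm *)

Section bounded_families.
Context {R : realType} {d : nat} {s : 'I_d -> nat}.
Context {RS : regularity_structure R} {P : polynomial_part s RS}.
Context {gamma : R} {r : nat} (M : model P gamma r).
Hypothesis hd : (0 < d)%N.
Hypothesis hs : forall i, (1 <= s i)%N.
Local Notation Rd := 'rV[R]_d.
Local Notation Gam := (md_Gamma M).
Local Notation mu := (@lebesgue_rV R d).
Implicit Types (c z K rho : R) (f : Rd -> rs_space RS) (p q : \bar R) (D : set Rd).

Definition bounded_by D p q c f K : Prop := premodelled c f /\
  forall z, z \in levels RS c ->
    (local_part D p f z <= K%:E)%E /\ (increment_part s Gam D p q c f z <= K%:E)%E.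

Definition bounded_embedding D p q c p' q' c' : Prop :=
  exists C, 0 < C /\ forall f K, 0 < K -> bounded_by D p q c f K ->
    bounded_by D p' q' c' (restrict_below c' f) (C * K).

Lemma local_partP D p f z K : (1 <= p)%E -> 0 <= K ->
  (local_part D p f z <= K%:E)%E <->
  Lle mu p ((EFin \o (fun x => `|f x z|)) \_ D) K.
Proof. by move=> p1 K0; apply: Lp_normP. Qed.

Lemma increment_partP D p q c f z K : (1 <= q)%E -> 0 <= K ->
  (increment_part s Gam D p q c f z <= K%:E)%E <->
  Hle s q (incr_norm M D p c z f) K.
Proof. by move=> q1 K0; apply: Lq_normP => // h; exact: incr_norm_ge0. Qed.

Lemma strongly_measurableZ (V : normedModType R) (a : R) (g : Rd -> V) :
  strongly_measurable g -> strongly_measurable (fun x => a *: g x).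
Proof.
move=> [u [hu uv]]; have [->|a0] := eqVneq a 0.
  by under eq_fun do rewrite scale0r; exact: strongly_measurable_cst.
exists (fun n x => a *: u n x); split => [n|x]; last exact: cvgZl_tmp.
have [fu mu'] := hu n; split.
  apply: (@sub_finite_set _ _ ((fun v => a *: v) @` range (u n))).
    by move=> _ [x _ <-]; exists (u n x) => //; exists x.
  exact: finite_image.
move=> v; rewrite (_ : _ @^-1` _ = u n @^-1` [set a^-1 *: v])//.
apply/seteqP; split => x /=; first by move=> <-; rewrite scalerA mulVf// scale1r.
by move=> ->; rewrite scalerA mulfV// scale1r.
Qed.

Lemma premodelledZ c (a : R) f : premodelled c f -> premodelled c (fun x => a *: f x).
Proof.
move=> [h1 h2]; split => [x z cz|z hz]; first by rewrite dsum_valZ h1// scaler0.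
by apply: strongly_measurableZ; exact: h2.
Qed.

Lemma Lp_normZ D p (a : R) (g : Rd -> R) : (1 <= p)%E -> measurable D ->
  measurable_fun setT g -> (forall x, 0 <= g x) -> forall K : R, 0 <= K ->
  (Lp_norm D p g <= K%:E)%E ->
  (Lp_norm D p (fun x => (`|a| * g x)%R) <= (`|a| * K)%R%:E)%E.
Proof.
move=> p1 mD mg g0 K K0 /(Lp_normP D p1 g0 K0) h.
apply/Lp_normP; rewrite ?mulr_ge0//; first by move=> x; rewrite mulr_ge0.
rewrite (_ : _ \_ D = (fun x => `|a|%:E * ((EFin \o g) \_ D) x)%E).
  apply: LleZ => //; first exact: measurable_restrict_setT.
  exact: restrict_EFin_ge0.
by apply/funext => x; rewrite !patchE; case: ifP => // _; rewrite mule0.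
Qed.

Lemma incrementZ c z (a : R) f h x :
  increment s Gam c z (fun y => a *: f y) h x = `|a| * increment s Gam c z f h x.
Proof.
rewrite /increment (groupZ _ _ (md_Gamma_group M _ _)) -scalerBr dsum_valZ normrZ.
by rewrite mulrA.
Qed.

Lemma incr_normZ D p c z (a : R) f h : (1 <= p)%E -> measurable D ->
  c <= gamma -> premodelled c f -> a != 0 ->
  (incr_norm M D p c z (fun y => (a *: f y)%R) h <=
   `|a|%:E * incr_norm M D p c z f h)%E.
Proof.
move=> p1 mD cg pf a0; have a0' : 0 < `|a| by rewrite normr_gt0.
rewrite /incr_norm (_ : increment _ _ _ _ _ _ =
    (fun x => `|a| * increment s Gam c z f h x)); last first.
  by apply/funext => x; rewrite incrementZ.
apply: lee_pmul_bound => // [|K K0 hK]; first exact: Lnorm_ge0.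
apply: Lp_normZ => //; [|by move=> x; exact: increment_ge0|exact: ltW].
exact: measurable_increment1 cg pf.
Qed.

Lemma bounded_byZ D p q c f K (a : R) : (1 <= p)%E -> (1 <= q)%E ->
  measurable D -> c <= gamma -> 0 <= K -> a != 0 ->
  bounded_by D p q c f K -> bounded_by D p q c (fun x => a *: f x) (`|a| * K).
Proof.
move=> p1 q1 mD cg K0 a0 [pf h]; split; first exact: premodelledZ.
move=> z zl; have [h1 h2] := h z zl; split.
  rewrite /local_part (_ : (fun x => _) = (fun x => `|a| * `|f x z|)); last first.
    by apply/funext => x; rewrite dsum_valZ normrZ.
  by apply: Lp_normZ => //; exact: measurable_level pf.
apply/increment_partP; rewrite ?mulr_ge0//.
apply: (@Hle_mono _ _ _ hs _ _ (fun h => `|a|%:E * incr_norm M D p c z f h)%E) => //.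
- by apply: measurable_incr_norm => //; exact: premodelledZ.
- by apply: measurable_funeM; exact: measurable_incr_norm.
- by move=> k; exact: incr_norm_ge0.
- by move=> k; exact: incr_normZ.
apply: HleZ => //; first exact: measurable_incr_norm.
- by move=> k; exact: incr_norm_ge0.
- by apply/increment_partP.
Qed.

Lemma restrict_belowZ c (a : R) f :
  restrict_below c (fun x => a *: f x) = fun x => a *: restrict_below c f x.
Proof. by apply/funext => x; rewrite /restrict_below dsum_belowZ. Qed.

Lemma premodelled_restrict c c' f : c' <= c -> premodelled c f ->
  premodelled c' (restrict_below c' f).
Proof.
move=> cc' [h1 h2]; split => [x|z [hz zc]]; first exact: in_below_dsum_below.
rewrite (_ : (fun x => _) = (fun x => f x z)).
  by apply: h2; split => //; exact: lt_le_trans cc'.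
by apply/funext => x; rewrite /restrict_below dsum_belowE zc.
Qed.

(** Apply the hypothesis to [f / K] and scale back by [K]. *)
Lemma bounded_embedding_unit D p q c p' q' c' :
  (1 <= p)%E -> (1 <= q)%E -> (1 <= p')%E -> (1 <= q')%E ->
  measurable D -> c <= gamma -> c' <= gamma ->
  (exists C, 0 < C /\ forall f, bounded_by D p q c f 1 ->
    bounded_by D p' q' c' (restrict_below c' f) C) ->
  bounded_embedding D p q c p' q' c'.
Proof.
move=> p1 q1 p'1 q'1 mD cg c'g [C [C0 hC]]; exists C; split => // f K K0 hf.
have Kn0 : K != 0 by rewrite gt_eqF.
have := bounded_byZ p1 q1 mD cg (ltW K0) (invr_neq0 Kn0) hf.
rewrite ger0_norm ?invr_ge0 ?(ltW K0)// mulVf// => /hC.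
move=> /(bounded_byZ p'1 q'1 mD c'g (ltW C0) Kn0).
rewrite ger0_norm ?(ltW K0)// mulrC; congr bounded_by.
by apply/funext => x; rewrite restrict_belowZ scalerA mulfV// scale1r.
Qed.

Lemma bounded_embedding_comp D p q c p' q' c' p'' q'' c'' : c'' <= c' ->
  bounded_embedding D p q c p' q' c' ->
  bounded_embedding D p' q' c' p'' q'' c'' ->
  bounded_embedding D p q c p'' q'' c''.
Proof.
move=> cc [C [C0 hC]] [C' [C'0 hC']]; exists (C' * C); split; first exact: mulr_gt0.
move=> f K K0 /(hC _ _ K0) /(hC' _ _ (mulr_gt0 C0 K0)).
rewrite mulrA; congr bounded_by.
by apply/funext => x; rewrite /restrict_below dsum_below_below.
Qed.

Lemma restrict_below_id c f : (forall x, in_below c (f x)) -> restrict_below c f = f.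
Proof. by move=> h; apply/funext => x; rewrite /restrict_below dsum_below_id. Qed.

Lemma increment_sup p c (a : R) : (1 <= p)%E -> 1 <= a -> c <= gamma ->
  exists C, 0 < C /\ forall f, premodelled c f ->
    (forall z, z \in levels RS c -> Hle s a%:E (incr_norm M setT p c z f) 1) ->
    forall z h, z \in levels RS c -> h != 0 -> snorm s h <= 1 ->
      (incr_norm M setT p c z f h <= C%:E)%E.
Proof.
move=> p1 a1 cg; have [C [C0 hC]] := increment_dist_chain M cg.
pose N : R := (size (levels RS c))%:R; pose K := 2 * N + 1.
have N0 : 0 <= N by [].
have K0 : 0 < K by rewrite /K; lra.
(* [K] is the size of the good increments, [N ^ 2] comes from the sum over the levels, [C] from
   [Gamma] and 4 from adding the two legs of the path; the final 1 ensures positivity. *)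
exists (4 * (C * (N ^+ 2 * K)) + 1); split.
  by rewrite ltr_wpDl// !mulr_ge0 ?exprn_ge0// ltW.
move=> f pf H z h zl h0 h1.
(* [good_point] takes a family over all real indices; those that are not levels get the zero
   function. *)
pose F i := if i \in levels RS c then incr_norm M setT p c i f else cst 0%E.
have F1 i : measurable_fun setT (F i).
  by rewrite /F; case: ifP => _ //; exact: measurable_incr_norm.
have F2 i k : (0 <= F i k)%E.
  by rewrite /F; case: ifP => _ //; exact: incr_norm_ge0.
have F3 i : F i 0 = 0%E.
  by rewrite /F; case: ifP => // il; apply: incr_norm0 => //; exact: levels_lt il.
have F4 i : Hle s a%:E (F i) 1.
  rewrite /F; case: ifP => [|_]; first exact: H.
  rewrite /Hle /= integral0_eq ?lee_fin ?powR_ge0// => x _.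
  by rewrite powR0 ?mul0e// gt_eqF// (lt_le_trans ltr01).
have [k [kh hk hF]] := good_point hs (levels RS c) a1 F1 F2 F3 F4 h0 h1.
set rho := snorm s h in kh hk.
have rho0 : 0 < rho := snorm_gt0 hs h0.
have rho01 : 0 < rho <= 1 by rewrite rho0.
have L l : snorm s l <= rho ->
    (forall i, i \in levels RS c -> (F i l <= K%:E)%E) ->
    Lle mu p (fun x => (increment_dist M c rho f (x + l) x)%:E)
      (N ^+ 2 * (rho `^ c * K)).
  move=> hl hFl; apply: Lle_increment_dist => //; first exact: ltW.
  move=> i il; apply/Lp_normTP => //; first by move=> x; exact: increment_ge0.
  - exact: ltW.
  - by have := hFl i il; rewrite /F il.
have Lk := L k kh (fun i il => (hF i il).1).
have Lhk := L (h + k) hk (fun i il => (hF i il).2).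
have md l : measurable_fun setT (fun x : Rd => (increment_dist M c rho f (x + l) x)%:E).
  apply/measurable_EFinP.
  apply: (measurableT_comp (measurable_increment_dist M hd hs rho cg pf)
    (g := fun x : Rd => (x + l, x))).
  by apply: measurable_fun_pair => //; exact: measurable_rV_add.
have B0 : 0 <= N ^+ 2 * (rho `^ c * K).
  by rewrite !mulr_ge0 ?exprn_ge0 ?powR_ge0// ltW.
have Lh : Lle mu p (fun x => (increment_dist M c rho f (x + h) x)%:E)
    (4 * (C * (N ^+ 2 * (rho `^ c * K)))).
  (* Both legs meet at [x + h + k]. The leg from [x + h] is reversed at the price of [C], which
     makes it an increment of shift [k] based at [x + h]; translation invariance then moves its base
     point to [x]. *)
  pose g' (x : Rd) := (C%:E * (increment_dist M c rho f ((x + h) + k)%R (x + h)%R)%:E +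
    C%:E * (increment_dist M c rho f (x + (h + k))%R x)%:E)%E.
  apply: (@Lle_mono _ _ _ _ _ _ g') => //; rewrite ?/g'.
  - apply: emeasurable_funD; apply: measurable_funeM => //.
    exact: (measurableT_comp (md k) (measurable_rV_add h)).
  - by move=> x; rewrite lee_fin increment_dist_ge0.
  - move=> x; rewrite -!EFinM -EFinD lee_fin.
    have hk' : snorm s (x + h - (x + (h + k))) <= rho.
      by rewrite opprD addrACA subrr add0r opprD addNKr snormN.
    have [h2 _] := hC f pf.1 rho (x + h) (x + (h + k)) x rho01 hk'.
    have [_ h3] := hC f pf.1 rho (x + h) (x + (h + k)) x rho01 hk'.
    by apply: (le_trans h2); rewrite lerD2r -(addrA x).
  apply: LleD => //.
  - by rewrite mulr_ge0// ltW.
  - apply: measurable_funeM.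
    exact: (measurableT_comp (md k) (measurable_rV_add h)).
  - exact: measurable_funeM.
  - by move=> x; rewrite -EFinM lee_fin mulr_ge0 ?increment_dist_ge0// ltW.
  - by move=> x; rewrite -EFinM lee_fin mulr_ge0 ?increment_dist_ge0// ltW.
  - apply: LleZ => //; first exact: ltW.
    + exact: (measurableT_comp (md k) (measurable_rV_add h)).
    + by move=> x; rewrite lee_fin increment_dist_ge0.
    + apply: (@Lle_translate _ _ _ (fun x =>
        (increment_dist M c rho f (x + k)%R x)%:E)) => //.
      by move=> x; rewrite lee_fin increment_dist_ge0.
  - apply: LleZ => //; first exact: ltW.
    by move=> x; rewrite lee_fin increment_dist_ge0.
have Lz : Lle mu p (EFin \o increment s Gam c z f h) (4 * (C * (N ^+ 2 * K)) + 1).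
  apply: (@Lle_widen _ _ _ _ _ _ (rho `^ (- c) * (4 * (C * (N ^+ 2 * (rho `^ c * K)))))) => //.
  - by rewrite !mulr_ge0 ?exprn_ge0 ?powR_ge0// ltW.
  - rewrite [leLHS](_ : _ = 4 * (C * (N ^+ 2 * K))); first by rewrite lerDl.
    have e : rho `^ (- c) * rho `^ c = 1 by rewrite powRN mulVf// gt_eqF// powR_gt0.
    by rewrite -[RHS]mul1r -e; ring.
  apply: (@Lle_mono _ _ _ _ _ _ (fun x : Rd =>
    (rho `^ (- c))%:E * (increment_dist M c rho f (x + h)%R x)%:E)%E) => //.
  - by apply/measurable_EFinP; exact: measurable_increment1 cg pf.
  - exact: measurable_funeM.
  - by move=> x; rewrite lee_fin increment_ge0.
  - by move=> x; rewrite -EFinM lee_fin; exact: increment_le_dist.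
  apply: LleZ => //; first exact: powR_ge0.
  - by rewrite !mulr_ge0 ?exprn_ge0 ?powR_ge0// ltW.
  - by move=> x; rewrite lee_fin increment_dist_ge0.
apply/Lp_normTP => //; first by move=> x; exact: increment_ge0.
by rewrite addr_ge0// !mulr_ge0 ?exprn_ge0// ltW.
Qed.

Lemma bounded_embedding_q p q q' c : (1 <= p)%E -> (1 <= q)%E -> (q < q')%E ->
  c <= gamma -> bounded_embedding setT p q c p q' c.
Proof.
move=> p1 q1 qq' cg; have q'1 : (1 <= q')%E := le_trans q1 (ltW qq').
apply: bounded_embedding_unit => //.
case: q q1 qq' => [a|_|]//; last by rewrite ltNge leey.
rewrite lee_fin => a1 qq'; have [C [C0 hC]] := increment_sup p1 a1 cg.
have C1 : 1 <= C + 1 by rewrite lerDr ltW.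
have C10 : 0 < C + 1 := lt_le_trans ltr01 C1.
(* A constant that is at least 1 dominates the local norms and also satisfies
   [(C + 1) ^ (b - a) <= (C + 1) ^ b] below. *)
exists (C + 1); split => // f [pf hf].
rewrite (restrict_below_id pf.1); split => // z zl.
have [h1 h2] := hf z zl; split; first by apply: (le_trans h1); rewrite lee_fin.
have H i : i \in levels RS c -> Hle s a%:E (incr_norm M setT p c i f) 1.
  move=> il; have [E _] := @increment_partP setT p a%:E c f i 1 a1 ler01.
  exact: E (hf i il).2.
have sup h : h != 0 -> snorm s h <= 1 -> (incr_norm M setT p c z f h <= (C + 1)%:E)%E.
  move=> h0 hh; apply: (le_trans (hC f pf H z h zl h0 hh)).
  by rewrite lee_fin lerDl.
apply/increment_partP => //; first exact: ltW.
case: q' q'1 qq' => [b|_ _|]//; last first.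
  by apply: filterS (ae_neq0 hd hs) => h h0 hB; exact: sup.
rewrite lee_fin lte_fin => b1 ab.
have a0 : 0 < a := lt_le_trans ltr01 a1; have b0 : 0 < b := lt_trans a0 ab.
pose G h := incr_norm M setT p c z f h.
have mG : measurable_fun setT G by exact: measurable_incr_norm.
have G0 h : (0 <= G h)%E by exact: incr_norm_ge0.
(* Interpolation between the exponents [a] and [+oo]: [G ^ b = G ^ (b - a) * G ^ a], with the first
   factor bounded by the supremum. The supremum bound excludes [h = 0], where the weight is 0 by
   convention. *)
apply: (@le_trans _ _ (\int[mu]_(h in cball s 1)
    (((C + 1) `^ (b - a))%:E * (G h `^ a * (snorm s h ^- scale_deg s)%:E)))%E).
  apply: ge0_le_integral => //.
  - exact: measurable_cball.
  - by move=> h _; rewrite mule_ge0 ?poweR_ge0 ?weight_ge0.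
  - by apply: measurable_funTS; exact: measurable_Hle_integrand.
  - apply: measurable_funTS; apply: measurable_funeM.
    exact: measurable_Hle_integrand.
  - move=> h hB; have [->|h0] := eqVneq h 0.
      by rewrite snorm0// expr0n gtn_eqF ?scale_deg_gt0//= invr0 !mule0.
    rewrite muleA lee_wpmul2r ?weight_ge0// -/(G h).
    have Gfin : G h \is a fin_num.
      by rewrite ge0_fin_numE// (le_lt_trans (sup h h0 hB))// ltry.
    have := sup h h0 hB; rewrite -/(G h) -(fineK Gfin) lee_fin => Gle.
    have g0 : 0 <= fine (G h) by rewrite fine_ge0.
    rewrite !poweR_EFin -EFinM lee_fin.
    have [->|gn0] := eqVneq (fine (G h)) 0.
      by rewrite !powR0 ?mulr0// gt_eqF.
    have -> : fine (G h) `^ b = fine (G h) `^ (b - a) * fine (G h) `^ a.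
      by rewrite -powRD ?subrK// gn0 implybT.
    rewrite ler_wpM2r ?powR_ge0//; apply: ge0_ler_powR; rewrite ?nnegrE//.
    - by rewrite subr_ge0 ltW.
    - exact: ltW.
rewrite ge0_integralZl//.
- apply: (@le_trans _ _ (((C + 1) `^ (b - a))%:E * 1)%E).
    rewrite lee_wpmul2l ?lee_fin ?powR_ge0//.
    by have := H z zl; rewrite /Hle powR1.
  by rewrite mule1 lee_fin; apply: ler_powR => //; rewrite gerBl ltW.
- exact: measurable_cball.
- by apply: measurable_funTS; exact: measurable_Hle_integrand.
- by move=> h _; rewrite mule_ge0 ?poweR_ge0 ?weight_ge0.
- by rewrite lee_fin powR_ge0.
Qed.

End bounded_families.

(** * Trading a power of |h| for integrability in h *)

Section integrability_gain.
Context {R : realType} {d : nat} (s : 'I_d -> nat).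
Hypothesis hd : (0 < d)%N.
Hypothesis hs : forall i, (1 <= s i)%N.
Local Notation Rd := 'rV[R]_d.
Local Notation mu := (@lebesgue_rV R d).
Local Open Scope ereal_scope.

Lemma powR_le1 (x a : R) : (0 <= x <= 1)%R -> (0 <= a)%R -> (x `^ a <= 1)%R.
Proof.
move=> /andP[x0 x1] a0; suff : (x `^ a <= 1 `^ a)%R by rewrite powR1.
by apply: ge0_ler_powR; rewrite ?nnegrE.
Qed.

(** As [x + 1 >= 1], the exponent may be raised from [b] to [a]; then [x + 1 <= 2 * max x 1]. *)
Lemma poweR_add1_le (x : \bar R) (a b : R) : 0 <= x -> (1 <= b)%R -> (b <= a)%R ->
  (x + 1) `^ b <= (2 `^ a)%:E * (x `^ a + 1).
Proof.
move=> x0 b1 ba; have a1 := le_trans b1 ba.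
have a0 : (0 < a)%R := lt_le_trans ltr01 a1.
case: x x0 => [x||]//; last first.
  rewrite !poweRyr ?gt_eqF// ?(lt_le_trans ltr01)// addye//.
  by rewrite gt0_muley// lte_fin powR_gt0.
rewrite lee_fin => x0; rewrite -EFinD !poweR_EFin -EFinD -EFinM lee_fin.
apply: (@le_trans _ _ ((x + 1) `^ a)%R).
  by apply: ler_powR => //; rewrite lerDr.
have [x1|x1] := leP x 1%R.
  apply: (@le_trans _ _ (2 `^ a)%R).
    by apply: ge0_ler_powR; rewrite ?nnegrE ?addr_ge0 ?(ltW a0)//; lra.
  by rewrite ler_peMr ?powR_ge0// lerDr powR_ge0.
apply: (@le_trans _ _ ((2 * x) `^ a)%R).
  by apply: ge0_ler_powR; rewrite ?nnegrE ?addr_ge0 ?mulr_ge0 ?(ltW a0)//; lra.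
by rewrite powRM// ler_wpM2l ?powR_ge0// lerDl.
Qed.

(** The 1 added to [F h] stands for the local norms. The weight alone is not integrable at the
    origin, so it is the factor [|h| ^ e] that makes this constant admissible, and with it the
    passage from [q] to a smaller [q']. *)
Lemma Hle_gain (q q' : \bar R) (e A : R) : 1 <= q' -> q' <= q -> (0 < e)%R ->
  (0 <= A)%R -> exists C, (0 < C)%R /\ forall F F' : Rd -> \bar R,
    measurable_fun setT F -> measurable_fun setT F' ->
    (forall h, 0 <= F h) -> (forall h, 0 <= F' h) ->
    (forall h, h != 0%R -> (snorm s h <= 1)%R ->
      F' h <= (A * snorm s h `^ e)%:E * (F h + 1)) ->
    Hle s q F 1 -> Hle s q' F' C.
Proof.
move=> q'1 q'q e0 A0.
case: q' q'1 q'q => [b|_|]//; last first.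
  rewrite leye_eq => /eqP ->; exists (A * 2 + 1)%R; split.
    by rewrite ltr_wpDl// mulr_ge0.
  move=> F F' mF mF' F0 F'0 FF' hF.
  apply: filterS2 hF (ae_neq0 hd hs) => h hF h0 hB.
  apply: (le_trans (FF' h h0 hB)).
  apply: (@le_trans _ _ (A%:E * 2%:E)); last by rewrite -EFinM lee_fin lerDl.
  apply: lee_pmul.
  - by rewrite lee_fin mulr_ge0 ?powR_ge0.
  - by rewrite adde_ge0.
  - by rewrite lee_fin ler_piMr// powR_le1 ?snorm_ge0//; exact: ltW.
  - by rewrite -[2%R]/(1 + 1)%R EFinD leeD2r// hF.
rewrite lee_fin => b1 bq; have b0 : (0 < b)%R := lt_le_trans ltr01 b1.
have eb0 : (0 < e * b)%R by exact: mulr_gt0.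
have [I [I0 hI]] := weight_int hs eb0.
have m1 : measurable_fun setT (fun h : Rd =>
    (snorm s h `^ (e * b))%:E * (snorm s h ^- scale_deg s)%:E).
  apply: emeasurable_funM; last exact: measurable_weight.
  apply/measurable_EFinP; apply: (measurableT_comp (measurable_powR _)).
  exact: measurable_snorm.
have m1_0 (h : Rd) : 0 <= (snorm s h `^ (e * b))%:E * (snorm s h ^- scale_deg s)%:E.
  by rewrite mule_ge0 ?weight_ge0// lee_fin powR_ge0.
have mball : measurable (cball s 1 : set Rd) by exact: measurable_cball.
(* covers both q < +oo and q = +oo *)
have main (B : R) (F F' Psi : Rd -> \bar R) : (0 <= B)%R ->
    measurable_fun setT F' -> measurable_fun setT Psi ->
    (forall h, 0 <= F h) -> (forall h, 0 <= F' h) -> (forall h, 0 <= Psi h) ->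
    (forall h, h != 0%R -> (snorm s h <= 1)%R ->
      F' h <= (A * snorm s h `^ e)%:E * (F h + 1)) ->
    {ae mu, forall h, cball s 1 h -> (snorm s h `^ (e * b))%:E * (F h + 1) `^ b *
        (snorm s h ^- scale_deg s)%:E <=
      B%:E * (Psi h + (snorm s h `^ (e * b))%:E * (snorm s h ^- scale_deg s)%:E)} ->
    \int[mu]_(h in cball s 1) Psi h <= 1 ->
    Hle s b%:E F' (A `^ b * (B * (1 + I)) + 1).
  move=> B0 mF' mPsi F0 F'0 Psi0 FF' hB iPsi.
  have mPI : measurable_fun (cball s 1) (fun h => Psi h +
      (snorm s h `^ (e * b))%:E * (snorm s h ^- scale_deg s)%:E).
    by apply: measurable_funTS; exact: emeasurable_funD.
  have X0 : (0 <= A `^ b * (B * (1 + I)))%R.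
    by rewrite !mulr_ge0 ?powR_ge0 ?addr_ge0.
  apply: (@le_trans _ _ (A `^ b * (B * (1 + I)))%:E); last first.
    rewrite lee_fin; apply: (@le_trans _ _ (A `^ b * (B * (1 + I)) + 1)%R).
      by rewrite lerDl.
    by rewrite le1r_powR// lerDr.
  apply: (@le_trans _ _ (\int[mu]_(h in cball s 1) ((A `^ b * B)%:E *
      (Psi h + (snorm s h `^ (e * b))%:E * (snorm s h ^- scale_deg s)%:E)))).
    apply: ae_ge0_le_integral => //.
    - by move=> h _; rewrite mule_ge0 ?poweR_ge0 ?weight_ge0.
    - by apply: measurable_funTS; exact: measurable_Hle_integrand.
    - move=> h _; rewrite mule_ge0 ?adde_ge0//.
      by rewrite lee_fin mulr_ge0 ?powR_ge0.
    - exact: measurable_funeM.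
    - apply: filterS2 hB (ae_neq0 hd hs) => h hB h0 h1.
      rewrite EFinM -muleA.
      apply: (le_trans _ (lee_wpmul2l _ (hB h1))); last by rewrite lee_fin powR_ge0.
      rewrite muleA lee_wpmul2r ?weight_ge0//.
      apply: (le_trans (lee_poweR _ _ (FF' h h0 h1))) => //; first exact: ltW.
      rewrite poweRM ?adde_ge0//; last by rewrite lee_fin mulr_ge0 ?powR_ge0.
      by rewrite poweR_EFin powRM ?powR_ge0// -powRrM EFinM muleA.
  rewrite ge0_integralZl//; last 2 first.
    - by move=> h _; rewrite adde_ge0.
    - by rewrite lee_fin mulr_ge0 ?powR_ge0.
  rewrite mulrA [leRHS]EFinM lee_wpmul2l ?lee_fin ?mulr_ge0 ?powR_ge0//.
  rewrite ge0_integralD//; last 2 first.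
    - exact: measurable_funTS.
    - exact: measurable_funTS.
  by rewrite EFinD leeD.
case: q bq => [a|_|]//; last first.
  exists (A `^ b * ((2 `^ b) * (1 + I)) + 1)%R; split.
    by rewrite ltr_wpDl// !mulr_ge0 ?powR_ge0 ?addr_ge0.
  move=> F F' mF mF' F0 F'0 FF' hF.
  apply: (main (2 `^ b)%R F F' (cst 0)) => //.
    apply: filterS hF => h hF h1; rewrite add0e -muleA muleCA lee_wpmul2r//.
    rewrite -poweR_EFin; apply: lee_poweR; [exact: ltW|by rewrite adde_ge0|].
    by rewrite -[2%R]/(1 + 1)%R EFinD leeD2r// hF.
  by rewrite integral0_eq// lee_fin.
rewrite lee_fin => ba.
exists (A `^ b * ((2 `^ a) * (1 + I)) + 1)%R; split.
  by rewrite ltr_wpDl// !mulr_ge0 ?powR_ge0 ?addr_ge0.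
move=> F F' mF mF' F0 F'0 FF' hF.
apply: (main (2 `^ a)%R F F' (fun h => F h `^ a * (snorm s h ^- scale_deg s)%:E)) => //.
- exact: measurable_Hle_integrand.
- by move=> h; rewrite mule_ge0 ?poweR_ge0 ?weight_ge0.
- apply: nearW => h h1.
  apply: (@le_trans _ _ ((2 `^ a)%:E * ((F h `^ a + 1) *
      ((snorm s h `^ (e * b))%:E * (snorm s h ^- scale_deg s)%:E)))).
    by rewrite -muleA muleCA [leRHS]muleA lee_wpmul2r// poweR_add1_le.
  rewrite lee_wpmul2l ?lee_fin ?powR_ge0//.
  rewrite ge0_muleDl ?poweR_ge0// mul1e leeD2r// lee_wpmul2l ?poweR_ge0//.
  rewrite -EFinM lee_fin ler_piMl ?invr_ge0 ?exprn_ge0 ?snorm_ge0//.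
  by rewrite powR_le1 ?snorm_ge0//; exact: ltW.
- by have := hF; rewrite /Hle powR1.
Qed.

End integrability_gain.

(** * Lowering the regularity or the integrability *)

Section lower_cases.
Context {R : realType} {d : nat} {s : 'I_d -> nat}.
Context {RS : regularity_structure R} {P : polynomial_part s RS}.
Context {gamma : R} {r : nat} (M : model P gamma r).
Hypothesis hd : (0 < d)%N.
Hypothesis hs : forall i, (1 <= s i)%N.
Local Notation Rd := 'rV[R]_d.
Local Notation Gam := (md_Gamma M).
Local Notation mu := (@lebesgue_rV R d).
Implicit Types (c z K rho : R) (f : Rd -> rs_space RS) (p q : \bar R) (D : set Rd).

Lemma below_all (t : seq R) : (forall x, x \in t -> 0 < x) ->
  exists2 e, 0 < e & forall x, x \in t -> e <= x.
Proof.
elim: t => [|x t ih] h; first by exists 1.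
have [|e e0 he] := ih; first by move=> y yt; apply: h; rewrite inE yt orbT.
exists (Num.min e x); first by rewrite lt_min e0 h// mem_head.
move=> y; rewrite inE ge_min => /orP[/eqP ->|/he ->//].
by rewrite lexx orbT.
Qed.

(** Only finitely many levels lie between [c'] and [c], and none of them equals [c']; [e] is the
    least of finitely many positive distances. *)
Lemma level_gap c c' : c' < c -> ~ rs_hom RS c' -> exists2 e, 0 < e &
  e <= c - c' /\ forall b, b \in levels RS c -> c' <= b -> e <= b - c'.
Proof.
move=> cc' hc'.
have [|e e0 he] := @below_all ((c - c') :: [seq b - c' | b <- levels RS c & c' <= b]).
  move=> x; rewrite inE => /orP[/eqP ->|/mapP[b]]; first by rewrite subr_gt0.
  rewrite mem_filter => /andP[cb bl] ->; rewrite subr_gt0 lt_neqAle cb andbT.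
  by apply/eqP => c'b; apply: hc'; rewrite c'b; have [] := (mem_levels _ _ _).1 bl.
exists e => //; split; first by apply: he; rewrite mem_head.
move=> b bl cb; apply: he; rewrite inE; apply/orP; right.
by apply/mapP; exists b => //; rewrite mem_filter cb.
Qed.

Lemma restrict_level c' f x z : z < c' -> restrict_below c' f x z = f x z.
Proof. by move=> zc; rewrite /restrict_below dsum_belowE zc. Qed.

(** At a level below [c'], the increments of [f] and of its restriction differ by [Gamma_{x,y}]
    applied to the discarded levels of [f y]. *)
Lemma restrict_increment_le c c' : c' <= c -> c <= gamma -> exists C, 0 < C /\
  forall f, (forall x, in_below c (f x)) -> forall z rho x y,
    z \in levels RS c' -> 0 < rho <= 1 -> snorm s (x - y) <= rho ->
    `|(restrict_below c' f x - Gam x y (restrict_below c' f y)) z| <=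
    `|(f x - Gam x y (f y)) z| +
      C * (rho `^ (- z) * dnorm c rho (f y - restrict_below c' f y)).
Proof.
move=> cc' cg; have [C [C0 hC]] := Gamma_dnorm M cg; exists C; split => //.
move=> f hf z rho x y zl rho01 xy; have [rho0 _] := andP rho01.
have zc := levels_lt zl.
have zl' := levels_le cc' zl.
rewrite (_ : _ z = (f x - Gam x y (f y)) z + Gam x y (f y - restrict_below c' f y) z).
  apply: (le_trans (ler_normD _ _)); rewrite lerD2l.
  apply: (le_trans (dnorm_level _ zl' rho0)).
  rewrite mulrCA ler_wpM2l ?powR_ge0//; apply: hC => //.
  apply: in_belowB => //; apply: (in_below_le cc').
  exact: in_below_dsum_below.
rewrite (groupB _ _ (md_Gamma_group M x y)) !dsum_valB restrict_level//.
by rewrite addrA subrK.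
Qed.

Lemma dnorm_restrict_le c c' e f : c' <= c ->
  (forall b, b \in levels RS c -> c' <= b -> e <= b - c') ->
  forall rho x, 0 < rho <= 1 ->
  dnorm c rho (f x - restrict_below c' f x) <=
    rho `^ (c' + e) * \sum_(b <- levels RS c) `|f x b|.
Proof.
move=> cc' he rho x /andP[rho0 rho1]; rewrite mulr_sumr /dnorm.
rewrite big_seq [leRHS]big_seq; apply: ler_sum => b bl.
rewrite dsum_valB; have [bc|cb] := ltP b c'.
  by rewrite restrict_level// subrr normr0 mulr0 mulr_ge0 ?powR_ge0.
rewrite /restrict_below dsum_belowE ltNge cb subr0 ler_wpM2r//.
by apply: ger_powR; rewrite ?rho0//; have := he b bl cb; lra.
Qed.

Lemma bounded_embedding_lower p q q' c c' : (1 <= p)%E -> (1 <= q')%E -> (q' <= q)%E ->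
  c' < c -> c <= gamma -> ~ rs_hom RS c' ->
  bounded_embedding M setT p q c p q' c'.
Proof.
move=> p1 q'1 q'q cc' cg hc'.
have q1 : (1 <= q)%E := le_trans q'1 q'q.
have c'c := ltW cc'; have c'g := le_trans c'c cg.
apply: bounded_embedding_unit => //.
have [e e0 [ec eb]] := level_gap cc' hc'.
have [C [C0 hC]] := restrict_increment_le c'c cg.
pose N : R := (size (levels RS c))%:R.
have N0 : 0 <= N by [].
(* The 1 accounts for the increment of [f] and [C * N ^ 2] for the local norms of the discarded
   levels, summed over at most [N] levels; 4 is the cost of adding the two. *)
pose A := 4 * (1 + C * N ^+ 2).
have A0 : 0 <= A by rewrite mulr_ge0// addr_ge0// mulr_ge0 ?exprn_ge0// ltW.
have [C' [C'0 hC']] := @Hle_gain R d s hd hs q q' e A q'1 q'q e0 A0.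
exists (1 + C'); split; first by rewrite addr_gt0.
move=> f [pf hf].
have pf' : premodelled c' (restrict_below c' f) by exact: premodelled_restrict pf.
split => // z zl; have zc' := levels_lt zl.
have zl' := levels_le (ltW cc') zl.
have [h1 h2] := hf z zl'; split.
  rewrite /local_part (_ : (fun x => _) = (fun x => `|f x z|)); last first.
    by apply/funext => x; rewrite restrict_level.
  by apply: (le_trans h1); rewrite lee_fin lerDl ltW.
apply: (@le_trans _ _ C'%:E); last by rewrite lee_fin lerDr.
have [_ E] := @increment_partP R d s RS P gamma r M setT p q' c'
  (restrict_below c' f) z C' q'1 (ltW C'0).
apply: E.
apply: (hC' (incr_norm M setT p c z f)).
- exact: measurable_incr_norm.
- exact: measurable_incr_norm.
- by move=> h; exact: incr_norm_ge0.
- by move=> h; exact: incr_norm_ge0.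
- move=> h h0 hB; have sh0 := snorm_gt0 hs h0; set rho := snorm s h in hB sh0 *.
  have rho01 : 0 < rho <= 1 by rewrite sh0.
  (* An infinite increment norm makes the right side infinite, because [A] and [|h| ^ e] are
     positive. *)
  have [E'|E'] := eqVneq (incr_norm M setT p c z f h) +oo%E.
    rewrite E' addye// gt0_muley ?leey// lte_fin mulr_gt0 ?powR_gt0//.
    by rewrite mulr_gt0// ltr_wpDr// mulr_ge0 ?exprn_ge0// ltW.
  have fin : incr_norm M setT p c z f h \is a fin_num.
    by rewrite ge0_fin_numE ?incr_norm_ge0// ltey.
  have := fineK fin; set K := fine _ => KE; rewrite -KE -EFinD -EFinM.
  have K0 : 0 <= K by rewrite fine_ge0// incr_norm_ge0.
  have LK : Lle mu p (EFin \o increment s Gam c z f h) K.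
    apply/Lp_normTP => //; first by move=> x; exact: increment_ge0.
    by rewrite KE.
  have LU : Lle mu p (fun x => \sum_(b <- levels RS c) (`|f x b|)%:E)%E (N ^+ 2 * 1).
    apply: Lle_sum => //.
    - by move=> b; apply/measurable_EFinP; exact: measurable_level pf.
    - move=> b bl; have [Hb _] := hf b bl.
      have [E1 _] := @Lp_normTP R d p (fun x => `|f x b|) 1 p1
        (fun x => normr_ge0 (f x b)) ler01.
      exact: E1 Hb.
  have mU : measurable_fun setT (fun x => \sum_(b <- levels RS c) (`|f x b|)%:E)%E.
    by apply: emeasurable_sum => b; apply/measurable_EFinP; exact: measurable_level pf.
  have U0 x : (0 <= \sum_(b <- levels RS c) (`|f x b|)%:E)%E.
    by apply: sume_ge0.
  have CN0 : 0 <= C * N ^+ 2 by rewrite mulr_ge0 ?exprn_ge0// ltW.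
  have mi : measurable_fun setT (EFin \o increment s Gam c z f h).
    by apply/measurable_EFinP; exact: measurable_increment1 cg pf.
  have LS : Lle mu p (fun x => (increment s Gam c z f h x)%:E +
      C%:E * \sum_(b <- levels RS c) (`|f x b|)%:E)%E (4 * (K + C * N ^+ 2)).
    apply: LleD => //.
    - by rewrite addr_ge0.
    - exact: measurable_funeM.
    - by move=> x; rewrite lee_fin increment_ge0.
    - by move=> x; rewrite mule_ge0// lee_fin ltW.
    - by apply: (Lle_widen _ _ _ LK) => //; rewrite lerDl.
    - have := LleZ p1 (ltW C0) _ mU U0 LU.
      rewrite mulr1 => /(_ (exprn_ge0 _ N0)).
      by apply: Lle_widen => //; rewrite lerDr.
  have L' : Lle mu p (EFin \o increment s Gam c' z (restrict_below c' f) h)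
      (rho `^ e * (4 * (K + C * N ^+ 2))).
    apply: (@Lle_mono _ _ _ _ _ _ (fun x : Rd => (rho `^ e)%:E *
      ((increment s Gam c z f h x)%:E +
      C%:E * \sum_(b <- levels RS c) (`|f x b|)%:E))%E) => //.
    - apply/measurable_EFinP.
      exact: measurable_increment1 c'g pf'.
    - apply: measurable_funeM; apply: emeasurable_funD => //.
      exact: measurable_funeM.
    - by move=> x; rewrite lee_fin increment_ge0.
    - move=> x; rewrite sumEFin -EFinM lee_fin /=.
      rewrite /increment -/rho ler_pdivrMr ?powR_gt0//.
      have hx : snorm s (x + h - x) <= rho by rewrite addrC addKr.
      apply: (le_trans (hC f pf.1 z rho (x + h) x zl rho01 hx)).
      rewrite mulrDr mulrDl; apply: lerD.
        (* The powers of [rho] combine to the exponent [e - (c - c')], which is at most 0 by the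
           choice of [e], so the factor is at least 1 for [rho <= 1]. *)
        set W := `| _ |; have rn0 a : rho `^ a != 0 by rewrite gt_eqF// powR_gt0.
        have pD a b : rho `^ (a + b) = rho `^ a * rho `^ b.
          by rewrite powRD// (gt_eqF sh0) implybT.
        have -> : rho `^ e * (W / rho `^ (c - z)) * rho `^ (c' - z) =
            rho `^ (e + (c' - c)) * W.
          have -> : c' - z = (c' - c) + (c - z) by ring.
          by rewrite !pD; field; rewrite !rn0.
        rewrite ler_peMl ?normr_ge0//.
        rewrite -[leLHS](powRr0 rho); apply: ger_powR => //; lra.
      apply: (@le_trans _ _ (C * (rho `^ (- z) * (rho `^ (c' + e) *
          \sum_(b <- levels RS c) `|f x b|)))).
        rewrite ler_wpM2l ?(ltW C0)// ler_wpM2l ?powR_ge0//.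
        exact: dnorm_restrict_le.
      rewrite le_eqVlt; apply/orP; left; apply/eqP.
      have -> : rho `^ (c' + e) = rho `^ e * rho `^ (c' - z) * rho `^ z.
        rewrite -!powRD ?(gt_eqF sh0) ?implybT//; congr (_ `^ _); ring.
      rewrite powRN; have : rho `^ z != 0 by rewrite gt_eqF// powR_gt0.
      by move=> ?; field.
    apply: LleZ => //.
    - exact: powR_ge0.
    - by rewrite mulr_ge0// addr_ge0.
    - by apply: emeasurable_funD => //; exact: measurable_funeM.
    - move=> x; rewrite adde_ge0 ?lee_fin ?increment_ge0//.
      by rewrite mule_ge0// lee_fin ltW.
  have B0 : 0 <= rho `^ e * (4 * (K + C * N ^+ 2)).
    by rewrite mulr_ge0 ?powR_ge0// mulr_ge0// addr_ge0.
  have [_ E2] := @Lp_normTP R d p (increment s Gam c' z (restrict_below c' f) h) _ p1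
    (increment_ge0 M c' z _ h) B0.
  apply: (le_trans (E2 L')); rewrite lee_fin (mulrC A) -mulrA.
  rewrite ler_wpM2l ?powR_ge0// /A -mulrA ler_wpM2l//.
  rewrite mulrDl mul1r mulrDr mulr1.
  have : 0 <= C * N ^+ 2 * K by exact: mulr_ge0.
  by lra.
- have [E' _] := @increment_partP R d s RS P gamma r M setT p q c f z 1 q1 ler01.
  exact: E' h2.
Qed.

(** For each fixed [h], [Lle_finite_measure] lowers the exponent in [x] at the cost of the same
    factor [V + 1]; the norm in [h] only has to be monotone and homogeneous. *)
Lemma bounded_embedding_periodic D p q p' c (V : R) : (1 <= p')%E -> (p' < p)%E ->
  (1 <= q)%E -> measurable D -> (mu D <= V%:E)%E -> c <= gamma ->
  bounded_embedding M D p q c p' q c.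
Proof.
move=> p'1 p'p q1 mD muD cg; have p1 : (1 <= p)%E := le_trans p'1 (ltW p'p).
have V0 : 0 <= V by rewrite -lee_fin; apply: le_trans muD; exact: measure_ge0.
have V1 : 0 < V + 1 by rewrite ltr_wpDl.
apply: bounded_embedding_unit => //.
exists (V + 1); split => // f [pf hf]; rewrite (restrict_below_id pf.1); split => //.
move=> z zl; have [h1 h2] := hf z zl.
have supp (g : Rd -> R) x : ~ D x -> ((EFin \o g) \_ D) x = 0%E.
  by move=> Dx; rewrite patchE memNset.
split.
  have [_ E] := @local_partP R d RS D p' f z (V + 1) p'1 (ltW V1).
  have [E1 _] := @local_partP R d RS D p f z 1 p1 ler01.
  apply: E; rewrite -[V + 1]mul1r.
  apply: (Lle_finite_measure p'1 p'p mD muD V0 ltr01 _ _ (supp _) (E1 h1)).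
    by apply: measurable_restrict_setT => //; exact: measurable_level pf.
  by apply: restrict_EFin_ge0.
have [_ E] := @increment_partP R d s RS P gamma r M D p' q c f z (V + 1) q1 (ltW V1).
have [E1 _] := @increment_partP R d s RS P gamma r M D p q c f z 1 q1 ler01.
apply: E; apply: (@Hle_mono _ _ _ hs _ _
    (fun h => (V + 1)%:E * incr_norm M D p c z f h)%E) => //.
- exact: measurable_incr_norm.
- by apply: measurable_funeM; exact: measurable_incr_norm.
- by move=> h; exact: incr_norm_ge0.
- move=> h; apply: lee_pmul_bound => // [|K K0 hK]; first exact: incr_norm_ge0.
  have B0 : 0 <= (V + 1) * K by rewrite mulr_ge0 ?ltW.
  have [_ E2] := @Lp_normP R d D p' (increment s Gam c z f h) _ p'1
    (increment_ge0 M c z f h) B0.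
  have [E3 _] := @Lp_normP R d D p (increment s Gam c z f h) _ p1
    (increment_ge0 M c z f h) (ltW K0).
  rewrite mulrC in E2 *.
  apply: E2; apply: (Lle_finite_measure p'1 p'p mD muD V0 K0 _ _ (supp _)).
  + apply: measurable_restrict_setT => //; exact: measurable_increment1 cg pf.
  + by apply: restrict_EFin_ge0 => x; exact: increment_ge0.
  + exact: E3.
suff : Hle s q (fun h => (V + 1)%:E * incr_norm M D p c z f h)%E ((V + 1) * 1).
  by rewrite mulr1.
apply: HleZ => //; first exact: ltW.
- exact: measurable_incr_norm.
- by move=> h; exact: incr_norm_ge0.
- exact: E1.
Qed.

End lower_cases.

(** * Averages over scaled balls *)

Section averages.
Context {R : realType} {d : nat} (s : 'I_d -> nat).
Hypothesis hd : (0 < d)%N.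
Hypothesis hs : forall i, (1 <= s i)%N.
Local Notation Rd := 'rV[R]_d.
Local Notation mu := (@lebesgue_rV R d).
Implicit Types (rho a : R) (g : Rd -> \bar R).
Local Open Scope ereal_scope.

Lemma restrict_cball_meas rho (H : Rd * Rd -> \bar R) : measurable_fun setT H ->
  (forall z, 0 <= H z) -> exists H' : Rd * Rd -> \bar R,
    [/\ measurable_fun setT H', forall z, 0 <= H' z &
      forall x l, H' (x, l) = ((fun l => H (x, l)) \_ (cball s rho)) l].
Proof.
move=> mH H0; have mB := @measurable_cball R d s hs rho.
exists (H \_ (setT `*` cball s rho)); split => [|z|x l].
- apply/(measurable_restrictT _ (measurableX measurableT mB)).
  exact: measurable_funTS.
- by rewrite patchE; case: ifP.
- by rewrite !patchE in_setX/= in_setT.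
Qed.

Lemma fubini_cball rho (H : Rd * Rd -> \bar R) : measurable_fun setT H ->
  (forall z, 0 <= H z) ->
  \int[mu]_x \int[mu]_(l in cball s rho) H (x, l) =
  \int[mu]_(l in cball s rho) \int[mu]_x H (x, l).
Proof.
move=> mH H0; have [H' [mH' H'0 H'E]] := restrict_cball_meas rho mH H0.
under eq_integral do rewrite integral_mkcond.
transitivity (\int[mu]_x \int[mu]_l H' (x, l)).
  by apply: eq_integral => x _; apply: eq_integral => l _; rewrite H'E.
rewrite fubini_tonelli// [RHS]integral_mkcond; apply: eq_integral => l _.
rewrite [RHS]patchE; case: ifPn => lB.
  by apply: eq_integral => x _; rewrite H'E patchE lB.
by rewrite integral0_eq// => x _; rewrite H'E patchE (negbTE lB).
Qed.

Lemma measurable_integral_cball rho (H : Rd * Rd -> \bar R) :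
  measurable_fun setT H -> (forall z, 0 <= H z) ->
  measurable_fun setT (fun x => \int[mu]_(l in cball s rho) H (x, l)).
Proof.
move=> mH H0; have [H' [mH' H'0 H'E]] := restrict_cball_meas rho mH H0.
rewrite (_ : (fun x => _) = fubini_F mu H'); first exact: measurable_fun_fubini_tonelli_F.
apply/funext => x; rewrite integral_mkcond; apply: eq_integral => l _.
by rewrite H'E.
Qed.

Definition vol rho : R := (2 ^+ d * rho ^+ scale_deg s)%R.

Lemma vol_gt0 rho : (0 < rho)%R -> (0 < vol rho)%R.
Proof. by move=> r0; rewrite mulr_gt0// exprn_gt0. Qed.

Lemma vol_ge0 rho : (0 < rho)%R -> (0 <= vol rho)%R.
Proof. by move=> /vol_gt0/ltW. Qed.

Lemma cball_vol rho : (0 < rho)%R -> mu (cball s rho) = (vol rho)%:E.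
Proof. by move=> r0; rewrite lebesgue_cball// ltW. Qed.

Definition avg rho g : \bar R :=
  (vol rho)^-1%:E * \int[mu]_(k in cball s rho) g k.

Lemma avg_le rho g g' : (0 < rho)%R ->
  measurable_fun setT g -> measurable_fun setT g' -> (forall k, 0 <= g k) ->
  (forall k, (snorm s k <= rho)%R -> g k <= g' k) -> avg rho g <= avg rho g'.
Proof.
move=> r0 mg mg' g0 gg'; rewrite /avg lee_wpmul2l ?lee_fin ?invr_ge0 ?vol_ge0//.
apply: ge0_le_integral => //.
- exact: measurable_cball.
- exact: measurable_funTS.
- exact: measurable_funTS.
Qed.

Lemma avg_ge0 rho g : (0 < rho)%R -> (forall k, 0 <= g k) -> 0 <= avg rho g.
Proof.
move=> r0 g0; rewrite mule_ge0 ?lee_fin ?invr_ge0 ?vol_ge0//.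
by apply: integral_ge0.
Qed.

Lemma avg_cst rho (y : \bar R) : (0 < rho)%R -> avg rho (fun=> y) = y.
Proof.
move=> r0; rewrite /avg integral_cst//; last exact: measurable_cball.
rewrite [X in _ * (_ * X)](cball_vol r0).
by rewrite muleCA -EFinM mulVf ?mule1// gt_eqF// vol_gt0.
Qed.

Lemma avgD rho g g' : (0 < rho)%R ->
  measurable_fun setT g -> measurable_fun setT g' ->
  (forall k, 0 <= g k) -> (forall k, 0 <= g' k) ->
  avg rho (fun k => g k + g' k) = avg rho g + avg rho g'.
Proof.
move=> r0 mg mg' g0 g'0; rewrite /avg ge0_integralD//.
- by rewrite ge0_muleDr//; apply: integral_ge0.
- exact: measurable_cball.
- exact: measurable_funTS.
- exact: measurable_funTS.
Qed.

Lemma avgZ rho g (l : R) : (0 < rho)%R -> (0 <= l)%R ->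
  measurable_fun setT g -> (forall k, 0 <= g k) ->
  avg rho (fun k => l%:E * g k) = l%:E * avg rho g.
Proof.
move=> r0 l0 mg g0; rewrite /avg ge0_integralZl//.
- by rewrite muleCA.
- exact: measurable_cball.
- exact: measurable_funTS.
Qed.

Lemma avg_sum (I : Type) (t : seq I) rho (g : I -> Rd -> \bar R) : (0 < rho)%R ->
  (forall i, measurable_fun setT (g i)) -> (forall i k, 0 <= g i k) ->
  avg rho (fun k => \sum_(i <- t) g i k) = \sum_(i <- t) avg rho (g i).
Proof.
move=> r0 mg g0; elim: t => [|i t ih].
  by under [X in avg _ X]eq_fun do rewrite big_nil; rewrite avg_cst// big_nil.
under [X in avg _ X]eq_fun do rewrite big_cons.
rewrite avgD// ?ih ?big_cons//; first exact: emeasurable_sum.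
by move=> k; apply: sume_ge0.
Qed.

(** Either [x <= l], or [x = x ^ (1 - a) * x ^ a] with [x ^ (1 - a) <= l ^ (1 - a)]. The right side
    is affine in [x ^ a] and can be averaged term by term. *)
Lemma young_le a (x : \bar R) (l : R) : (1 <= a)%R -> 0 <= x -> (0 < l)%R ->
  x <= l%:E + (l `^ (1 - a))%:E * (x `^ a).
Proof.
move=> a1 x0 l0; have a0 : (0 < a)%R := lt_le_trans ltr01 a1.
case: x x0 => [x||]//; last first.
  by rewrite poweRyr ?gt_eqF// gt0_muley ?addey ?leey// lte_fin powR_gt0.
rewrite lee_fin => x0; rewrite poweR_EFin -EFinM -EFinD lee_fin.
have [xl|lx] := leP x l; first by rewrite ler_wpDr// mulr_ge0 ?powR_ge0.
have xp : (0 < x)%R := lt_trans l0 lx.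
apply: (@le_trans _ _ (l `^ (1 - a) * x `^ a)%R); last by rewrite lerDr ltW.
have -> : (x `^ a = x `^ (a - 1) * x)%R.
  by rewrite -{3}(powRr1 x0) -powRD ?subrK// (gt_eqF xp) implybT.
rewrite mulrA ler_peMl//.
rewrite -[(1 - a)%R]opprB powRN mulrC ler_pdivlMr ?powR_gt0// mul1r.
by apply: ge0_ler_powR; rewrite ?nnegrE ?subr_ge0// ltW.
Qed.

(** The choice [l = G ^ (1/a)] makes both terms equal to [G ^ (1/a)], whence the factor 2; for
    [G = 0] let [l] tend to 0. *)
Lemma le_root_of_young a (y G : \bar R) : (1 <= a)%R -> 0 <= G ->
  (forall l : R, (0 < l)%R -> y <= l%:E + (l `^ (1 - a))%:E * G) ->
  y <= 2%:E * (G `^ a^-1).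
Proof.
move=> a1 G0 h; have a0 : (0 < a)%R := lt_le_trans ltr01 a1.
case: G G0 h => [G||]//; last first.
  by rewrite poweRyr ?gt_eqF ?invr_gt0// gt0_muley ?leey// lte_fin.
rewrite lee_fin le_eqVlt => /predU1P[<- h|G0 h].
  rewrite poweR0r ?mule0 ?invr_eq0 ?gt_eqF//.
  apply/lee_addgt0Pr => e e0; rewrite add0e.
  by have := h e e0; rewrite mule0 adde0.
have l0 : (0 < G `^ a^-1)%R by rewrite powR_gt0.
apply: (le_trans (h _ l0)).
rewrite poweR_EFin -!EFinM -EFinD lee_fin -powRrM.
have -> : (a^-1 * (1 - a) = a^-1 - 1)%R by rewrite mulrBr mulr1 mulVf// gt_eqF.
rewrite powRD ?(gt_eqF G0) ?implybT// -mulrA (_ : (G `^ (-1) * G = 1)%R).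
  by rewrite mulr1; lra.
by rewrite powR_inv1 ?(ltW G0)// mulVf// gt_eqF.
Qed.

(** Average [young_le] for every [l], then optimize over [l]. *)
Lemma avg_jensen rho g a : (1 <= a)%R -> (0 < rho)%R -> measurable_fun setT g ->
  (forall k, 0 <= g k) ->
  avg rho g <= 2%:E * (avg rho (fun k => g k `^ a)) `^ a^-1.
Proof.
move=> a1 r0 mg g0; apply: le_root_of_young => //.
  by apply: avg_ge0 => // k; exact: poweR_ge0.
move=> l l0.
have mp : measurable_fun setT (fun k => g k `^ a) by exact: measurable_poweRfun.
rewrite -(avg_cst l%:E r0) -avgZ ?powR_ge0//; last by move=> k; exact: poweR_ge0.
have mZ : measurable_fun setT (fun k => (l `^ (1 - a))%:E * (g k `^ a)).
  exact: measurable_funeM.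
have Z0 k : 0 <= (l `^ (1 - a))%:E * (g k `^ a).
  by rewrite mule_ge0 ?poweR_ge0// lee_fin powR_ge0.
rewrite -avgD//; last by move=> k; rewrite lee_fin ltW.
apply: avg_le => //; first exact: emeasurable_funD.
by move=> k _; exact: young_le.
Qed.

(* G is both bounded and integrable *)
Lemma Lle_average (a : R) (p' : \bar R) rho (k0 Q : R) (Psi : Rd -> \bar R) :
  (1 <= a)%R -> a%:E < p' -> (0 < rho)%R -> (0 <= k0)%R -> (0 <= Q)%R ->
  measurable_fun setT Psi -> (forall x, 0 <= Psi x) -> \int[mu]_x Psi x <= Q%:E ->
  let G (x : Rd) := k0%:E * \int[mu]_(l in cball s rho) Psi (x + l)%R in
  measurable_fun setT G /\
  Lle mu p' (fun x : Rd => G x `^ a^-1)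
    ((k0 * Q) `^ a^-1 * vol rho `^ (fine p'^-1)).
Proof.
move=> a1 ap' r0 k00 Q0 mPsi Psi0 iPsi G.
pose H (z : Rd * Rd) := Psi (z.1 + z.2)%R.
have mH : measurable_fun setT H.
  apply: (measurableT_comp mPsi).
  by apply: measurable_rV_addfun; [exact: measurable_fst|exact: measurable_snd].
have H0 z : 0 <= H z by exact: Psi0.
have mI : measurable_fun setT (fun x : Rd => \int[mu]_(l in cball s rho) Psi (x + l)%R).
  exact: (measurable_integral_cball rho mH H0).
have mG : measurable_fun setT G by exact: measurable_funeM.
have I0 x : 0 <= \int[mu]_(l in cball s rho) Psi (x + l)%R by exact: integral_ge0.
have G0 x : 0 <= G x by rewrite mule_ge0// lee_fin.
split => //; apply: (Lle_interp (G := G)) => //.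
- exact: measurable_poweRfun.
- by move=> x; exact: poweR_ge0.
- exact: mulr_ge0.
- exact: vol_gt0.
- by move=> x; rewrite poweRVK// (lt_le_trans ltr01).
(* Boundedness: the integral over a ball around [x] is at most the integral over the whole space. *)
- move=> x; rewrite /G EFinM lee_wpmul2l ?lee_fin//; apply: le_trans iPsi.
  apply: (@le_trans _ _ (\int[mu]_l Psi (x + l)%R)).
    apply: ge0_subset_integral => //; first exact: measurable_cball.
    apply: (measurableT_comp mPsi).
    by apply: measurable_rV_addfun.
  under eq_integral do rewrite addrC.
  by rewrite (ge0_integral_translate x mPsi Psi0).
(* Integrability: by Tonelli every shift [l] contributes at most [Q], over a ball of measure
   [vol rho]. *)
- rewrite /G ge0_integralZl// -mulrA EFinM lee_wpmul2l ?lee_fin//.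
  rewrite (fubini_cball rho mH H0).
  apply: (@le_trans _ _ (\int[mu]_(l in cball s rho) (cst Q%:E l))).
    apply: ge0_le_integral => //.
    + exact: measurable_cball.
    + by move=> l _; exact: integral_ge0.
    + apply: measurable_funTS.
      exact: (@measurable_fun_fubini_tonelli_G _ _ _ _ _ mu H).
    + by move=> l _; rewrite /H/= (ge0_integral_translate l mPsi Psi0).
  rewrite integral_cst//; last exact: measurable_cball.
  by rewrite [X in _ * X <= _](cball_vol r0) -EFinM.
Qed.

End averages.

Section average_tools.
Context {R : realType} {d : nat} (s : 'I_d -> nat).
Hypothesis hd : (0 < d)%N.
Hypothesis hs : forall i, (1 <= s i)%N.
Local Notation Rd := 'rV[R]_d.
Local Notation mu := (@lebesgue_rV R d).
Local Open Scope ereal_scope.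

Lemma measurable_avg (rho : R) (e : Rd * Rd -> \bar R) : measurable_fun setT e ->
  (forall z, 0 <= e z) -> measurable_fun setT (fun l => avg s rho (fun k => e (l, k))).
Proof.
by move=> me e0; apply: measurable_funeM; exact: measurable_integral_cball.
Qed.

Section chain.
Variables (ra rb : R) (phi psi : Rd -> \bar R) (e : Rd * Rd -> \bar R).
Hypotheses (ra0 : (0 < ra)%R) (rb0 : (0 < rb)%R).
Hypotheses (mphi : measurable_fun setT phi) (mpsi : measurable_fun setT psi).
Hypotheses (me : measurable_fun setT e).
Hypotheses (phi0 : forall k, 0 <= phi k) (psi0 : forall k, 0 <= psi k).
Hypotheses (e0 : forall z, 0 <= e z).

Let me1 l : measurable_fun setT (fun k => e (l, k)).
Proof. exact: (measurableT_comp me (measurable_pair1 l)). Qed.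

Let mavg : measurable_fun setT (fun l => avg s ra (fun k => e (l, k))).
Proof. exact: measurable_avg. Qed.

Let avg0 l : 0 <= avg s ra (fun k => e (l, k)).
Proof. by apply: avg_ge0 => // k. Qed.

(** The pointwise bound is averaged over both variables, and a term free of one variable is
    unchanged by averaging over it. This version and the next differ in the ball over which [phi] is
    averaged, so that scales can be traversed in either direction with the same error term. *)
Lemma avg_chain_inner :
  (forall k l, (snorm s k <= ra)%R -> (snorm s l <= rb)%R ->
    phi l <= psi k + e (l, k)) ->
  avg s rb phi <= avg s ra psi + avg s rb (fun l => avg s ra (fun k => e (l, k))).
Proof.
move=> h; rewrite -(avg_cst hs (avg s ra psi) rb0) -avgD//; last first.
  by move=> k; exact: avg_ge0.
apply: avg_le => //; first by apply: emeasurable_funD => //; exact: measurable_cst.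
move=> l hl; rewrite -(avg_cst hs (phi l) ra0) -avgD//.
apply: avg_le => //; first exact: emeasurable_funD.
by move=> k hk; exact: h.
Qed.

Lemma avg_chain_outer :
  (forall k l, (snorm s k <= ra)%R -> (snorm s l <= rb)%R ->
    phi k <= psi l + e (l, k)) ->
  avg s ra phi <= avg s rb psi + avg s rb (fun l => avg s ra (fun k => e (l, k))).
Proof.
move=> h; rewrite -(avg_cst hs (avg s ra phi) rb0) -avgD//.
apply: avg_le => //; first exact: emeasurable_funD.
  by move=> k; exact: avg_ge0.
move=> l hl; rewrite -(avg_cst hs (psi l) ra0) -avgD//.
apply: avg_le => //; first exact: emeasurable_funD.
by move=> k hk; exact: h.
Qed.

End chain.

Lemma integral_cball_shift (r1 r2 : R) (l : Rd) (Phi : Rd -> \bar R) :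
  measurable_fun setT Phi -> (forall k, 0 <= Phi k) ->
  (forall h, (snorm s (h + l) <= r1)%R -> (snorm s h <= r2)%R) ->
  \int[mu]_(k in cball s r1) Phi k <= \int[mu]_(h in cball s r2) Phi (h + l)%R.
Proof.
move=> mPhi Phi0 hr.
have mB1 := @measurable_cball R d s hs r1; have mB2 := @measurable_cball R d s hs r2.
have ms : measurable_fun setT (fun h : Rd => Phi (h + l)%R).
  exact: (measurableT_comp mPhi (measurable_rV_add l)).
have mP : measurable_fun setT (Phi \_ (cball s r1)).
  by apply/(measurable_restrictT _ mB1); exact: measurable_funTS.
have P0 h : 0 <= (Phi \_ (cball s r1)) h by rewrite patchE; case: ifP.
rewrite integral_mkcond -(ge0_integral_translate l mP P0) [leRHS]integral_mkcond.
apply: ge0_le_integral => //.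
- exact: (measurableT_comp mP (measurable_rV_add l)).
- by apply/(measurable_restrictT _ mB2); exact: measurable_funTS.
- move=> h _; rewrite !patchE; case: ifPn => [/set_mem h1|_].
    by rewrite mem_set//; exact: hr.
  by case: ifP.
Qed.

Lemma Lle_fin_ae (a : R) (F : Rd -> \bar R) K : (1 <= a)%R ->
  measurable_fun setT F -> (forall x, 0 <= F x) -> Lle mu a%:E F K ->
  {ae mu, forall x, F x < +oo}.
Proof.
move=> a1 mF F0 hF; have a0 : (0 < a)%R := lt_le_trans ltr01 a1.
have iF : mu.-integrable setT (fun x => F x `^ a).
  apply/integrableP; split; first exact: measurable_poweRfun.
  under eq_integral do rewrite gee0_abs ?poweR_ge0//.
  by apply: (le_lt_trans hF); rewrite ltry.
apply: filterS (integrable_ae measurableT iF) => x /(_ I).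
rewrite ge0_fin_numE ?poweR_ge0//; apply: lty_poweRy.
by rewrite gt_eqF.
Qed.

(** Otherwise all terms from [n] on are at least [e] and the partial sums are unbounded. *)
Lemma small_terms (u : nat -> \bar R) (n : nat) (e : R) : (forall m, 0 <= u m) ->
  \sum_(m <oo) u m < +oo -> (0 < e)%R -> exists N, (n <= N)%N /\ u N < e%:E.
Proof.
move=> u0 su e0; apply: contrapT => h.
have hN N : (n <= N)%N -> e%:E <= u N.
  by move=> nN; rewrite leNgt; apply/negP => uN; apply: h; exists N.
have sfin : \sum_(m <oo) u m \is a fin_num by rewrite ge0_fin_numE// nneseries_ge0.
have partial k : (k%:R * e)%:E <= \sum_(m <oo) u m.
  apply: (le_trans _ (nneseries_lim_ge (n + k) _)) => //.
  elim: k => [|k ih]; first by rewrite mul0r sume_ge0.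
  by rewrite addnS big_nat_recr//= -natr1 mulrDl mul1r EFinD leeD// hN// leq_addr.
have := archimedean.Num.Theory.truncnS_gt (fine (\sum_(m <oo) u m) / e).
set k := _.+1; rewrite ltr_pdivrMr// => hk.
have := partial k; rewrite -(fineK sfin) lee_fin leNgt.
by rewrite hk.
Qed.

End average_tools.

(** * The dyadic argument for p < p' *)

Section sobolev.
Context {R : realType} {d : nat} {s : 'I_d -> nat}.
Context {RS : regularity_structure R} {P : polynomial_part s RS}.
Context {gamma : R} {r : nat} (M : model P gamma r).
Hypothesis hd : (0 < d)%N.
Hypothesis hs : forall i, (1 <= s i)%N.
Local Notation Rd := 'rV[R]_d.
Local Notation Gam := (md_Gamma M).
Local Notation mu := (@lebesgue_rV R d).
Local Notation S := (scale_deg s).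

Variables (c a g C : R) (p' : \bar R).
Hypotheses (cg : c <= gamma) (a1 : 1 <= a) (ap' : (a%:E < p')%E) (C0 : 0 < C).
Hypothesis hC : forall x y rho u, snorm s (x - y) <= rho -> 0 < rho <= 1 ->
  in_below c u -> dnorm c rho (Gam x y u) <= C * dnorm c rho u.
Let u' : R := fine (p'^-1)%E.
Let kappa : R := c - S%:R * (a^-1 - u').
Hypothesis gk : g < kappa.

Variable f : Rd -> rs_space RS.
Hypothesis pf : premodelled c f.
Let N : R := (size (levels RS c))%:R.
Hypothesis hloc : forall b, b \in levels RS c -> Lle mu a%:E (fun x => (`|f x b|)%:E) 1.
Hypothesis hinc : {ae mu, forall h, cball s 1 h ->
  forall z, z \in levels RS c -> (incr_norm M setT a%:E c z f h <= 1)%E}.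

Let a0 : 0 < a := lt_le_trans ltr01 a1.
Let N0 : 0 <= N. Proof. by []. Qed.

Definition dyad (m : nat) : R := 2^-1 ^+ m.

Lemma dyad_gt0 m : 0 < dyad m.
Proof. by rewrite exprn_gt0. Qed.

Lemma dyadS m : dyad m.+1 = dyad m / 2.
Proof. by rewrite /dyad exprS mulrC. Qed.

Lemma dyad_le1 m : dyad m <= 1.
Proof. by rewrite /dyad exprn_ile1// invf_le1// ler1n. Qed.

Lemma dyad01 m : 0 < dyad m <= 1.
Proof. by rewrite dyad_gt0 dyad_le1. Qed.

Lemma dyad_le m n : (m <= n)%N -> dyad n <= dyad m.
Proof. by move=> mn; rewrite /dyad; apply: ler_wiXn2l => //; rewrite invf_le1// ler1n. Qed.

Let dpow m b : 0 <= dyad m `^ b := powR_ge0 _ _.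

Let dpD m b b' : dyad m `^ (b + b') = dyad m `^ b * dyad m `^ b'.
Proof. by rewrite powRD// (gt_eqF (dyad_gt0 m)) implybT. Qed.

Definition wlev b (x y : Rd) : R := `|(f x - Gam x y (f y)) b|.
Definition vlev b (x y : Rd) : R := `|Gam x y (f y) b|.
(* For y close to x the levels b < g of Gamma_{x,y} f(y) - f(x) and the levels
   b >= g of Gamma_{x,y} f(y) make up Gamma_{x,y} f(y) minus the restriction of
   f(x) to T_{<g}. *)
Definition mlev b (x y : Rd) : R := if b < g then wlev b x y else vlev b x y.
Local Notation W m := (increment_dist M c (dyad m) f).

Let hf x : in_below c (f x) := pf.1 x.

Let grp x y : rs_group (Gam x y) := md_Gamma_group M x y.

Lemma measurable_wlev b : measurable_fun setT (fun z : Rd * Rd => (wlev b z.1 z.2)%:E).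
Proof. by apply/measurable_EFinP; exact: (measurable_pair_level M hd hs b cg pf pf). Qed.

Lemma measurable_vlev b : measurable_fun setT (fun z : Rd * Rd => (vlev b z.1 z.2)%:E).
Proof.
apply/measurable_EFinP.
rewrite (_ : (fun z => _) = (fun z : Rd * Rd => `|(0 - Gam z.1 z.2 (f z.2)) b|)).
  exact: (measurable_pair_level M hd hs b cg (premodelled0 c) pf).
by apply/funext => z; rewrite dsum_valB dsum_val0 sub0r normrN.
Qed.

Lemma measurable_mlev b : measurable_fun setT (fun z : Rd * Rd => (mlev b z.1 z.2)%:E).
Proof.
by rewrite /mlev; case: (b < g); [exact: measurable_wlev|exact: measurable_vlev].
Qed.

Lemma measurable_W m : measurable_fun setT (fun z : Rd * Rd => (W m z.1 z.2)%:E).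
Proof. by apply/measurable_EFinP; exact: measurable_increment_dist. Qed.

Let W0 m x y : 0 <= W m x y := increment_dist_ge0 M c (dyad m) f x y.

Let hdiff x y : in_below c (f x - Gam x y (f y)).
Proof. by apply: in_belowB => //; apply: group_in_below. Qed.

Lemma Gamma_diff_le m b x y t : b \in levels RS c -> snorm s (x - y) <= dyad m ->
  `|Gam x y (f y - Gam y t (f t)) b| <= C * dyad m `^ (- b) * W m y t.
Proof.
move=> bl xy; apply: (le_trans (dnorm_level _ bl (dyad_gt0 m))).
rewrite (mulrC C) -mulrA ler_wpM2l//; apply: hC => //; exact: dyad01.
Qed.

(** [Gamma_{x,t} f(t)] and [Gamma_{x,y} f(y)] differ by [Gamma_{x,y}] applied to
    [f(y) - Gamma_{y,t} f(t)]: moving the point of expansion from [y] to [t] costs [W(y,t)],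
    transported to [x]. *)
Lemma vlev_chain m b x y t : b \in levels RS c -> snorm s (x - y) <= dyad m ->
  vlev b x t <= vlev b x y + C * dyad m `^ (- b) * W m y t.
Proof.
move=> bl xy; rewrite /vlev.
rewrite (_ : Gam x t (f t) b = Gam x y (f y) b - Gam x y (f y - Gam y t (f t)) b).
  by apply: (le_trans (ler_normB _ _)); rewrite lerD2l; exact: Gamma_diff_le.
rewrite (groupB _ _ (grp x y)) dsum_valB md_Gamma_comp opprB.
by rewrite addrC subrK.
Qed.

Lemma wlev_chain m b x y t : b \in levels RS c -> snorm s (x - y) <= dyad m ->
  wlev b x y <= wlev b x t + C * dyad m `^ (- b) * W m y t.
Proof.
move=> bl xy; rewrite /wlev.
rewrite (_ : (f x - Gam x y (f y)) b =
    (f x - Gam x t (f t)) b - Gam x y (f y - Gam y t (f t)) b).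
  by apply: (le_trans (ler_normB _ _)); rewrite lerD2l; exact: Gamma_diff_le.
rewrite (groupB _ _ (grp x y)) !dsum_valB md_Gamma_comp opprB.
by rewrite addrA subrK.
Qed.

Lemma W_flip m x y : snorm s (x - y) <= dyad m -> W m x y <= C * W m y x.
Proof.
move=> xy; rewrite /increment_dist Gamma_flip dnormN.
by apply: hC => //; exact: dyad01.
Qed.

Definition Psi m (y : Rd) : \bar R :=
  (\int[mu]_(h in cball s (dyad m)) ((W m (y + h)%R y)%:E `^ a))%E.
(** Dominates the average of [W(x + k, x + l) ^ a] over [|k| <= 2 ^ -(m+1)] and [|l| <= 2 ^ -(m+2)],
    hence the two volumes. With [h = k - l], of size at most [2 ^ -m], the integral in [k] is at
    most [Psi m (x + l)], a function of the single point [x + l]. *)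
Definition Gav m (x : Rd) : \bar R :=
  ((vol s (dyad m.+1) * vol s (dyad m.+2))^-1%:E *
   \int[mu]_(l in cball s (dyad m.+2)) Psi m (x + l)%R)%E.

Let HW m (z : Rd * Rd) : \bar R := ((W m (z.1 + z.2)%R z.1)%:E `^ a)%E.

Let mHW m : measurable_fun setT (HW m).
Proof.
apply: measurable_poweRfun.
apply: (measurableT_comp (measurable_W m) (g := fun z : Rd * Rd => (z.1 + z.2, z.1))).
apply: measurable_fun_pair; last exact: measurable_fst.
by apply: measurable_rV_addfun; [exact: measurable_fst|exact: measurable_snd].
Qed.

Let HW0 m z : (0 <= HW m z)%E. Proof. exact: poweR_ge0. Qed.

Lemma measurable_Psi m : measurable_fun setT (Psi m).
Proof. exact: (measurable_integral_cball hs (dyad m) (mHW m) (HW0 m)). Qed.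

Lemma Psi_ge0 m y : (0 <= Psi m y)%E.
Proof. by apply: integral_ge0 => h _; exact: poweR_ge0. Qed.

(** By Tonelli: for almost every [h], the unit bound [hinc] makes the integral over [y] at most
    [(N ^ 2 * 2 ^ (-m c)) ^ a]. *)
Lemma int_Psi m :
  (\int[mu]_y Psi m y <= (vol s (dyad m) * (N ^+ 2 * dyad m `^ c) `^ a)%R%:E)%E.
Proof.
rewrite (fubini_cball hs (dyad m) (mHW m) (HW0 m)).
apply: (@le_trans _ _ (\int[mu]_(h in cball s (dyad m))
    (cst ((N ^+ 2 * dyad m `^ c) `^ a)%:E h))%E).
  apply: ae_ge0_le_integral => //.
  - exact: measurable_cball.
  - by move=> h _; apply: integral_ge0.
  - apply: measurable_funTS.
    exact: (@measurable_fun_fubini_tonelli_G _ _ _ _ _ mu (HW m)).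
  - by move=> h _; rewrite lee_fin powR_ge0.
  - apply: filterS hinc => h hh hB; rewrite /HW/=.
    have hB1 : cball s 1 h by exact: le_trans hB (dyad_le1 m).
    have := @Lle_increment_dist R d s RS P gamma r M hd hs a%:E c (dyad m) f h 1
      a1 cg pf (dyad_gt0 m) hB ler01; rewrite mulr1; apply => z zl.
    have [E _] := @Lp_normTP R d a%:E (increment s Gam c z f h) 1 a1
      (increment_ge0 M c z f h) ler01.
    exact: E (hh hB1 z zl).
rewrite integral_cst//; last exact: measurable_cball.
by rewrite [X in (_ * X <= _)%E](cball_vol hs (dyad_gt0 m)) -EFinM mulrC.
Qed.

(** The part of the bound of [Lle_average] that is free of [m]. The volumes give
    [2 ^ S * 4 ^ S / 2 ^ d * 2 ^ (m S)] under the root of order [a], and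
    [2 ^ d / 4 ^ S * 2 ^ (-m S)] to the power [u']; together with [2 ^ (-m c)] the powers of
    [2 ^ -m] add up to [kappa]. *)
Definition sob_const : R :=
  (2 ^+ S * 4 ^+ S / 2 ^+ d) `^ a^-1 * N ^+ 2 * (2 ^+ d / 4 ^+ S) `^ u'.

Lemma sob_const_ge0 : 0 <= sob_const.
Proof. by rewrite !mulr_ge0 ?powR_ge0 ?exprn_ge0. Qed.

Lemma Gav_Lle m : measurable_fun setT (Gav m) /\
  Lle mu p' (fun x => Gav m x `^ a^-1)%E (sob_const * dyad m `^ kappa).
Proof.
have v1 := vol_gt0 s (dyad_gt0 m.+1); have v2 := vol_gt0 s (dyad_gt0 m.+2).
have k00 : 0 <= (vol s (dyad m.+1) * vol s (dyad m.+2))^-1.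
  by rewrite invr_ge0 mulr_ge0// ltW.
have Q0 : 0 <= vol s (dyad m) * (N ^+ 2 * dyad m `^ c) `^ a.
  by rewrite mulr_ge0 ?powR_ge0// vol_ge0// dyad_gt0.
have [mG LG] := Lle_average hs a1 ap' (dyad_gt0 m.+2) k00 Q0 (measurable_Psi m)
  (Psi_ge0 m) (int_Psi m).
split => //; move: LG; rewrite -/u'.
set X := (_ `^ _ * _); suff -> : X = sob_const * dyad m `^ kappa by [].
have rS : dyad m ^+ S = dyad m `^ S%:R by rewrite powR_mulrn// ltW ?dyad_gt0.
have rS0 : 0 < dyad m ^+ S by rewrite exprn_gt0 ?dyad_gt0.
have e2 n : (2 : R) ^+ n != 0 by rewrite expf_neq0.
have e4 n : (4 : R) ^+ n != 0 by rewrite expf_neq0.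
have [B BE] : exists B, B = N ^+ 2 * dyad m `^ c by eexists.
have B0 : 0 <= B by rewrite BE mulr_ge0 ?exprn_ge0 ?powR_ge0.
have dyad2 : dyad m.+2 ^+ S = dyad m ^+ S / 4 ^+ S.
  by rewrite -expr_div_n !dyadS -mulrA -invfM -natrM.
have dyad1 : dyad m.+1 ^+ S = dyad m ^+ S / 2 ^+ S by rewrite -expr_div_n dyadS.
have E1 : (vol s (dyad m.+1) * vol s (dyad m.+2))^-1 * (vol s (dyad m) * B `^ a) =
    (2 ^+ S * 4 ^+ S / 2 ^+ d) * (dyad m ^+ S)^-1 * B `^ a.
  rewrite /vol dyad1 dyad2; have r0 := lt0r_neq0 rS0.
  by field; rewrite !e2 !e4 r0.
have E2 : vol s (dyad m.+2) = (2 ^+ d / 4 ^+ S) * dyad m ^+ S.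
  by rewrite /vol dyad2 mulrA mulrAC.
have [X1 X1E] : exists X1 : R, X1 = 2 ^+ S * 4 ^+ S / 2 ^+ d by eexists.
have [X2 X2E] : exists X2 : R, X2 = 2 ^+ d / 4 ^+ S by eexists.
have X10 : 0 <= X1 by rewrite X1E !mulr_ge0 ?invr_ge0 ?exprn_ge0.
have X20 : 0 <= X2 by rewrite X2E !mulr_ge0 ?invr_ge0 ?exprn_ge0.
have [Sr SrE] : exists Sr : R, Sr = S%:R by eexists.
rewrite /X -BE E1 E2 rS /sob_const /kappa -X1E -X2E -SrE -powRN.
rewrite !powRM ?mulr_ge0 ?powR_ge0// -!powRrM mulfV ?gt_eqF// powRr1// BE.
have -> : c - Sr * (a^-1 - u') = c + (- Sr / a + Sr * u') by ring.
rewrite !dpD; ring.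
Qed.

Lemma Gav_ge0 m x : (0 <= Gav m x)%E.
Proof.
apply: mule_ge0; last by apply: integral_ge0 => l _; exact: Psi_ge0.
by rewrite lee_fin invr_ge0; apply: mulr_ge0; apply: vol_ge0; exact: dyad_gt0.
Qed.

Let GR m x : \bar R := (Gav m x `^ a^-1)%E.

Let GR0 m x : (0 <= GR m x)%E. Proof. exact: poweR_ge0. Qed.

Let mshift2 : measurable_fun setT (fun z : Rd * Rd => z.1 + z.2).
Proof. by apply: measurable_rV_addfun; [exact: measurable_fst|exact: measurable_snd]. Qed.

Let mshift (x : Rd) : measurable_fun setT (fun k : Rd => x + k).
Proof. by apply: measurable_rV_addfun. Qed.

Let mWx m x : measurable_fun setT (fun z : Rd * Rd => (W m (x + z.2) (x + z.1))%:E).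
Proof.
apply: (measurableT_comp (measurable_W m) (g := fun z : Rd * Rd => (x + z.2, x + z.1))).
apply: measurable_fun_pair.
  exact: (measurableT_comp (mshift x) measurable_snd).
exact: (measurableT_comp (mshift x) measurable_fst).
Qed.

Let Wx0 m x (z : Rd * Rd) : (0 <= (W m (x + z.2)%R (x + z.1)%R)%:E)%E.
Proof. by rewrite lee_fin. Qed.

(** Jensen for a double average: [young_le] is inserted under both averages with the same [l], which
    is optimized at the end. The substitution [k = h + i] then embeds the inner integral into that
    of [Psi]. *)
Lemma avg_W_le m x :
  (avg s (dyad m.+2) (fun l => avg s (dyad m.+1) (fun k =>
     (W m (x + k)%R (x + l)%R)%:E)) <= 2%:E * GR m x)%E.
Proof.
apply: le_root_of_young => //; first exact: Gav_ge0.
move=> l l0; have v1 := dyad_gt0 m.+1; have v2 := dyad_gt0 m.+2.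
pose e (z : Rd * Rd) : \bar R := ((W m (x + z.2)%R (x + z.1)%R)%:E `^ a)%E.
have me : measurable_fun setT e by exact: measurable_poweRfun.
have e0 z : (0 <= e z)%E by exact: poweR_ge0.
have me1 i : measurable_fun setT (fun k => e (i, k)).
  exact: (measurableT_comp me (measurable_pair1 i)).
have mae : measurable_fun setT (fun i => avg s (dyad m.+1) (fun k => e (i, k))).
  exact: measurable_avg.
have ae0 i : (0 <= avg s (dyad m.+1) (fun k => e (i, k)))%E by exact: avg_ge0.
have l10 : 0 <= l `^ (1 - a) by exact: powR_ge0.
apply: (@le_trans _ _ (avg s (dyad m.+2) (fun i => l%:E +
    (l `^ (1 - a))%:E * avg s (dyad m.+1) (fun k => e (i, k))))%E).
  apply: avg_le => //.
  - exact: (measurable_avg hs (dyad m.+1) (mWx m x) (Wx0 m x)).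
  - by apply: emeasurable_funD => //; exact: measurable_funeM.
  - by move=> i; apply: avg_ge0 => // k; rewrite lee_fin.
  - move=> i _; rewrite -(avg_cst hs l%:E v1) -avgZ// -avgD//; last 3 first.
      + exact: measurable_funeM.
      + by move=> k; rewrite lee_fin ltW.
      + by move=> k; rewrite mule_ge0// lee_fin.
    apply: avg_le => //.
    + exact: (measurableT_comp (mWx m x) (measurable_pair1 i)).
    + by apply: emeasurable_funD => //; exact: measurable_funeM.
    + by move=> k; rewrite lee_fin.
    + by move=> k _; apply: young_le => //; rewrite lee_fin.
rewrite avgD//; last 3 first.
- exact: measurable_funeM.
- by move=> i; rewrite lee_fin ltW.
- by move=> i; rewrite mule_ge0// lee_fin.
rewrite avg_cst// avgZ// leeD2l// lee_wpmul2l ?lee_fin//.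
have V10 : 0 <= (vol s (dyad m.+1))^-1 by rewrite invr_ge0 vol_ge0.
pose I (i : Rd) : \bar R := (\int[mu]_(k in cball s (dyad m.+1)) e (i, k))%E.
have mI : measurable_fun setT I by exact: measurable_integral_cball.
have I0 i : (0 <= I i)%E by apply: integral_ge0 => k _; exact: e0.
have -> : avg s (dyad m.+2) (fun i => avg s (dyad m.+1) (fun k => e (i, k))) =
    ((vol s (dyad m.+1))^-1%:E * avg s (dyad m.+2) I)%E by exact: (avgZ hs v2 V10 mI I0).
have -> : Gav m x = ((vol s (dyad m.+1))^-1%:E *
    avg s (dyad m.+2) (fun l => Psi m (x + l)%R))%E.
  by rewrite /Gav /avg muleA; congr (_ * _)%E; rewrite -EFinM invfM.
apply: lee_wpmul2l; first by rewrite lee_fin.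
have mP : measurable_fun setT (fun l => Psi m (x + l)%R).
  exact: (measurableT_comp (measurable_Psi m) (mshift x)).
apply: (avg_le hs v2 mI mP I0).
move=> i hi; rewrite /I /Psi.
apply: (@le_trans _ _ (\int[mu]_(h in cball s (dyad m)) e (i, (h + i)%R))%E).
  apply: integral_cball_shift => // h hh.
  rewrite -[h](addrK i); apply: (le_trans (snormB hs _ _)).
  apply: (le_trans (lerD hh hi)); rewrite !dyadS.
  by have := dyad_gt0 m; lra.
rewrite le_eqVlt; apply/orP; left; apply/eqP; apply: eq_integral => h _.
by rewrite /e /= (addrC h) addrA.
Qed.

Let mlevx (F : R -> Rd -> Rd -> R) b x :
  measurable_fun setT (fun z : Rd * Rd => (F b z.1 z.2)%:E) ->
  measurable_fun setT (fun k => (F b x (x + k))%:E).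
Proof.
move=> mF.
apply: (measurableT_comp mF (g := fun k : Rd => (x, x + k))).
by apply: measurable_fun_pair => //; exact: mshift.
Qed.

(** Index [m] goes with radius [2 ^ -(m+1)], so that any two points of the ball are within [2 ^ -m],
    the scale of [W m]. *)
Definition lavg (F : R -> Rd -> Rd -> R) b m x : \bar R :=
  avg s (dyad m.+1) (fun k => (F b x (x + k)%R)%:E).

Let step_error b m x : (avg s (dyad m.+2) (fun l => avg s (dyad m.+1) (fun k =>
     (C * dyad m `^ (- b) * W m (x + k)%R (x + l)%R)%R%:E)) <=
   (2 * C * dyad m `^ (- b))%R%:E * GR m x)%E.
Proof.
have Cb : 0 <= C * dyad m `^ (- b) by rewrite mulr_ge0// ltW.
have v1 := dyad_gt0 m.+1; have v2 := dyad_gt0 m.+2.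
under [X in avg _ _ X]eq_fun => l.
  under [X in avg _ _ X]eq_fun do rewrite EFinM.
  rewrite avgZ//; last 2 first.
  - exact: (measurableT_comp (mWx m x) (measurable_pair1 l)).
  - by move=> k; rewrite lee_fin.
  over.
rewrite avgZ//; last 2 first.
- exact: (measurable_avg hs (dyad m.+1) (mWx m x) (Wx0 m x)).
- by move=> l; apply: avg_ge0 => // k; rewrite lee_fin.
rewrite -[2 * C * _]mulrA (mulrC 2) [X in (_ <= X * _)%E]EFinM -[leRHS]muleA.
by apply: lee_wpmul2l; [rewrite lee_fin|exact: avg_W_le].
Qed.

Let me_ b m x : measurable_fun setT (fun z : Rd * Rd =>
  (C * dyad m `^ (- b) * W m (x + z.2)%R (x + z.1)%R)%:E).
Proof.
by apply/measurable_EFinP; apply: measurable_funM => //; apply/measurable_EFinP; exact: mWx.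
Qed.

Let me0 b m x (z : Rd * Rd) :
  (0 <= (C * dyad m `^ (- b) * W m (x + z.2)%R (x + z.1)%R)%:E)%E.
Proof. by rewrite lee_fin !mulr_ge0// ltW. Qed.

Let near_center x k m : snorm s k <= dyad m.+1 -> snorm s (x - (x + k)) <= dyad m.
Proof.
move=> hk; rewrite opprD addNKr snormN; apply: (le_trans hk).
exact: dyad_le.
Qed.

(* [vlev_step] descends from scale 1, whereas [wlev_step] climbs from the small
   scales, where the averages vanish by [lavg_wlev_vanish]. *)
Lemma vlev_step b m x : b \in levels RS c ->
  (lavg vlev b m.+1 x <= lavg vlev b m x + (2 * C * dyad m `^ (- b))%R%:E * GR m x)%E.
Proof.
move=> bl; apply: (le_trans _ (leeD2l _ (step_error b m x))).
apply: (avg_chain_inner hs (dyad_gt0 m.+1) (dyad_gt0 m.+2) _ _ (me_ b m x) _ _ (me0 b m x)).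
- exact: (mlevx (F := vlev) x (@measurable_vlev b)).
- exact: (mlevx (F := vlev) x (@measurable_vlev b)).
- by move=> k; rewrite lee_fin normr_ge0.
- by move=> k; rewrite lee_fin normr_ge0.
- move=> k l hk hl; rewrite -EFinD lee_fin; apply: vlev_chain => //.
  exact: near_center.
Qed.

Lemma wlev_step b m x : b \in levels RS c ->
  (lavg wlev b m x <= lavg wlev b m.+1 x + (2 * C * dyad m `^ (- b))%R%:E * GR m x)%E.
Proof.
move=> bl; apply: (le_trans _ (leeD2l _ (step_error b m x))).
apply: (avg_chain_outer hs (dyad_gt0 m.+1) (dyad_gt0 m.+2) _ _ (me_ b m x) _ _ (me0 b m x)).
- exact: (mlevx (F := wlev) x (@measurable_wlev b)).
- exact: (mlevx (F := wlev) x (@measurable_wlev b)).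
- by move=> k; rewrite lee_fin normr_ge0.
- by move=> k; rewrite lee_fin normr_ge0.
- move=> k l hk hl; rewrite -EFinD lee_fin; apply: wlev_chain => //.
  exact: near_center.
Qed.

Let p'1 : (1 <= p')%E.
Proof. by apply: le_trans (ltW ap'); rewrite lee_fin. Qed.

Let C2 : 0 <= 2 * C. Proof. by rewrite mulr_ge0// ltW. Qed.

Lemma dyad_pow_le m n e : (m <= n)%N -> 0 <= e -> dyad n `^ e <= dyad m `^ e.
Proof.
move=> mn e0; apply: ge0_ler_powR; rewrite ?nnegrE//; first exact/ltW/dyad_gt0.
  exact/ltW/dyad_gt0.
exact: dyad_le.
Qed.

(** Splits the decay into the two equal geometric factors that [Lle_series] asks for. *)
Lemma dyad_pow_geo e m : dyad m `^ e = (2^-1 `^ (e / 2)) ^+ m * (2^-1 `^ (e / 2)) ^+ m.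
Proof.
rewrite -exprMn -powRD; last by rewrite invr_eq0 pnatr_eq0 implybT.
rewrite -splitr -powR_mulrn ?powR_ge0// -powRrM mulrC powRrM.
by rewrite powR_mulrn// invr_ge0.
Qed.

Lemma half_pow_lt1 e : 0 < e -> 0 < (2^-1 : R) `^ (e / 2) < 1.
Proof.
move=> e0; have e2 : 0 < e / 2 by rewrite divr_gt0.
have h : (2^-1 : R) `^ (e / 2) < 1 `^ (e / 2).
  by apply: gt0_ltr_powR; rewrite ?nnegrE// invf_lt1// ltr1n.
by rewrite powR_gt0//=; move: h; rewrite powR1.
Qed.

Definition usum (x : Rd) : \bar R := (\sum_(b <- levels RS c) (`|f x b|)%:E)%E.
Definition loc_avg (x : Rd) : \bar R :=
  (avg s (dyad 1) (fun k => usum (x + k)%R `^ a) `^ a^-1)%E.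
Definition tail_sum (x : Rd) : \bar R :=
  (\sum_(m <oo) (dyad m `^ (- g))%:E * GR m x)%E.
(** The factor [2 C] is that of the errors in [vlev_step] and [wlev_step]; including it here lets
    [good] hold with constant 1. *)
Definition tstar (x : Rd) : \bar R := ((2 * C)%:E * (loc_avg x + tail_sum x))%E.

Let mGR m : measurable_fun setT (GR m).
Proof. by apply: measurable_poweRfun; exact: (Gav_Lle m).1. Qed.

Let usum0 x : (0 <= usum x)%E.
Proof. by apply: sume_ge0 => b _; rewrite lee_fin. Qed.

Let mlev_ b : measurable_fun setT (fun x : Rd => (`|f x b|)%:E).
Proof. by apply/measurable_EFinP; exact: (measurable_level _ pf). Qed.

Lemma measurable_usum : measurable_fun setT usum.
Proof. by apply: emeasurable_sum. Qed.

Lemma loc_avg_ge0 x : (0 <= loc_avg x)%E. Proof. exact: poweR_ge0. Qed.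

Let tt0 m x : (0 <= (dyad m `^ (- g))%:E * GR m x)%E.
Proof. by rewrite mule_ge0// lee_fin. Qed.

Lemma tail_sum_ge0 x : (0 <= tail_sum x)%E. Proof. exact: nneseries_ge0. Qed.

Lemma tstar_ge0 x : (0 <= tstar x)%E.
Proof. by rewrite mule_ge0 ?lee_fin// adde_ge0 ?loc_avg_ge0// tail_sum_ge0. Qed.

Definition loc_const : R := ((vol s (dyad 1))^-1 * (N ^+ 2) `^ a) `^ a^-1 * vol s (dyad 1) `^ u'.
Definition tail_const : R := (1 - 2^-1 `^ ((kappa - g) / 2)) ^- 2 * sob_const.
Definition tstar_const : R := 2 * C * (4 * (loc_const + tail_const)).

Lemma loc_const_ge0 : 0 <= loc_const. Proof. by rewrite mulr_ge0// powR_ge0. Qed.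
Lemma tail_const_ge0 : 0 <= tail_const.
Proof.
have /andP[_ t1] := half_pow_lt1 (etrans (subr_gt0 _ _) gk).
by rewrite mulr_ge0 ?sob_const_ge0// invr_ge0 exprn_ge0// subr_ge0 ltW.
Qed.

Lemma loc_avg_Lle : measurable_fun setT loc_avg /\ Lle mu p' loc_avg loc_const.
Proof.
have v1 := vol_gt0 s (dyad_gt0 1).
have k00 : 0 <= (vol s (dyad 1))^-1 by rewrite invr_ge0 ltW.
have Q0 : 0 <= (N ^+ 2) `^ a by exact: powR_ge0.
have mP : measurable_fun setT (fun x => usum x `^ a)%E.
  by apply: measurable_poweRfun; exact: measurable_usum.
have P0 x : (0 <= usum x `^ a)%E by exact: poweR_ge0.
have iP : (\int[mu]_x (usum x `^ a) <= ((N ^+ 2) `^ a)%:E)%E.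
  have := @Lle_sum _ _ _ mu R (levels RS c) a%:E (fun b x => (`|f x b|)%:E) 1.
  rewrite mulr1; apply => //.
have [mG LG] := Lle_average hs a1 ap' (dyad_gt0 1) k00 Q0 mP P0 iP.
by split => //; exact: measurable_poweRfun.
Qed.

(** By [Gav_Lle] the m-th term is bounded in L^p' by [sob_const * 2 ^ (-m (kappa - g))], a geometric
    decay because [g < kappa]. *)
Lemma tail_sum_Lle : measurable_fun setT tail_sum /\ Lle mu p' tail_sum tail_const.
Proof.
have mt m : measurable_fun setT (fun x => (dyad m `^ (- g))%:E * GR m x)%E.
  exact: measurable_funeM.
split; first by apply: ge0_emeasurable_sum => // m x _ _.
apply: Lle_series => //.
- by apply: half_pow_lt1; rewrite subr_gt0.
- exact: sob_const_ge0.
move=> m; rewrite -mulrA -dyad_pow_geo dpD.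
have -> : sob_const * (dyad m `^ kappa * dyad m `^ (- g)) =
    dyad m `^ (- g) * (sob_const * dyad m `^ kappa).
  by rewrite [RHS]mulrCA; congr (_ * _); rewrite mulrC.
apply: LleZ => //.
- by rewrite mulr_ge0// sob_const_ge0.
- exact: (Gav_Lle m).2.
Qed.

Lemma tstar_Lle : measurable_fun setT tstar /\ Lle mu p' tstar tstar_const.
Proof.
have [m1 L1] := loc_avg_Lle; have [m2 L2] := tail_sum_Lle.
have mS : measurable_fun setT (fun x => loc_avg x + tail_sum x)%E.
  exact: emeasurable_funD.
split; first exact: measurable_funeM.
have k1 := loc_const_ge0; have k2 := tail_const_ge0.
have k3 : 0 <= loc_const + tail_const by exact: addr_ge0.
apply: LleZ => //.
- by rewrite mulr_ge0.
- by move=> x; rewrite adde_ge0 ?loc_avg_ge0// tail_sum_ge0.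
apply: LleD => //; [exact: loc_avg_ge0|exact: tail_sum_ge0|..].
- by apply: Lle_widen L1 => //; rewrite lerDl.
- by apply: Lle_widen L2 => //; rewrite lerDr.
Qed.

(** At [rho = 1] all weights of [dnorm] are 1, so the uniform bound on [Gamma] controls each level
    by the sum [usum] of all levels; Jensen does the rest. *)
Lemma lavg_vlev0 b x : b \in levels RS c ->
  (lavg vlev b 0 x <= (2 * C)%:E * loc_avg x)%E.
Proof.
move=> bl; have v1 := dyad_gt0 1.
have mU : measurable_fun setT (fun k : Rd => usum (x + k)%R).
  exact: (measurableT_comp measurable_usum (mshift x)).
apply: (@le_trans _ _ (avg s (dyad 1) (fun k => C%:E * usum (x + k)%R))%E).
  apply: avg_le => //.
  - exact: (mlevx (F := vlev) x (@measurable_vlev b)).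
  - exact: measurable_funeM.
  - by move=> k; rewrite lee_fin normr_ge0.
  move=> k hk; rewrite /usum sumEFin -EFinM lee_fin.
  have := hC (near_center x hk) (dyad01 0) (hf (x + k)).
  rewrite /dyad expr0 {2}/dnorm; under eq_bigr do rewrite powR1 mul1r.
  apply: le_trans; have := dnorm_level (Gam x (x + k) (f (x + k))) bl ltr01.
  by rewrite powR1 mul1r.
rewrite avgZ//; last exact: ltW.
rewrite mulrC EFinM -muleA; apply: lee_wpmul2l; first by rewrite lee_fin ltW.
exact: (avg_jensen hs a1 v1 mU).
Qed.

Lemma partial_le n x :
  (\sum_(0 <= m < n) (dyad m `^ (- g))%:E * GR m x <= tail_sum x)%E.
Proof. by apply: (nneseries_lim_ge n) => m _ _. Qed.

(** Iterates [vlev_step] from scale 0. Since [b >= g], the weight [dyad n ^ (b - g)] does not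
    increase with [n], and it turns the error at scale [m] into [2 C] times a term of [tail_sum]. *)
Lemma vlev_tstar b n x : b \in levels RS c -> g <= b ->
  ((dyad n `^ (b - g))%:E * lavg vlev b n x <= tstar x)%E.
Proof.
move=> bl gb; have bg : 0 <= b - g by rewrite subr_ge0.
have l0 m : (0 <= lavg vlev b m x)%E.
  by apply: avg_ge0 => [|k]; [exact: dyad_gt0|rewrite lee_fin normr_ge0].
suff : ((dyad n `^ (b - g))%:E * lavg vlev b n x <= (2 * C)%:E *
    (loc_avg x + \sum_(0 <= m < n) (dyad m `^ (- g))%:E * GR m x))%E.
  move=> /le_trans; apply; apply: lee_wpmul2l; first by rewrite lee_fin.
  by apply: leeD2l; exact: partial_le.
elim: n => [|n ih].
  rewrite big_geq// adde0 /dyad expr0 powR1 mul1e.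
  exact: lavg_vlev0.
apply: (@le_trans _ _ ((dyad n.+1 `^ (b - g))%:E *
    (lavg vlev b n x + (2 * C * dyad n `^ (- b))%R%:E * GR n x))%E).
  by apply: lee_wpmul2l; [rewrite lee_fin|exact: vlev_step].
apply: (@le_trans _ _ ((dyad n `^ (b - g))%:E *
    (lavg vlev b n x + (2 * C * dyad n `^ (- b))%R%:E * GR n x))%E).
  apply: lee_wpmul2r; last by rewrite lee_fin; exact: dyad_pow_le.
  by rewrite adde_ge0// mule_ge0// lee_fin mulr_ge0.
rewrite ge0_muleDr//; last by rewrite mule_ge0// lee_fin mulr_ge0.
rewrite big_nat_recr//= addeA [leRHS]ge0_muleDr//; last first.
  by rewrite adde_ge0 ?loc_avg_ge0// sume_ge0.
apply: leeD => //; rewrite !muleA -!EFinM.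
rewrite (_ : dyad n `^ (b - g) * (2 * C * dyad n `^ (- b)) = 2 * C * dyad n `^ (- g))//.
by rewrite mulrCA -dpD; congr (_ * _ `^ _); ring.
Qed.

Let mWflip m x : measurable_fun setT (fun k : Rd => (W m (x + k)%R x)%:E).
Proof.
apply: (measurableT_comp (measurable_W m) (g := fun k : Rd => (x + k, x))).
by apply: measurable_fun_pair.
Qed.

(** Reversing the increment exposes [W(x + k, x)], whose a-th power integrated over [k] is bounded
    by [Psi m x]; the integral of [Psi m] is known. *)
Lemma lavg_wlev_flip b m x : b \in levels RS c ->
  (lavg wlev b m x <= (2 * C * dyad m `^ (- b))%:E *
    (((vol s (dyad m.+1))^-1%:E * Psi m x) `^ a^-1))%E.
Proof.
move=> bl; have v1 := dyad_gt0 m.+1.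
have Cb : 0 <= C * dyad m `^ (- b) by rewrite mulr_ge0// ltW.
have V0 : (0 <= (vol s (dyad m.+1))^-1%:E)%E by rewrite lee_fin invr_ge0 vol_ge0.
apply: (@le_trans _ _ (avg s (dyad m.+1) (fun k =>
    (C * dyad m `^ (- b))%:E * (W m (x + k)%R x)%:E))%E).
  apply: avg_le => //.
  - exact: (mlevx (F := wlev) x (@measurable_wlev b)).
  - exact: measurable_funeM.
  - by move=> k; rewrite lee_fin normr_ge0.
  move=> k hk; rewrite -EFinM lee_fin.
  have h1 := dnorm_level (f x - Gam x (x + k) (f (x + k))) bl (dyad_gt0 m).
  apply: (le_trans h1); rewrite (mulrC C) -mulrA ler_wpM2l//.
  by apply: W_flip; exact: near_center.
rewrite avgZ//; last by move=> k; rewrite lee_fin.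
rewrite -[2 * C * _]mulrA (mulrC 2) [X in (_ <= X * _)%E]EFinM -[leRHS]muleA.
apply: lee_wpmul2l; first by rewrite lee_fin.
have W00 k : (0 <= (W m (x + k)%R x)%:E)%E by rewrite lee_fin.
apply: (le_trans (avg_jensen hs a1 v1 (mWflip m x) W00)).
apply: lee_wpmul2l => //; apply: lee_poweR.
- by rewrite invr_ge0 ltW.
- by apply: avg_ge0 => // k; exact: poweR_ge0.
apply: lee_wpmul2l => //.
have mH : measurable_fun setT (fun k : Rd => (W m (x + k)%R x)%:E `^ a)%E.
  exact: measurable_poweRfun.
apply: ge0_subset_integral.
- exact: measurable_cball.
- exact: measurable_cball.
- exact: measurable_funTS.
- by move=> k _; exact: poweR_ge0.
- by move=> k hk; apply: (le_trans hk); exact: dyad_le.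
Qed.

Lemma lavg_wlev_ge0 b m x : (0 <= lavg wlev b m x)%E.
Proof. by apply: avg_ge0 => [|k]; [exact: dyad_gt0|rewrite lee_fin normr_ge0]. Qed.

Lemma measurable_lavg_wlev b m : measurable_fun setT (lavg wlev b m).
Proof.
apply: (measurable_avg hs (dyad m.+1) (e := fun z : Rd * Rd => (wlev b z.1 (z.1 + z.2)%R)%:E)).
  apply: (measurableT_comp (@measurable_wlev b) (g := fun z : Rd * Rd => (z.1, z.1 + z.2))).
  by apply: measurable_fun_pair.
by move=> z; rewrite lee_fin normr_ge0.
Qed.

Lemma lavg_wlev_Lle b m : b \in levels RS c ->
  Lle mu a%:E (lavg wlev b m)
    (2 * C * ((2 ^+ S) `^ a^-1 * N ^+ 2) * dyad m `^ (c - b)).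
Proof.
move=> bl; have v1 := dyad_gt0 m.+1; have v0 := vol_gt0 s v1.
have vi : 0 <= (vol s (dyad m.+1))^-1 by rewrite invr_ge0 ltW.
have V0 : (0 <= (vol s (dyad m.+1))^-1%:E)%E by rewrite lee_fin.
have Cb : 0 <= 2 * C * dyad m `^ (- b) by rewrite mulr_ge0.
pose G x : \bar R := ((vol s (dyad m.+1))^-1%:E * Psi m x)%E.
have G0 x : (0 <= G x)%E by rewrite mule_ge0// Psi_ge0.
have mG : measurable_fun setT G by apply: measurable_funeM; exact: measurable_Psi.
have mGr : measurable_fun setT (fun x => G x `^ a^-1)%E by exact: measurable_poweRfun.
have Gr0 x : (0 <= G x `^ a^-1)%E by exact: poweR_ge0.
pose Q : R := 2 ^+ S * (N ^+ 2 * dyad m `^ c) `^ a.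
have Q0 : 0 <= Q by rewrite mulr_ge0 ?exprn_ge0// powR_ge0.
have iG : (\int[mu]_x G x <= Q%:E)%E.
  rewrite /G ge0_integralZl//; last 2 first.
  - exact: measurable_Psi.
  - by move=> x _; exact: Psi_ge0.
  apply: (le_trans (lee_wpmul2l V0 (int_Psi m))).
  rewrite -EFinM lee_fin mulrA /Q; apply: ler_wpM2r; first exact: powR_ge0.
  rewrite /vol dyadS expr_div_n le_eqVlt; apply/orP; left; apply/eqP.
  have r0 : dyad m ^+ S != 0 by rewrite expf_neq0// gt_eqF// dyad_gt0.
  have e2 n : (2 : R) ^+ n != 0 by rewrite expf_neq0.
  by field; rewrite !e2 r0.
have LG : Lle mu a%:E (fun x => G x `^ a^-1)%E (Q `^ a^-1).
  by apply: (Lle_interp_self a1 mGr mG Gr0 Q0) => // x; rewrite poweRVK.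
have -> : 2 * C * ((2 ^+ S) `^ a^-1 * N ^+ 2) * dyad m `^ (c - b) =
    2 * C * dyad m `^ (- b) * Q `^ a^-1.
  have [B BE] : exists B, B = N ^+ 2 * dyad m `^ c by eexists.
  have B0 : 0 <= B by rewrite BE mulr_ge0 ?exprn_ge0 ?powR_ge0.
  have [X XE] : exists X : R, X = 2 ^+ S by eexists.
  have X0 : 0 <= X by rewrite XE exprn_ge0.
  rewrite /Q -BE -XE powRM ?powR_ge0// -powRrM mulfV ?gt_eqF// powRr1// BE dpD.
  by ring.
apply: (Lle_mono (g' := fun x => (2 * C * dyad m `^ (- b))%:E * (G x `^ a^-1))%E).
- by rewrite lee_fin.
- exact: measurable_lavg_wlev.
- exact: measurable_funeM.
- exact: lavg_wlev_ge0.
- by move=> x; exact: lavg_wlev_flip.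
by apply: LleZ => //; rewrite ?lee_fin ?powR_ge0.
Qed.

(** As [b < c], the averages decay geometrically in L^a, so their series is finite almost
    everywhere. A finite sum of nonnegative terms has arbitrarily small terms at arbitrarily fine
    scales. *)
Lemma lavg_wlev_vanish b : b \in levels RS c -> {ae mu, forall x, forall n (e : R),
  0 < e -> exists m, (n <= m)%N /\ (lavg wlev b m x < e%:E)%E}.
Proof.
move=> bl; have bc : 0 < c - b by rewrite subr_gt0; exact: levels_lt bl.
pose K := 2 * C * ((2 ^+ S) `^ a^-1 * N ^+ 2).
have K0 : 0 <= K by rewrite mulr_ge0// mulr_ge0 ?powR_ge0// exprn_ge0.
have mw m := measurable_lavg_wlev b m.
have L : Lle mu a%:E (fun x => \sum_(m <oo) lavg wlev b m x)%E
    ((1 - 2^-1 `^ ((c - b) / 2)) ^- 2 * K).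
  apply: Lle_series => //.
  - exact: half_pow_lt1.
  - by move=> m x; exact: lavg_wlev_ge0.
  by move=> m; rewrite -mulrA -dyad_pow_geo; exact: lavg_wlev_Lle.
have mS : measurable_fun setT (fun x => \sum_(m <oo) lavg wlev b m x)%E.
  by apply: ge0_emeasurable_sum => // m x _ _; exact: lavg_wlev_ge0.
have S0 x : (0 <= \sum_(m <oo) lavg wlev b m x)%E.
  by apply: nneseries_ge0 => m _ _; exact: lavg_wlev_ge0.
apply: filterS (Lle_fin_ae a1 mS S0 L) => x hx n e e0.
by apply: small_terms => // m; exact: lavg_wlev_ge0.
Qed.

(** Here [b < g], so [dyad n ^ (b - g) <= dyad m ^ (b - g)] for every finer scale [m >= n], which
    again turns the errors into terms of [tail_sum]. *)
Lemma wlev_telescope b n k x : b \in levels RS c -> b < g ->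
  ((dyad n `^ (b - g))%:E * lavg wlev b n x <=
   (dyad n `^ (b - g))%:E * lavg wlev b (n + k) x + (2 * C)%:E *
     \sum_(n <= m < n + k) ((dyad m `^ (- g))%:E * GR m x))%E.
Proof.
move=> bl bg; elim: k => [|k ih].
  by rewrite addn0 big_geq// mule0 adde0.
apply: (le_trans ih); rewrite addnS big_nat_recr ?leq_addr//=.
rewrite [((2 * C)%:E * (_ + _))%E]ge0_muleDr//; last exact: sume_ge0.
rewrite [X in (_ <= _ + X)%E]addeC addeA; apply: leeD2r.
apply: (@le_trans _ _ ((dyad n `^ (b - g))%:E * (lavg wlev b (n + k).+1 x +
    (2 * C * dyad (n + k) `^ (- b))%R%:E * GR (n + k) x))%E).
  by apply: lee_wpmul2l; [rewrite lee_fin|exact: wlev_step].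
rewrite ge0_muleDr ?lavg_wlev_ge0//; last by rewrite mule_ge0// lee_fin mulr_ge0.
apply: leeD2l; rewrite !muleA; apply: lee_wpmul2r => //; rewrite -!EFinM lee_fin.
rewrite mulrCA -!mulrA ler_wpM2l// ler_wpM2l ?(ltW C0)//.
have -> : dyad (n + k) `^ (- g) = dyad (n + k) `^ (b - g) * dyad (n + k) `^ (- b).
  by rewrite -dpD; congr (_ `^ _); ring.
apply: ler_wpM2r => //.
have -> : b - g = - (g - b) by ring.
rewrite !powRN; have d0 m : 0 < dyad m `^ (g - b) by rewrite powR_gt0// dyad_gt0.
by rewrite lef_pV2 ?posrE// dyad_pow_le ?leq_addr// subr_ge0 ltW.
Qed.

Definition good x := forall n b, b \in levels RS c ->
  ((dyad n `^ b)%:E * lavg mlev b n x <= (dyad n `^ g)%:E * tstar x)%E.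

Lemma ae_good : {ae mu, forall x, good x}.
Proof.
have := ae_seq (@lavg_wlev_vanish); apply: filterS => x hx n b bl.
suff h : ((dyad n `^ (b - g))%:E * lavg mlev b n x <= tstar x)%E.
  have := lee_wpmul2l (_ : (0 <= (dyad n `^ g)%:E)%E) h; rewrite lee_fin => /(_ (dpow n g)).
  by rewrite muleA -EFinM -dpD addrC subrK.
have [gb|bg] := leP g b.
  rewrite (_ : lavg mlev b n x = lavg vlev b n x); first exact: vlev_tstar.
  by rewrite /lavg /mlev ltNge gb.
rewrite (_ : lavg mlev b n x = lavg wlev b n x); last by rewrite /lavg /mlev bg.
apply: (@le_trans _ _ ((2 * C)%:E * tail_sum x)%E); last first.
  apply: lee_wpmul2l; first by rewrite lee_fin.
  by rewrite leeDr// loc_avg_ge0.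
apply/lee_addgt0Pr => e e0; have D0 : 0 < dyad n `^ (b - g) by rewrite powR_gt0// dyad_gt0.
(* Telescope from [n] to a finer scale [m] at which the remaining average, with its weight, is below
   [e]. *)
have [m [nm hm]] := hx b bl n (e / dyad n `^ (b - g)) (divr_gt0 e0 D0).
have := wlev_telescope n (m - n) x bl bg; rewrite subnKC// => /le_trans; apply.
rewrite addeC; apply: leeD.
  apply: lee_wpmul2l; first by rewrite lee_fin.
  apply: (le_trans _ (partial_le m x)).
  by rewrite [leRHS](@big_cat_nat _ _ _ n)//= leeDr// sume_ge0.
apply: (le_trans (lee_wpmul2l _ (ltW hm))); first by rewrite lee_fin.
by rewrite -EFinM lee_fin mulrC divfK// gt_eqF.
Qed.

Hypothesis gc : g <= c.
Local Notation f' := (restrict_below g f).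

(** Inserts the unrestricted value [f (x + k)] at an auxiliary point. Below level [g], the increment
    of [f'] is that of [f] from [x + k] to [x + h] plus [Gamma_{x+h,x}] applied to [v], and the
    levels of [v] have norms [mlev b x (x + k)]. *)
Lemma restrict_increment_mlev n z x h k : z \in levels RS g -> snorm s h <= dyad n ->
  `|(f' (x + h) - Gam (x + h) x (f' x)) z| <= wlev z (x + h) (x + k) +
    C * dyad n `^ (- z) * \sum_(b <- levels RS c) dyad n `^ b * mlev b x (x + k).
Proof.
move=> zg hn; have zlg := levels_lt zg.
have zl := levels_le gc zg.
pose v := Gam x (x + k) (f (x + k)) - f' x.
have hf' : in_below c (f' x) by apply: in_below_le gc _; exact: in_below_dsum_below.
have vb : in_below c v by apply: in_belowB => //; apply: group_in_below.
rewrite (_ : (f' (x + h) - Gam (x + h) x (f' x)) z =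
    (f (x + h) - Gam (x + h) (x + k) (f (x + k))) z + Gam (x + h) x v z); last first.
  rewrite (groupB _ _ (grp _ _)) !dsum_valB md_Gamma_comp restrict_level//.
  by rewrite addrA subrK.
apply: (le_trans (ler_normD _ _)); rewrite lerD2l.
apply: (le_trans (dnorm_level _ zl (dyad_gt0 n))).
rewrite (mulrC C) -mulrA ler_wpM2l//.
have hh : snorm s (x + h - x) <= dyad n by rewrite addrC addKr.
apply: (le_trans (hC hh (dyad01 n) vb)); rewrite ler_wpM2l ?(ltW C0)//.
rewrite /dnorm le_eqVlt; apply/orP; left; apply/eqP; apply: eq_bigr => b _.
congr (_ * _); rewrite /v /mlev dsum_valB /restrict_below dsum_belowE.
by case: ifP => _; [rewrite /wlev dsum_valB distrC|rewrite subr0].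
Qed.

(** The ball of radius [dyad n.+2] about 0 lies in the ball of twice that radius about [l]; [2 ^ S]
    is the ratio of the volumes. *)
Lemma avg_shrink n (l : Rd) (Phi : Rd -> \bar R) : measurable_fun setT Phi ->
  (forall k, (0 <= Phi k)%E) -> snorm s l <= dyad n.+2 ->
  (avg s (dyad n.+2) Phi <=
   (2 ^+ S)%:E * avg s (dyad n.+1) (fun k => Phi (k + l)%R))%E.
Proof.
move=> mPhi P0 hl; have v1 := vol_gt0 s (dyad_gt0 n.+1).
have v2 := vol_gt0 s (dyad_gt0 n.+2).
rewrite /avg muleA -EFinM (_ : 2 ^+ S * (vol s (dyad n.+1))^-1 = (vol s (dyad n.+2))^-1).
  apply: lee_wpmul2l; first by rewrite lee_fin invr_ge0 ltW.
  apply: integral_cball_shift => // h hh; rewrite -[h](addrK l).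
  apply: (le_trans (snormB hs _ _)); apply: (le_trans (lerD hh hl)).
  by rewrite !dyadS; have := dyad_gt0 n; lra.
rewrite /vol (dyadS n.+1) expr_div_n.
have r0 : dyad n.+1 ^+ S != 0 by rewrite expf_neq0// gt_eqF// dyad_gt0.
have e2 m : (2 : R) ^+ m != 0 by rewrite expf_neq0.
by field; rewrite !e2 r0.
Qed.

Lemma dyad0 : dyad 0 = 1. Proof. by rewrite /dyad expr0. Qed.

(** For every [k], [|f x z|] is at most [wlev + vlev]. Averaged at scale 0, the first term is
    controlled by [good x], as [z < g], and the second by [lavg_vlev0]. *)
Lemma level_le_tstar z x : good x -> z \in levels RS c -> z < g ->
  ((`|f x z|)%:E <= 2%:E * tstar x)%E.
Proof.
move=> gx zl zg; have v1 := dyad_gt0 1.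
have mw := mlevx (F := wlev) x (@measurable_wlev z).
have mv := mlevx (F := vlev) x (@measurable_vlev z).
have w0 k : (0 <= (wlev z x (x + k)%R)%:E)%E by rewrite lee_fin normr_ge0.
have v0 k : (0 <= (vlev z x (x + k)%R)%:E)%E by rewrite lee_fin normr_ge0.
apply: (@le_trans _ _ (lavg wlev z 0 x + lavg vlev z 0 x)%E).
  rewrite /lavg -avgD// -(avg_cst hs (`|f x z|)%:E v1); apply: avg_le => //.
    exact: emeasurable_funD.
  move=> k _; rewrite -EFinD lee_fin /wlev /vlev.
  by rewrite -[X in `|X| <= _](subrK (Gam x (x + k) (f (x + k)) z)); exact: ler_normD.
have -> : (2%:E * tstar x = tstar x + tstar x)%E by rewrite mule_natl mule2n.
apply: leeD.
  have := gx 0%N z zl; rewrite dyad0 !powR1 !mul1e; apply: le_trans.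
  by rewrite /lavg /mlev zg.
apply: (le_trans (lavg_vlev0 x zl)).
apply: lee_wpmul2l; first by rewrite lee_fin.
by rewrite leeDl// tail_sum_ge0.
Qed.

Let CN : R := 1 + C * N.
Let CN1 : 1 <= CN. Proof. by rewrite lerDl mulr_ge0// ltW. Qed.

Let T0 := tstar_ge0.

(** Averages [restrict_increment_mlev] over the auxiliary point [x + k]. By [avg_shrink] with
    [l = h], the first term becomes an average centred at [x + h], where [good (x + h)] applies;
    with [l = 0] the others fall under [good x]. *)
Lemma near_increment n z x h : good x -> good (x + h) -> z \in levels RS g ->
  snorm s h <= dyad n.+2 ->
  ((`|(f' (x + h) - Gam (x + h) x (f' x)) z|)%:E <=
   (2 ^+ S * CN * dyad n `^ (g - z))%:E * (tstar (x + h) + tstar x))%E.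
Proof.
move=> gx gxh zg hn; have zlg := levels_lt zg.
have zl := levels_le gc zg.
have v2 := dyad_gt0 n.+2.
have Cz : 0 <= C * dyad n `^ (- z) by rewrite mulr_ge0// ltW.
have hn0 : snorm s h <= dyad n by apply: (le_trans hn); apply: dyad_le; rewrite -addn2 leq_addr.
have mmlev b : measurable_fun setT (fun k => (mlev b x (x + k))%:E).
  exact: (mlevx (F := mlev) x (@measurable_mlev b)).
have ml0 b k : (0 <= (mlev b x (x + k)%R)%:E)%E.
  by rewrite lee_fin /mlev; case: ifP => _; exact: normr_ge0.
pose Phi k : \bar R := (wlev z (x + h) (x + k))%:E.
have mPhi : measurable_fun setT Phi.
  apply: (measurableT_comp (@measurable_wlev z) (g := fun k : Rd => (x + h, x + k))).
  by apply: measurable_fun_pair => //; exact: mshift.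
have P0 k : (0 <= Phi k)%E by rewrite lee_fin normr_ge0.
pose Th b k : \bar R := ((dyad n `^ b)%:E * (mlev b x (x + k)%R)%:E)%E.
have mTh b : measurable_fun setT (Th b) by exact: measurable_funeM.
have Th0 b k : (0 <= Th b k)%E by rewrite mule_ge0// lee_fin.
have Sh0 k : (0 <= \sum_(b <- levels RS c) Th b k)%E by exact: sume_ge0.
have mSh : measurable_fun setT (fun k => \sum_(b <- levels RS c) Th b k)%E.
  exact: emeasurable_sum.
have e2S : 0 <= (2 : R) ^+ S by exact: exprn_ge0.
rewrite -(avg_cst hs (`|(f' (x + h) - Gam (x + h) x (f' x)) z|)%:E v2).
apply: (@le_trans _ _ (avg s (dyad n.+2) (fun k => Phi k +
    (C * dyad n `^ (- z))%:E * \sum_(b <- levels RS c) Th b k))%E).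
  apply: avg_le => //.
    by apply: emeasurable_funD => //; exact: measurable_funeM.
  move=> k _; rewrite /Th /Phi.
  under eq_bigr do rewrite -EFinM.
  rewrite sumEFin -EFinM -EFinD lee_fin.
  exact: restrict_increment_mlev.
rewrite avgD//; last 2 first.
- exact: measurable_funeM.
- by move=> k; rewrite mule_ge0// lee_fin.
rewrite avgZ// avg_sum//.
have Lmlev b : b \in levels RS c ->
    (avg s (dyad n.+2) (Th b) <= (2 ^+ S * dyad n `^ g)%:E * tstar x)%E.
  move=> bl; rewrite /Th avgZ//.
  have := avg_shrink (mmlev b) (ml0 b) (_ : snorm s 0 <= dyad n.+2).
  rewrite snorm0// => /(_ (ltW v2)).
  under [X in (_ <= _ * avg _ _ X)%E]eq_fun do rewrite addr0.
  rewrite -/(lavg mlev b n x) => h1.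
  apply: (le_trans (lee_wpmul2l _ h1)); first by rewrite lee_fin.
  rewrite muleCA EFinM -muleA; apply: lee_wpmul2l; first by rewrite lee_fin.
  exact: gx.
have Lw : (avg s (dyad n.+2) Phi <= (2 ^+ S * dyad n `^ (g - z))%:E * tstar (x + h)%R)%E.
  apply: (le_trans (avg_shrink mPhi P0 hn)).
  rewrite EFinM -muleA; apply: lee_wpmul2l; first by rewrite lee_fin.
  rewrite (_ : avg _ _ _ = lavg mlev z n (x + h)%R); last first.
    rewrite /lavg /mlev zlg; congr (avg _ _ _); apply/funext => k.
    by rewrite /Phi (addrC k) addrA.
  have := gxh n z zl; have d0 : 0 < dyad n `^ z by rewrite powR_gt0// dyad_gt0.
  move=> /(lee_wpmul2l (_ : (0 <= ((dyad n `^ z)^-1)%:E)%E)).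
  rewrite lee_fin invr_ge0 (ltW d0) => /(_ isT).
  rewrite muleA -EFinM mulVf ?gt_eqF// mul1e muleA -EFinM -powRN -dpD.
  by rewrite (addrC (- z)).
have Ls : (\sum_(b <- levels RS c) avg s (dyad n.+2) (Th b) <=
    (N * (2 ^+ S * dyad n `^ g))%:E * tstar x)%E.
  rewrite EFinM -muleA -sume_const; last by rewrite mule_ge0// lee_fin mulr_ge0.
  by rewrite big_seq [leRHS]big_seq; apply: lee_sum.
apply: (le_trans (leeD Lw (lee_wpmul2l _ Ls))); first by rewrite lee_fin.
rewrite [X in (_ + X <= _)%E]muleA -EFinM [leRHS]ge0_muleDr//.
apply: leeD; apply: lee_wpmul2r => //; rewrite lee_fin.
  by rewrite -mulrA ler_wpM2l// ler_peMl.
rewrite (_ : C * dyad n `^ (- z) * (N * (2 ^+ S * dyad n `^ g)) =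
    2 ^+ S * (C * N) * dyad n `^ (g - z)); last by rewrite dpD; ring.
by rewrite ler_wpM2r// ler_wpM2l// lerDr.
Qed.

(** Used when [|h|] is comparable to 1: the increment is bounded by the triangle inequality, with no
    cancellation, from the sizes of the levels at [x] and [x + h]. *)
Lemma far_increment z x h : good x -> good (x + h) -> z \in levels RS g ->
  snorm s h <= 1 ->
  ((`|(f' (x + h) - Gam (x + h) x (f' x)) z|)%:E <=
   (2 * CN)%:E * (tstar (x + h) + tstar x))%E.
Proof.
move=> gx gxh zg h1; have zlg := levels_lt zg.
have zl := levels_le gc zg.
have hf' : in_below c (f' x) by apply: in_below_le gc _; exact: in_below_dsum_below.
apply: (@le_trans _ _ ((`|f (x + h)%R z|)%:E +
    C%:E * \sum_(b <- levels RS c) (`|f' x b|)%:E)%E).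
  rewrite sumEFin -EFinM -EFinD lee_fin dsum_valB restrict_level//.
  apply: (le_trans (ler_normB _ _)); rewrite lerD2l.
  have hh : snorm s (x + h - x) <= 1 by rewrite addrC addKr.
  have h01 : 0 < (1 : R) <= 1 by rewrite ltr01 lexx.
  have := hC hh h01 hf'; rewrite {2}/dnorm.
  under eq_bigr do rewrite powR1 mul1r.
  apply: le_trans; have := dnorm_level (Gam (x + h) x (f' x)) zl ltr01.
  by rewrite powR1 mul1r.
rewrite [leRHS]ge0_muleDr//; apply: leeD.
  apply: (le_trans (level_le_tstar gxh zl zlg)).
  by apply: lee_wpmul2r => //; rewrite lee_fin ler_peMr.
apply: (@le_trans _ _ (C%:E * (N%:E * (2%:E * tstar x)))%E).
  apply: lee_wpmul2l; first by rewrite lee_fin ltW.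
  rewrite -sume_const; last by rewrite mule_ge0.
  rewrite big_seq [leRHS]big_seq; apply: lee_sum => b bl.
  rewrite /restrict_below dsum_belowE; case: ifP => bg; first exact: level_le_tstar.
  by rewrite normr0 mule_ge0.
move: (tstar x) (T0 x) => T hT.
rewrite !muleA -!EFinM; apply: lee_wpmul2r => //; rewrite lee_fin.
by rewrite mulrC ler_wpM2l// lerDr.
Qed.

Lemma increment_le_tstar z x h : good x -> good (x + h) -> z \in levels RS g ->
  h != 0 -> snorm s h <= 1 ->
  ((increment s Gam g z f' h x)%:E <=
   (8 `^ (g - z) * (2 ^+ S * (2 * CN)))%:E * (tstar (x + h) + tstar x))%E.
Proof.
move=> gx gxh zg h0 h1; have sh0 := snorm_gt0 hs h0.
have gz : 0 < g - z by rewrite subr_gt0; exact: levels_lt zg.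
have S1 : 1 <= (2 : R) ^+ S by rewrite exprn_ege1// ler1n.
have t0 : 0 < snorm s h `^ (g - z) by rewrite powR_gt0.
have CN0 : 0 <= CN by exact: le_trans CN1.
have TT : (0 <= tstar (x + h)%R + tstar x)%E by rewrite adde_ge0.
suff H : ((`|(f' (x + h) - Gam (x + h) x (f' x)) z|)%:E <=
    (8 `^ (g - z) * (2 ^+ S * (2 * CN)) * snorm s h `^ (g - z))%:E *
    (tstar (x + h)%R + tstar x))%E.
  rewrite /increment mulrC EFinM.
  apply: (le_trans (lee_wpmul2l _ H)); first by rewrite lee_fin invr_ge0 ltW.
  by rewrite muleA -EFinM mulrCA mulVf ?gt_eqF// mulr1.
(* For [|h| <= 1/4], bracketing [4 |h|] gives [dyad n.+3 < |h| <= dyad n.+2], the range of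
   [near_increment], and [dyad n <= 8 |h|], the origin of the 8. For larger [h] one has
   [8 |h| >= 1]. *)
have [h4|h4] := leP (snorm s h) 4^-1.
  have h41 : 0 < 4 * snorm s h <= 1 by apply/andP; lra.
  have [n /andP[n1 n0]] := dyadic_bracket h41; rewrite -!/(dyad _) in n1 n0.
  have n3 : dyad n.+3 < snorm s h by move: n1; rewrite !dyadS; lra.
  have n2 : snorm s h <= dyad n.+2 by rewrite !dyadS; lra.
  apply: (le_trans (near_increment gx gxh zg n2)).
  apply: lee_wpmul2r => //; rewrite lee_fin.
  have d8 : dyad n <= 8 * snorm s h by move: n3; rewrite !dyadS; lra.
  have : dyad n `^ (g - z) <= 8 `^ (g - z) * snorm s h `^ (g - z).
    rewrite -powRM// ?(ltW sh0)//; apply: ge0_ler_powR; rewrite ?nnegrE ?(ltW gz)//.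
      exact/ltW/dyad_gt0.
    by rewrite mulr_ge0// ltW.
  have SC0 : 0 <= 2 ^+ S * CN by rewrite mulr_ge0 ?exprn_ge0.
  move=> h8; apply: (le_trans (ler_wpM2l SC0 h8)).
  rewrite (_ : 8 `^ (g - z) * (2 ^+ S * (2 * CN)) * snorm s h `^ (g - z) =
    2 * (2 ^+ S * CN * (8 `^ (g - z) * snorm s h `^ (g - z)))); last by ring.
  by rewrite ler_peMl ?ler1n// mulr_ge0// mulr_ge0// powR_ge0.
apply: (le_trans (far_increment gx gxh zg h1)).
apply: lee_wpmul2r => //; rewrite lee_fin.
have : 1 <= 8 `^ (g - z) * snorm s h `^ (g - z).
  rewrite -powRM// ?(ltW sh0)//.
  apply: (@le_trans _ _ (1 `^ (g - z))); first by rewrite powR1.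
  have h8 : 1 <= 8 * snorm s h by lra.
  by apply: ge0_ler_powR; rewrite ?nnegrE ?(ltW gz)// (le_trans ler01 h8).
move=> h8.
rewrite (_ : 8 `^ (g - z) * (2 ^+ S * (2 * CN)) * snorm s h `^ (g - z) =
  2 ^+ S * (8 `^ (g - z) * snorm s h `^ (g - z)) * (2 * CN)); last by ring.
by rewrite ler_peMl ?mulr_ge0// mulr_ege1.
Qed.

Lemma tstar_const_ge0 : 0 <= tstar_const.
Proof. by rewrite !mulr_ge0// ?(ltW C0)// addr_ge0 ?loc_const_ge0 ?tail_const_ge0. Qed.

Let K0 := tstar_const_ge0.

Lemma sobolev_local z : z \in levels RS g ->
  Lle mu p' (fun x => (`|f' x z|)%:E) (2 * tstar_const).
Proof.
move=> zg; have zlg := levels_lt zg; have [mT LT] := tstar_Lle.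
have zl := levels_le gc zg.
rewrite (_ : (fun x => _) = (fun x => (`|f x z|)%:E)); last first.
  by apply/funext => x; rewrite restrict_level.
apply: (Lle_mono_ae (g' := fun x => 2%:E * tstar x)%E) => //.
- exact: measurable_funeM.
- by move=> x; rewrite mule_ge0.
- by apply: filterS ae_good => x gx; exact: level_le_tstar.
- exact: LleZ.
Qed.

Lemma sobolev_increment z h : z \in levels RS g -> snorm s h <= 1 ->
  (incr_norm M setT p' g z f' h <=
   (8 `^ (g - z) * (2 ^+ S * (2 * CN)) * (4 * tstar_const))%:E)%E.
Proof.
move=> zg h1; have zlg := levels_lt zg; have [mT LT] := tstar_Lle.
have CN0 : 0 <= CN by exact: le_trans CN1.
have A0 : 0 <= 8 `^ (g - z) * (2 ^+ S * (2 * CN)).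
  by rewrite mulr_ge0 ?powR_ge0// mulr_ge0 ?exprn_ge0// mulr_ge0.
have [->|h0] := eqVneq h 0.
  by rewrite incr_norm0// lee_fin mulr_ge0// mulr_ge0.
have gg : g <= gamma by exact: le_trans cg.
have pf' : premodelled g f' by exact: premodelled_restrict pf.
have mTh : measurable_fun setT (fun x : Rd => tstar (x + h)).
  exact: (measurableT_comp mT (measurable_rV_add h)).
have mTT : measurable_fun setT (fun x : Rd => tstar (x + h)%R + tstar x)%E.
  exact: (emeasurable_funD mTh mT).
have AK0 : 0 <= 8 `^ (g - z) * (2 ^+ S * (2 * CN)) * (4 * tstar_const).
  by rewrite mulr_ge0// mulr_ge0.
have [_ E] := @Lp_normTP R d p' (increment s Gam g z f' h) _ p'1
  (increment_ge0 M g z f' h) AK0.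
apply: E.
apply: (Lle_mono_ae (g' := fun x : Rd => (8 `^ (g - z) * (2 ^+ S * (2 * CN)))%:E *
    (tstar (x + h)%R + tstar x))%E) => //.
- by apply/measurable_EFinP; exact: measurable_increment1 gg pf'.
- exact: measurable_funeM.
- by move=> x; rewrite lee_fin increment_ge0.
- by move=> x; rewrite mule_ge0// adde_ge0.
(* For fixed [h], translation invariance makes [x + h] good for almost every [x]. *)
- apply: filterS2 ae_good (ae_translate h ae_good) => x gx gxh.
  exact: increment_le_tstar.
apply: LleZ => //; first by rewrite mulr_ge0.
- by move=> x; rewrite adde_ge0.
exact: (LleD p'1 K0 mTh mT (fun x => T0 (x + h)) T0
  (@Lle_translate R d p' tstar tstar_const h p'1 mT T0 LT) LT).
Qed.

End sobolev.

(** * Bounded embeddings for p < p' *)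

Section sobolev_embedding.
Context {R : realType} {d : nat} {s : 'I_d -> nat}.
Context {RS : regularity_structure R} {P : polynomial_part s RS}.
Context {gamma : R} {r : nat} (M : model P gamma r).
Hypothesis hd : (0 < d)%N.
Hypothesis hs : forall i, (1 <= s i)%N.
Local Notation Rd := 'rV[R]_d.
Local Notation Gam := (md_Gamma M).
Local Notation mu := (@lebesgue_rV R d).
Local Notation S := (scale_deg s).

Lemma fine_inve_le (a : R) (p' : \bar R) : 0 < a -> (a%:E < p')%E -> fine (p'^-1)%E <= a^-1.
Proof.
move=> a0; case: p' => [b|_|]//; last by rewrite invey/= invr_ge0 ltW.
rewrite lte_fin => ab; have b0 := lt_trans a0 ab.
by rewrite inver (gt_eqF b0)/= lef_pV2 ?posrE// ltW.
Qed.

Lemma bounded_embedding_sobolev (a : R) (p' : \bar R) c g :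
  1 <= a -> (a%:E < p')%E -> c <= gamma ->
  g < c - S%:R * (a^-1 - fine (p'^-1)%E) ->
  bounded_embedding M setT a%:E +oo c p' +oo g.
Proof.
move=> a1 ap' cg gk; have a0 : 0 < a := lt_le_trans ltr01 a1.
have a1' : (1 <= a%:E)%E by rewrite lee_fin.
have p'1 : (1 <= p')%E by exact: le_trans (ltW ap').
have gc : g <= c.
  apply/ltW/(lt_le_trans gk); rewrite gerBl mulr_ge0// subr_ge0.
  exact: fine_inve_le.
have [C [C0 hC]] := Gamma_dnorm M cg.
apply: bounded_embedding_unit => //; [exact: leey|exact: leey|exact: le_trans cg|].
pose T := `|@tstar_const R d s RS c a g C p'|.
pose A : R := 2 ^+ S * (2 * (1 + C * (size (levels RS c))%:R)).
pose B z : R := `|8 `^ (g - z) * A * (4 * T)|.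
have T0 : 0 <= T by exact: normr_ge0.
have B0 z : 0 <= B z by exact: normr_ge0.
(* One constant for all levels: [2 T] covers the local parts, and the sum dominates the bounds on
   increments, which depend on [z] through [8 ^ (g - z)]. *)
exists (1 + 2 * T + \sum_(z <- levels RS g) B z); split.
  by apply: ltr_wpDr; [by apply: sumr_ge0|apply: ltr_wpDr; rewrite ?mulr_ge0].
move=> f [pf hf].
have hloc b : b \in levels RS c -> Lle mu a%:E (fun x => (`|f x b|)%:E) 1.
  move=> bl; have [E _] := @Lp_normTP R d a%:E (fun x => `|f x b|) 1 a1'
    (fun x => normr_ge0 (f x b)) ler01.
  exact: E (hf b bl).1.
have hinc : {ae mu, forall h, cball s 1 h ->
    forall z, z \in levels RS c -> (incr_norm M setT a%:E c z f h <= 1)%E}.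
  apply: filterS (@ae_seq _ _ _ mu _ (levels RS c)
    (fun z h => cball s 1 h -> (incr_norm M setT a%:E c z f h <= 1)%E) _) => [h H hB z zl|z zl].
    exact: H.
  have [E _] := @increment_partP R d s RS P gamma r M setT a%:E +oo%E c f z 1
    (leey _) ler01.
  exact: E (hf z zl).2.
split; first exact: premodelled_restrict pf.
have TE : @tstar_const R d s RS c a g C p' <= T by exact: ler_norm.
have S0 : 0 <= \sum_(z <- levels RS g) B z by apply: sumr_ge0.
have K0 : 0 <= 1 + 2 * T + \sum_(z <- levels RS g) B z.
  by rewrite addr_ge0// addr_ge0// mulr_ge0.
move=> z zl; split.
  have [_ E] := @Lp_normTP R d p' (fun x => `|restrict_below g f x z|) _ p'1
    (fun x => normr_ge0 (restrict_below g f x z)) K0.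
  apply: E; have := sobolev_local hd hs cg a1 ap' C0 hC gk pf hloc hinc gc zl.
  have t0 := @tstar_const_ge0 R d s RS c a g C p' C0 gk.
  by apply: Lle_widen => //; [rewrite mulr_ge0|lra].
have [_ E] := @increment_partP R d s RS P gamma r M setT p' +oo%E g
  (restrict_below g f) z _ (leey _) K0.
apply: E; apply: nearW => h hB.
apply: (le_trans (sobolev_increment hd hs cg a1 ap' C0 hC gk pf hloc hinc gc zl hB)).
rewrite lee_fin -/A; apply: (@le_trans _ _ (B z)).
  apply: le_trans (ler_norm _); rewrite ler_wpM2l//; last by rewrite ler_wpM2l.
  have C1 : 0 <= C by exact: ltW.
  by rewrite mulr_ge0 ?powR_ge0// mulr_ge0 ?exprn_ge0// mulr_ge0// addr_ge0// mulr_ge0.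
rewrite (bigD1_seq z)//= ?levels_uniq//.
have : 0 <= \sum_(i <- levels RS g | i != z) B i by apply: sumr_ge0.
by lra.
Qed.

Lemma bounded_embedding_lift p p' q c : (1 <= p)%E -> (p < p')%E -> (1 <= q)%E ->
  c < gamma - S%:R * (fine (p^-1)%E - fine (p'^-1)%E) -> ~ rs_hom RS c ->
  bounded_embedding M setT p q gamma p' q c.
Proof.
case: p => [a p1 ap' q1 ck hc|_|//]; last by rewrite ltNge leey.
have a1 : 1 <= a by rewrite -lee_fin.
have a0 : 0 < a := lt_le_trans ltr01 a1.
have p'1 : (1 <= p')%E by exact: le_trans (ltW ap').
move: ck; rewrite inver (gt_eqF a0)/= => ck.
(* The midpoint leaves room on both sides: [g < k] for the Sobolev step, which ends at exponent
   [+oo] in [h], and [c < g] for the descent that restores [q]. *)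
set k := gamma - _ in ck; pose g := (c + k) / 2.
have cg : c < g by rewrite /g; lra.
have gk : g < k by rewrite /g; lra.
have kc : k <= gamma.
  by rewrite /k gerBl mulr_ge0// subr_ge0; exact: fine_inve_le.
have gg : g <= gamma by exact/ltW/(lt_le_trans gk).
apply: (@bounded_embedding_comp _ _ _ _ _ _ _ _ _ _ _ _ p' +oo%E g).
- exact: ltW.
- apply: (@bounded_embedding_comp _ _ _ _ _ _ _ _ _ _ _ _ a%:E +oo%E gamma) => //.
    have [->|qoo] := eqVneq q +oo%E; last first.
      by apply: bounded_embedding_q => //; rewrite ltey.
    exists 1; split => // f K K0 [pf hf]; rewrite mul1r restrict_below_id//.
    exact: pf.1.
  exact: bounded_embedding_sobolev.
- by apply: bounded_embedding_lower => //; exact: leey.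
Qed.

End sobolev_embedding.

(** * Continuity of the embedding *)

Section continuity.
Context {R : realType} {d : nat} {s : 'I_d -> nat}.
Context {RS : regularity_structure R} {P : polynomial_part s RS}.
Context {gamma : R} {r : nat} (M : model P gamma r).
Hypothesis hd : (0 < d)%N.
Hypothesis hs : forall i, (1 <= s i)%N.
Local Notation Rd := 'rV[R]_d.
Local Notation Gam := (md_Gamma M).
Local Notation mu := (@lebesgue_rV R d).
Implicit Types (p q : \bar R) (c : R) (f g : Rd -> rs_space RS) (D : set Rd).

(** Positive total mass makes the essential supremum of a nonnegative function nonnegative, which
    settles [q = +oo] in [increment_part_ge0]. *)
Lemma lebesgue_setT_gt0 : (0 < mu setT)%E.
Proof.
apply: (@lt_le_trans _ _ (mu (cball s 1))).
  by rewrite cball_vol// lte_fin vol_gt0.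
by apply: le_measure; rewrite ?inE//; exact: measurable_cball.
Qed.

Lemma local_part_ge0 D p f z : (0 <= local_part D p f z)%E.
Proof. exact: Lnorm_ge0. Qed.

Lemma increment_part_ge0 D p q c f z : (0 <= increment_part s Gam D p q c f z)%E.
Proof.
rewrite /increment_part /Lq_norm; case: q => [q||]//; first exact: poweR_ge0.
apply: ess_sup_gee; first exact: lebesgue_setT_gt0.
by apply: nearW => h; rewrite patchE; case: ifP => // _; exact: incr_norm_ge0.
Qed.

Lemma modelled_normE D p q c f : modelled_norm s Gam D p q c f =
  (\sum_(z <- levels RS c) (local_part D p f z + increment_part s Gam D p q c f z))%E.
Proof. by rewrite /modelled_norm fsbig_finite//; exact: finite_hom_below. Qed.

Lemma part_le_modelled_norm D p q c f z : z \in levels RS c ->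
  (local_part D p f z <= modelled_norm s Gam D p q c f)%E /\
  (increment_part s Gam D p q c f z <= modelled_norm s Gam D p q c f)%E.
Proof.
move=> zl; rewrite modelled_normE (bigD1_seq z)//= ?levels_uniq//.
have l0 i := local_part_ge0 D p f i; have i0 i := increment_part_ge0 D p q c f i.
have S0 : (0 <= \sum_(i <- levels RS c | i != z)
    (local_part D p f i + increment_part s Gam D p q c f i))%E.
  by apply: sume_ge0 => i _; rewrite adde_ge0.
split; apply: (@le_trans _ _ (local_part D p f z + increment_part s Gam D p q c f z)%E).
- by rewrite leeDl.
- by rewrite leeDl.
- by rewrite leeDr.
- by rewrite leeDl.
Qed.

Lemma modelled_in_bounded D p q c f : modelled_in s Gam D p q c f ->
  exists2 K, 0 < K & bounded_by M D p q c f K.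
Proof.
move=> [f1 f2].
pose F z : \bar R := (local_part D p f z + increment_part s Gam D p q c f z)%E.
have F0 z : (0 <= F z)%E by rewrite adde_ge0 ?local_part_ge0 ?increment_part_ge0.
have fin z : z \in levels RS c -> F z \is a fin_num.
  by move=> /mem_levels/f2[_ h1 h2]; rewrite ge0_fin_numE// lte_add_pinfty.
have S0 : 0 <= \sum_(z <- levels RS c) fine (F z).
  by apply: sumr_ge0 => z _; exact: fine_ge0.
exists (1 + \sum_(z <- levels RS c) fine (F z)); first by rewrite ltr_pwDl.
split; first by split => // z /f2[].
move=> z zl.
have Fz : (F z <= (1 + \sum_(z <- levels RS c) fine (F z))%:E)%E.
  rewrite -(fineK (fin z zl)) lee_fin (bigD1_seq z)//= ?levels_uniq//.
  have : 0 <= \sum_(i <- levels RS c | i != z) fine (F i).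
    by apply: sumr_ge0 => i _; exact: fine_ge0.
  by lra.
split; apply: le_trans Fz.
  by rewrite leeDl// increment_part_ge0.
by rewrite leeDr// local_part_ge0.
Qed.

Lemma bounded_modelled_in D p q c f K :
  bounded_by M D p q c f K -> modelled_in s Gam D p q c f.
Proof.
move=> [[f1 f2] f3]; split => // z hz; have [h1 h2] := f3 z ((mem_levels _ _ _).2 hz).
split; [exact: f2|exact: le_lt_trans h1 (ltry _)|exact: le_lt_trans h2 (ltry _)].
Qed.

Lemma strongly_measurableB (V : normedModType R) (u v : Rd -> V) :
  strongly_measurable u -> strongly_measurable v ->
  strongly_measurable (fun x => u x - v x).
Proof.
move=> [a [ha au]] [b [hb bv]]; exists (fun n x => a n x - b n x); split => [n|x]; last exact: cvgB.
have [fa ma] := ha n; have [fb mb] := hb n; split.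
  apply: (@sub_finite_set _ _ [set y - z | y in range (a n) & z in range (b n)]).
    by move=> _ [x _ <-]; exists (a n x); [exists x|exists (b n x) => //; exists x].
  exact: finite_image2.
move=> y; rewrite (_ : _ @^-1` _ = \bigcup_(z in range (b n))
    (a n @^-1` [set y + z] `&` b n @^-1` [set z])).
  by apply: fin_bigcup_measurable => // z _; exact: measurableI.
apply/seteqP; split => x /=.
  by move=> <-; exists (b n x); [exists x|split => //=; rewrite subrK].
by move=> [z _ [/= -> ->]]; rewrite addrK.
Qed.

Lemma premodelledB c f g : premodelled c f -> premodelled c g -> premodelled c (f - g).
Proof.
move=> [f1 f2] [g1 g2]; split => [x|z hz]; first exact: in_belowB.
by apply: strongly_measurableB; [exact: f2|exact: g2].
Qed.

Lemma bounded_embedding_in D p q c p' q' c' f :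
  bounded_embedding M D p q c p' q' c' -> modelled_in s Gam D p q c f ->
  modelled_in s Gam D p' q' c' (restrict_below c' f).
Proof.
move=> [C [C0 hC]] /modelled_in_bounded[K K0 hK].
exact: bounded_modelled_in (hC f K K0 hK).
Qed.

(** Restriction is linear and both functions are compared through the same [Gamma], so the bound is
    applied to [g - f]. *)
Lemma bounded_embedding_continuous D p q c p' q' c' :
  bounded_embedding M D p q c p' q' c' -> forall e : R, 0 < e -> exists2 dl : R, 0 < dl &
  forall f g, modelled_in s Gam D p q c f -> modelled_in s Gam D p q c g ->
    (modelled_norm s Gam D p q c (g - f)%R < dl%:E)%E ->
    (modelled_norm s Gam D p' q' c' (restrict_below c' g - restrict_below c' f)%R < e%:E)%E.
Proof.
move=> [C [C0 hC]] e e0; pose n : R := (size (levels RS c'))%:R.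
have n0 : 0 <= n by exact: ler0n.
have n1 : 0 < n + 1 by rewrite ltr_wpDl.
have B0 : 0 < 2 * C * (n + 1) by rewrite !mulr_gt0.
(* The target norm has two parts for each of its [n] levels, each at most [C * dl]; [n + 1] makes
   the inequality strict and avoids division by 0. *)
exists (e / (2 * C * (n + 1))); first exact: divr_gt0.
set dl := e / _; have dl0 : 0 < dl by exact: divr_gt0.
move=> f g [f1 f2] [g1 g2] hN.
have pu : premodelled c (g - f).
  by apply: premodelledB; split => // z; [move=> /g2[]|move=> /f2[]].
have bu : bounded_by M D p q c (g - f) dl.
  split => // z zl; have [h1 h2] := part_le_modelled_norm D p q (g - f) zl.
  by split; [exact: le_trans h1 (ltW hN)|exact: le_trans h2 (ltW hN)].
have [_ h] := hC _ _ dl0 bu.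
have -> : restrict_below c' g - restrict_below c' f = restrict_below c' (g - f).
  by apply/funext => x; rewrite /restrict_below /= dsum_belowB.
rewrite modelled_normE.
apply: (@le_lt_trans _ _ (\sum_(z <- levels RS c') (2 * (C * dl))%:E)%E).
  rewrite big_seq [leRHS]big_seq; apply: lee_sum => z zl; have [h1 h2] := h z zl.
  by rewrite mulr_natl mulr2n EFinD; exact: leeD.
have Cdl : 0 <= C * dl by exact/ltW/mulr_gt0.
rewrite sume_const; last by rewrite lee_fin mulr_ge0.
rewrite -EFinM lte_fin -/n.
rewrite (_ : n * (2 * (C * dl)) = e * (n / (n + 1))).
  by rewrite gtr_pMr// ltr_pdivrMr// mul1r ltrDl.
by rewrite /dl; field; rewrite !gt_eqF.
Qed.

Lemma bounded_embedding_embedded p q c p' q' c' :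
  bounded_embedding M setT p q c p' q' c' -> embedded s Gam p q c p' q' c'.
Proof.
move=> h; split=> [f|f hf e e0]; first exact: bounded_embedding_in.
have [dl dl0 H] := bounded_embedding_continuous h e0.
by exists dl => // g hg; exact: H.
Qed.

Lemma bounded_embedding_periodic_embedded (B : 'M[R]_d) p q c p' q' c' :
  bounded_embedding M (period_cell B) p q c p' q' c' ->
  periodic_embedded s Gam B p q c p' q' c'.
Proof.
move=> h; split=> [f [hf perf]|f [hf _] e e0].
  split; first exact: bounded_embedding_in h hf.
  by move=> x l hl; rewrite /restrict_below perf.
have [dl dl0 H] := bounded_embedding_continuous h e0.
by exists dl => // g [hg _]; exact: H.
Qed.

End continuity.

(** * Measurability and finite measure of a period cell *)

Section period_cell.
Context {R : realType} {d : nat}.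
Local Notation Rd := 'rV[R]_d.
Local Notation mu := (@lebesgue_rV R d).

Lemma measurable_mulmx (B : 'M[R]_d) : measurable_fun setT (fun x : Rd => x *m B).
Proof.
apply: measurable_fun_rV => i.
under eq_fun do rewrite mxE.
apply: measurable_sum => j; apply: measurable_funM => //.
exact: measurable_coord.
Qed.

(** For invertible [B], the cell is the preimage of the half-open unit cube under [x |-> x B^-1]. *)
Lemma measurable_period_cell (B : 'M[R]_d) : B \in unitmx -> measurable (period_cell B).
Proof.
move=> uB.
have -> : period_cell B = (fun x : Rd => x *m invmx B) @^-1`
    [set x : Rd | forall i, `[0, 1[%classic (x ord0 i)].
  apply/seteqP; split => x /=.
    by move=> [t ht ->] i; rewrite mulmxK// in_itv/=; exact: ht.
  move=> h; exists (x *m invmx B); last by rewrite mulmxKV.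
  by move=> i; have := h i; rewrite in_itv.
rewrite -[X in measurable X]setTI; apply: measurable_mulmx => //.
by apply: (@measurable_box R d (fun=> `[0, 1[%classic)) => i; exact: measurable_itv.
Qed.

(** The cell lies in the box whose half-sides are the column sums of the absolute values of the
    entries of [B]. *)
Lemma period_cell_bounded (B : 'M[R]_d) : B \in unitmx ->
  exists V : R, (mu (period_cell B) <= V%:E)%E.
Proof.
move=> uB; pose K (j : 'I_d) := \sum_(i < d) `|B i j|.
have K0 j : 0 <= K j by exact: sumr_ge0.
exists (\prod_(j < d) (K j - - K j)).
rewrite -(lebesgue_box (a := fun j => - K j) (b := K)); last first.
  by move=> j; rewrite (le_trans (y := 0))// oppr_le0.
apply: le_measure; rewrite ?inE.
- exact: measurable_period_cell.
- by apply: (@measurable_box R d (fun j => `[- K j, K j]%classic)) => i; exact: measurable_itv.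
move=> _ [t ht ->] j /=; rewrite in_itv/= -ler_norml mxE.
apply: (le_trans (ler_norm_sum _ _ _)); apply: ler_sum => i _.
have /andP[t0 t1] := ht i.
by rewrite normrM ger0_norm// ler_piMl// ltW.
Qed.

End period_cell.

Theorem theorem4p1 (R : realType) (d : nat) (hd : (0 < d)%N)
    (s : 'I_d -> nat) (hs : forall i, (1 <= s i)%N)
    (RS : regularity_structure R) (P : polynomial_part s RS)
    (gamma gamma' : R) (r : nat)
    (hr : forall zeta, hom_below RS gamma zeta -> `|zeta| < r%:R)
    (M : model P gamma r)
    (p p' q q' : \bar R)
    (hp : (1 <= p)%E) (hp' : (1 <= p')%E) (hq : (1 <= q)%E) (hq' : (1 <= q')%E)
    (hgamma : 0 < gamma) (hgamma' : 0 < gamma')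
    (gammaNA : ~ rs_hom RS gamma) (gamma'NA : ~ rs_hom RS gamma') :
  [/\ (q < q')%E -> p' = p -> gamma' = gamma ->
        embedded s (md_Gamma M) p q gamma p' q' gamma',
      (q' <= q)%E -> p' = p -> gamma' < gamma ->
        embedded s (md_Gamma M) p q gamma p' q' gamma',
      forall B : 'M[R]_d, B \in unitmx -> periodic_model M (lattice B) ->
        q' = q -> (p' < p)%E -> gamma' = gamma ->
        periodic_embedded s (md_Gamma M) B p q gamma p' q' gamma' &
      q' = q -> (p < p')%E ->
        gamma' < gamma - (scale_deg s)%:R * (fine (p^-1)%E - fine (p'^-1)%E) ->
        embedded s (md_Gamma M) p q gamma p' q' gamma'].
Proof.
split.
- move=> qq' -> ->; apply: bounded_embedding_embedded => //.
  exact: bounded_embedding_q.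
- move=> qq' -> gg; apply: bounded_embedding_embedded => //.
  exact: bounded_embedding_lower.
- move=> B uB _ -> pp -> ; apply: bounded_embedding_periodic_embedded => //.
  have [V hV] := period_cell_bounded uB.
  by apply: bounded_embedding_periodic hV _ => //; exact: measurable_period_cell.
- move=> -> pp gg; apply: bounded_embedding_embedded => //.
  exact: bounded_embedding_lift.
Qed.
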